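(* Let $\Gamma$ be a four block operator with superoptimal singular values $t_0,\dots,t_{d-1}$ such that $\|\Gamma\|_{\rm e}$ is less than the smallest nonzero superoptimal singular value, and let $\Phi$ be its superoptimal symbol. Let $a_0>a_1>\cdots>a_l$ be all the distinct nonzero superoptimal singular values of $\Gamma$. For a thematic factorization of $\Phi$ with indices $k_j$ put $$\nu_r=\sum_{\{j:\,t_j=a_r\}}k_j,\qquad 0\le r\le l.$$ Then the numbers $\nu_r$ do not depend on the choice of the thematic factorization of $\Phi$.
   Context: $\mathbb T$ is the unit circle; $H^2_-=L^2\ominus H^2$; $M_{k,l}$ is the space of $k\times l$ matrices; $\|F\|_\infty=\operatorname{ess\,sup}_{\zeta\in\mathbb T}\|F(\zeta)\|$. $s_j(A)$ is the distance from $A$ to the matrices (operators) of rank at most $j$; $\|T\|_{\rm e}$ is the essential norm. For $\varphi\in L^\infty$, $T_\varphi:H^2\to H^2$, $T_\varphi f=\mathbb P_+\varphi f$. Four block operator: $m=m_1+m_2$, $n=n_1+n_2$, $d=\min\{m_1,n_1\}$. For $\Phi=\begin{pmatrix}\Phi_{11}&\Phi_{12}\\ \Phi_{21}&\Phi_{22}\end{pmatrix}\in L^\infty(M_{m,n})$ with $\Phi_{11}$ of size $m_1\times n_1$ and $\Phi_{22}$ of size $m_2\times n_2$, $\Gamma_\Phi:H^2(\mathbb C^{n_1})\oplus L^2(\mathbb C^{n_2})\to H^2_-(\mathbb C^{m_1})\oplus L^2(\mathbb C^{m_2})$ is $\Gamma_\Phi f=\mathbb P^-\Phi f$, $\mathbb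 P^-$ the orthogonal projection onto $H^2_-(\mathbb C^{m_1})\oplus L^2(\mathbb C^{m_2})$. $\Phi$ is a symbol of $\Gamma$ if $\Gamma=\Gamma_\Phi$. Superoptimality: for $Q\in H^\infty(M_{m_1,n_1})$ put $\Phi_Q=\begin{pmatrix}\Phi_{11}-Q&\Phi_{12}\\ \Phi_{21}&\Phi_{22}\end{pmatrix}$. $\Omega_0$ is the set of $Q$ minimizing $\|\Phi_Q\|_\infty$, $\Omega_j$ the set of $Q\in\Omega_{j-1}$ minimizing $\operatorname{ess\,sup}_\zeta s_j(\Phi_Q(\zeta))$ over $\Omega_{j-1}$; superoptimal solutions are the elements of $\Omega_{d-1}$; $t_j=\operatorname{ess\,sup}_\zeta s_j(\Phi_Q(\zeta))$, $Q\in\Omega_j$, $0\le j\le d-1$, are the superoptimal singular values (depending only on $\Gamma_\Phi$). $\Phi$ is a superoptimal symbol of $\Gamma$ if $\Gamma=\Gamma_\Phi$ and $0$ is a superoptimal solution for $\Phi$ (unique under the hypotheses here). The hypothesis on $\|\Gamma\|_{\rm e}$ means $\|\Gamma\|_{\rm e}<t_j$ for every $j$ with $t_j\ne0$. Inner/outer: $\Theta\in H^\infty$ is inner if $\Theta(\zeta)$ is isometric a.e.; $F\in H^\infty(M_{k,l})$ is outer if $FH^2(\mathbb C^l)$ is dense in $H^2(\mathbb C^k)$, co-outer if $F^t$ is outer. Thematic functions: a thematic function with block sizes $(p,q)$ is a unitary-valued measurable $(p+q)\times(p+q)$ matrix function of the form $\begin{pmatrix}v_1&\overline{V_c}&\star\\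 v_2&0&\star\end{pmatrix}$, where $v_1\in H^\infty(\mathbb C^p)$ is a co-outer column, $v_2\in L^\infty(\mathbb C^q)$, $V_c\in H^\infty(M_{p,p-1})$ is inner and co-outer (empty if $p=1$), and the last $q$ columns are arbitrary. Thematic factorization of the superoptimal symbol $\Phi$: a factorization $\Phi=W_0^*W_1^*\cdots W_{d-1}^*\,D\,V_{d-1}^*\cdots V_1^*V_0^*$ with $D=\begin{pmatrix}\operatorname{diag}(t_0u_0,\dots,t_{d-1}u_{d-1})&0\\ 0&\star\end{pmatrix}$ ($\star$ a bounded function of size $(m-d)\times(n-d)$), $u_j$ unimodular functions with $T_{u_j}$ Fredholm and $\operatorname{ind}T_{u_j}>0$, $V_j=\begin{pmatrix}I_j&0\\0&\breve V_j\end{pmatrix}$, $W_j=\begin{pmatrix}I_j&0\\0&\breve W_j\end{pmatrix}$, where $\breve V_j$ is thematic with block sizes $(n_1-j,n_2)$ and $\breve W_j^t$ has the form of a thematic function with block sizes $(m_1-j,m_2)$. Its indices are $k_j=\operatorname{ind}T_{u_j}=\dim\operatorname{Ker}T_{u_j}$, defined for $t_j\neq0$. *)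

(* Defs.v *)
From HB Require Import structures.
From mathcomp Require Import all_boot all_order all_algebra.
From mathcomp Require Import spectral complex.
From mathcomp Require Import all_classical all_reals all_analysis.
From mathcomp Require Import ess_sup_inf.

Set Implicit Arguments.
Unset Strict Implicit.
Unset Printing Implicit Defensive.

Import Order.TTheory GRing.Theory Num.Theory.
Import numFieldNormedType.Exports.

Local Open Scope classical_set_scope.
Local Open Scope ring_scope.

(** A function [f] on the unit circle is represented by [x |-> f(e^{2 pi i x})],
    [x] in [[0, 1[]; only the values on [[0, 1[] matter.  Elements of Lebesgue
    spaces are represented by functions, and equality in these spaces is
    equality [circ]-almost everywhere. *)

Section Matrices.
Context {R : realType}.
Local Notation C := R[i].

Definition vnorm n (v : 'cV[C]_n) : R :=
  Num.sqrt (\sum_(i < n) (complex.Re (v i 0) ^+ 2 + complex.Im (v i 0) ^+ 2)).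

Definition opnorm m n (A : 'M[C]_(m, n)) : R :=
  sup [set vnorm (A *m v) | v in [set v | vnorm v <= 1]].

(* the distance from [A] to the matrices of rank at most [j] *)
Definition sval_mx m n (j : nat) (A : 'M[C]_(m, n)) : R :=
  inf [set opnorm (A - B) | B in [set B : 'M[C]_(m, n) | (\rank B <= j)%N]].

Definition conj_mx m n (A : 'M[C]_(m, n)) : 'M[C]_(m, n) := map_mx Num.conj A.

Definition adjmx m n (A : 'M[C]_(m, n)) : 'M[C]_(n, m) := conj_mx A^T.

End Matrices.

Section Circle.
Context {R : realType}.
Local Notation C := R[i].

Definition circ : {measure set (measurableTypeR R) -> \bar R} :=
  mrestr (@lebesgue_measure R) (measurable_itv `[0%R, 1%R[).

Definition ae_eq_fun (V : Type) (f g : R -> V) : Prop :=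
  {ae circ, forall x, f x = g x}.

Definition measurable_mx m n (F : R -> 'M[C]_(m, n)) : Prop :=
  forall i j,
    measurable_fun (setT : set (measurableTypeR R)) (fun x => complex.Re (F x i j)) /\
    measurable_fun (setT : set (measurableTypeR R)) (fun x => complex.Im (F x i j)).

Definition cintegral (f : R -> C) : C :=
  Complex (Rintegral circ setT (fun x => complex.Re (f x)))
          (Rintegral circ setT (fun x => complex.Im (f x))).

Definition cis (a : R) : C := Complex (cos a) (sin a).

Definition fourier_coef (f : R -> C) (k : int) : C :=
  cintegral (fun x => f x * cis (- (2 * pi * k%:~R * x))).

Definition ess_norm_mx m n (F : R -> 'M[C]_(m, n)) : \bar R :=
  ess_sup circ (fun x => (opnorm (F x))%:E).

Definition ess_sval m n (j : nat) (F : R -> 'M[C]_(m, n)) : \bar R :=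
  ess_sup circ (fun x => (sval_mx j (F x))%:E).

Definition Linf m n (F : R -> 'M[C]_(m, n)) : Prop :=
  measurable_mx F /\ (ess_norm_mx F < +oo)%E.

Definition Hinf m n (F : R -> 'M[C]_(m, n)) : Prop :=
  Linf F /\
  forall i j (k : int), k < 0 -> fourier_coef (fun x => F x i j) k = 0.

Definition norm2 n (f : R -> 'cV[C]_n) : \bar R :=
  Lnorm circ 2%:E (fun x => (vnorm (f x))%:E).

Definition inner2 n (f g : R -> 'cV[C]_n) : C :=
  cintegral (fun x => \sum_(i < n) f x i 0 * (g x i 0)^*).

Definition L2 n : set (R -> 'cV[C]_n) :=
  [set f | measurable_mx f /\ (norm2 f < +oo)%E].

Definition H2 n : set (R -> 'cV[C]_n) :=
  [set f | L2 f /\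
    forall i (k : int), k < 0 -> fourier_coef (fun x => f x i 0) k = 0].

(* the orthogonal complement of [H2] in [L2] *)
Definition H2minus n : set (R -> 'cV[C]_n) :=
  [set f | L2 f /\ forall g, H2 g -> inner2 f g = 0].

Definition dsum n1 n2 (A : set (R -> 'cV[C]_n1)) (B : set (R -> 'cV[C]_n2)) :
    set (R -> 'cV[C]_(n1 + n2)) :=
  [set f | A (fun x => usubmx (f x)) /\ B (fun x => dsubmx (f x))].

(* a representative of the orthogonal projection of [f] onto [A] *)
Definition proj2 n (A : set (R -> 'cV[C]_n)) (f : R -> 'cV[C]_n) :
    R -> 'cV[C]_n :=
  xget (fun=> 0) [set g | A g /\
    forall h, A h -> inner2 (fun x => f x - g x) h = 0].

End Circle.
Arguments circ R : clear implicits.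
Arguments L2 {R} n.
Arguments H2 {R} n.
Arguments H2minus {R} n.

(** Operators between subspaces [A], [B] of [L2], given by their action on
    representatives. *)
Section Operators.
Context {R : realType} {n m : nat}.
Local Notation C := R[i].
Implicit Types (A : set (R -> 'cV[C]_n)) (B : set (R -> 'cV[C]_m))
  (T K : (R -> 'cV[C]_n) -> (R -> 'cV[C]_m)).

Definition opnorm2 A T : \bar R :=
  ereal_sup [set norm2 (T f) | f in [set f | A f /\ (norm2 f <= 1)%E]].

Definition linear_op A B K : Prop :=
  [/\ forall f, A f -> B (K f),
      forall f g, A f -> A g -> ae_eq_fun f g -> ae_eq_fun (K f) (K g) &
      forall (c : C) f g, A f -> A g ->
        ae_eq_fun (K (fun x => c *: f x + g x))
                  (fun x => c *: K f x + K g x)].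

Definition compact_op A B K : Prop :=
  linear_op A B K /\
  forall f : nat -> R -> 'cV[C]_n,
    (forall i, A (f i)) ->
    (exists M : R, forall i, (norm2 (f i) <= M%:E)%E) ->
    exists s : nat -> nat, {homo s : i j / (i < j)%N} /\
    exists2 g, B g &
      norm2 (fun x => K (f (s i)) x - g x) @[i --> \oo] --> 0%E.

Definition essential_norm A B T : \bar R :=
  ereal_inf [set opnorm2 A (fun f x => T f x - K f x) | K in compact_op A B].

Definition ker_op A T : set (R -> 'cV[C]_n) :=
  [set f | A f /\ ae_eq_fun (T f) (fun=> 0)].

Definition range_op A B T : set (R -> 'cV[C]_m) :=
  [set g | B g /\ exists2 f, A f & ae_eq_fun (T f) g].

Definition closed2 B : Prop :=
  forall (f : nat -> R -> 'cV[C]_m) g, (forall i, B (f i)) -> L2 m g ->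
    norm2 (fun x => f i x - g x) @[i --> \oo] --> 0%E -> B g.

End Operators.

(* [dim (A / (A `&` N)) = k], for subspaces [A] and [N] of functions *)
Definition dim_quotient (R : realType) n (A N : set (R -> 'cV[R[i]]_n))
    (k : nat) : Prop :=
  exists e : 'I_k -> R -> 'cV[R[i]]_n,
    [/\ forall i, A (e i),
        forall c : 'I_k -> R[i],
          N (fun x => \sum_(i < k) c i *: e i x) -> forall i, c i = 0 &
        forall f, A f -> exists c : 'I_k -> R[i],
          N (fun x => f x - \sum_(i < k) c i *: e i x)].

(* [T : A -> B] is Fredholm of index [k]; the kernel is counted modulo
   functions vanishing almost everywhere *)
Definition fredholm_index (R : realType) n m
    (A : set (R -> 'cV[R[i]]_n)) (B : set (R -> 'cV[R[i]]_m))
    (T : (R -> 'cV[R[i]]_n) -> (R -> 'cV[R[i]]_m)) (k : int) : Prop :=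
  closed2 (range_op A B T) /\
  exists a b : nat,
    [/\ dim_quotient (ker_op A T) [set f | ae_eq_fun f (fun=> 0)] a,
        dim_quotient B (range_op A B T) b &
        k = a%:Z - b%:Z].

(* scalar functions are viewed as functions with values in ['cV_1] *)
Definition toeplitz (R : realType) (phi : R -> R[i]) (f : R -> 'cV[R[i]]_1) :
    R -> 'cV[R[i]]_1 :=
  proj2 (H2 1) (fun x => phi x *: f x).

Definition toeplitz_index (R : realType) (phi : R -> R[i]) (k : int) : Prop :=
  fredholm_index (H2 1) (H2 1) (toeplitz phi) k.

Section FourBlock.
Context {R : realType} {m1 m2 n1 n2 : nat}.
Local Notation C := R[i].
Implicit Types (Phi : R -> 'M[C]_(m1 + m2, n1 + n2)) (Q : R -> 'M[C]_(m1, n1)).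

Definition fb_dom : set (R -> 'cV[C]_(n1 + n2)) := dsum (H2 n1) (L2 n2).

Definition fb_cod : set (R -> 'cV[C]_(m1 + m2)) := dsum (H2minus m1) (L2 m2).

Definition four_block Phi (f : R -> 'cV[C]_(n1 + n2)) :
    R -> 'cV[C]_(m1 + m2) :=
  proj2 fb_cod (fun x => Phi x *m f x).

Definition is_symbol Phi (G : (R -> 'cV[C]_(n1 + n2)) -> R -> 'cV[C]_(m1 + m2))
    : Prop :=
  Linf Phi /\
  forall f, fb_dom f -> fb_cod (G f) /\ ae_eq_fun (G f) (four_block Phi f).

Definition sub_block Phi Q : R -> 'M[C]_(m1 + m2, n1 + n2) :=
  fun x => block_mx (ulsubmx (Phi x) - Q x) (ursubmx (Phi x))
                    (dlsubmx (Phi x)) (drsubmx (Phi x)).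

Definition minimizers (S : set (R -> 'M[C]_(m1, n1)))
    (F : (R -> 'M[C]_(m1, n1)) -> \bar R) : set (R -> 'M[C]_(m1, n1)) :=
  [set Q | S Q /\ forall Q', S Q' -> (F Q <= F Q')%E].

Fixpoint Omega Phi (j : nat) : set (R -> 'M[C]_(m1, n1)) :=
  match j with
  | 0 => minimizers (@Hinf R m1 n1) (fun Q => ess_norm_mx (sub_block Phi Q))
  | j'.+1 => minimizers (Omega Phi j')
               (fun Q => ess_sval j'.+1 (sub_block Phi Q))
  end.

Definition superopt_sval Phi (j : nat) (t : R) : Prop :=
  exists2 Q, Omega Phi j Q & ess_sval j (sub_block Phi Q) = t%:E.

Definition superopt_symbol Phi
    (G : (R -> 'cV[C]_(n1 + n2)) -> R -> 'cV[C]_(m1 + m2)) : Prop :=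
  is_symbol Phi G /\ Omega Phi (minn m1 n1).-1 (fun=> 0).

End FourBlock.

Section Thematic.
Context {R : realType}.
Local Notation C := R[i].

Definition inner_fun k l (F : R -> 'M[C]_(k, l)) : Prop :=
  Hinf F /\ {ae circ R, forall x, adjmx (F x) *m F x = 1%:M}.

Definition outer_fun k l (F : R -> 'M[C]_(k, l)) : Prop :=
  Hinf F /\
  forall g, H2 k g -> forall eps : R, 0 < eps ->
    exists2 f, H2 l f & (norm2 (fun x => F x *m f x - g x)%R < eps%:E)%E.

Definition coouter_fun k l (F : R -> 'M[C]_(k, l)) : Prop :=
  outer_fun (fun x => (F x)^T).

(* thematic functions with block sizes [(p.+1, q)] *)
Definition thematic p q (U : R -> 'M[C]_(p.+1 + q)) : Prop :=
  [/\ measurable_mx U,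
      {ae circ R, forall x, U x \is unitarymx} &
      exists (v1 : R -> 'cV[C]_p.+1) (v2 : R -> 'cV[C]_q)
             (Vc : R -> 'M[C]_(p.+1, p))
             (S1 : R -> 'M[C]_(p.+1, q)) (S2 : R -> 'M[C]_q),
      [/\ Hinf v1 /\ coouter_fun v1,
          Linf v2,
          inner_fun Vc /\ coouter_fun Vc &
          ae_eq_fun U (fun x => block_mx (row_mx (v1 x) (conj_mx (Vc x))) (S1 x)
                                         (row_mx (v2 x) 0) (S2 x))]].

(* [V] is the identity of size [j] followed by a thematic function with block
   sizes [(n1 - j, n2)]; the equation [e] forces [p.+1 = n1 - j] *)
Definition thematic_factor n1 n2 (j : nat) (V : R -> 'M[C]_(n1 + n2)) : Prop :=
  exists (p : nat) (e : (j + (p.+1 + n2) = n1 + n2)%N)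
         (B : R -> 'M[C]_(p.+1 + n2)),
    thematic B /\
    ae_eq_fun V (fun x => castmx (e, e) (block_mx 1%:M 0 0 (B x))).

Definition unimodular (u : R -> C) : Prop :=
  measurable_mx (fun x => (u x)%:M : 'M[C]_1) /\
  {ae circ R, forall x, `|u x| = 1}.

(* the equations [em], [en] only cast the sizes of the blocks; note that
   [minn m1 n1 <= m1 + m2, n1 + n2] *)
Definition thematic_middle m1 m2 n1 n2 (t : 'I_(minn m1 n1) -> R)
    (u : 'I_(minn m1 n1) -> R -> C)
    (D : R -> 'M[C]_(m1 + m2, n1 + n2)) : Prop :=
  exists (em : (minn m1 n1 + (m1 + m2 - minn m1 n1) = m1 + m2)%N)
         (en : (minn m1 n1 + (n1 + n2 - minn m1 n1) = n1 + n2)%N)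
         (S : R -> 'M[C]_(m1 + m2 - minn m1 n1, n1 + n2 - minn m1 n1)),
    Linf S /\
    ae_eq_fun D (fun x => castmx (em, en)
      (block_mx (diag_mx (\row_j (real_complex R (t j) * u j x))) 0 0 (S x))).

(* the factors in [\prod] appear from left to right in increasing order of the
   index, whence [rev_ord] for the product of the [V_j^*] *)
Definition thematic_factorization m1 m2 n1 n2
    (Phi : R -> 'M[C]_(m1 + m2, n1 + n2)) (t : 'I_(minn m1 n1) -> R)
    (u : 'I_(minn m1 n1) -> R -> C)
    (W : 'I_(minn m1 n1) -> R -> 'M[C]_(m1 + m2))
    (V : 'I_(minn m1 n1) -> R -> 'M[C]_(n1 + n2))
    (D : R -> 'M[C]_(m1 + m2, n1 + n2)) : Prop :=
  [/\ forall j, unimodular (u j) /\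
        exists2 k : int, toeplitz_index (u j) k & 0 < k,
      forall j : 'I_(minn m1 n1), thematic_factor j (V j),
      forall j : 'I_(minn m1 n1), thematic_factor j (fun x => (W j x)^T),
      thematic_middle t u D &
      ae_eq_fun Phi (fun x =>
        (\prod_(j < minn m1 n1) adjmx (W j x)) *m D x *m
        (\prod_(j < minn m1 n1) adjmx (V (rev_ord j) x)))].

End Thematic.

(* Main.v *)
Require Import Defs.
From HB Require Import structures.
From mathcomp Require Import all_boot all_order all_algebra.
From mathcomp Require Import spectral complex.
From mathcomp Require Import all_classical all_reals all_analysis.
From mathcomp Require Import ess_sup_inf measurable_realfun ring lra zify.

(** Let [X = H2 (+) L2] and [Y = H2- (+) L2], and for [Z = {a_0, ..., a_r}] let [N_Z] be
    the space of all [f] in [X] with [Phi f] in [Y] that are sums of eigenfunctions of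
    multiplication by [Phi^* Phi] with eigenvalues [s ^ 2], [s] in [Z]. It is defined by
    [Phi] alone, and its dimension is the sum of the indices [k_j] with [t_j >= a_r] for
    every thematic factorization of [Phi]; the difference of these sums for [r] and
    [r - 1] is [nu_r].

    To compute the dimension, peel off the factors one at a time. If
    [Phi = W^* diag (t u, Phi_1) V^*], [|Phi| <= t] and [t] is in [Z], then dropping the
    first component of [V^* f] maps [N_Z] onto the corresponding space for [Phi_1], with
    kernel isomorphic to [Ker T_u]. Surjectivity uses that [T_u] is onto, as its index
    is positive (Coburn), that [V] and [W] are built from co-outer functions (density),
    and that only finitely many singular values of [Gamma] exceed a number below [t],
    by the bound on the essential norm (closed range). When the Hardy components on one
    side are exhausted, the space is invariant under a shift, and the same finiteness
    forces it to be zero; it is also zero once [|Phi| < s] for all [s] in [Z]. The bound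
    [|Phi^(j)| <= t_j] for the successive quotients comes from [s_j (Phi) <= t_j]. *)

(** Every value peeled off before the stopping stage has to lie in [Z]: [Phi^* Phi] acts on the
    first component of [V^* f] as [t ^ 2], so for [t] outside [Z] the elements of [N_Z] have no
    first component, and the lifts constructed below would not belong to [N_Z]. This is why [Z] is
    an initial segment and [nu_r] only a difference. The obstacle is that lifts must be exact. For
    [h] in the space of [Phi_1] some [f] in [X] is needed with second component [h] and [Phi f] in
    [Y], and density yields approximations only. The remedy is to lift pairs [(h, y)] to pairs
    [(f, z)] in [X] and [Y] with first components related by [z_1 = t u f_1]; for [y = Phi_1 h] this
    says [z = Phi f]. Up to finitely many dimensions first components are controlled by second ones,
    because [Phi] stretches the former by [t] while the compression stretches by at most [tau < t].
    The same lifts carry this finiteness over to [Phi_1], so one [tau] below the least nonzero value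
    serves at all stages. *)

Set Implicit Arguments.
Unset Strict Implicit.
Unset Printing Implicit Defensive.

Import Order.TTheory GRing.Theory Num.Theory.
Import numFieldNormedType.Exports.

Local Open Scope classical_set_scope.
Local Open Scope ring_scope.

(** * Hilbert spaces *)

Section ComplexNumbers.
Context {R : realType}.
Local Notation C := R[i].
Implicit Types z w : C.

Definition cn2 z : R := complex.Re z ^+ 2 + complex.Im z ^+ 2.

Lemma ReD z w : complex.Re (z + w) = complex.Re z + complex.Re w.
Proof. by case: z; case: w. Qed.

Lemma ImD z w : complex.Im (z + w) = complex.Im z + complex.Im w.
Proof. by case: z; case: w. Qed.

Lemma ReN z : complex.Re (- z) = - complex.Re z. Proof. by case: z. Qed.

Lemma ImN z : complex.Im (- z) = - complex.Im z. Proof. by case: z. Qed.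

Lemma ReM z w : complex.Re (z * w) =
  complex.Re z * complex.Re w - complex.Im z * complex.Im w.
Proof. by case: z; case: w. Qed.

Lemma ImM z w : complex.Im (z * w) =
  complex.Re z * complex.Im w + complex.Im z * complex.Re w.
Proof. by case: z; case: w. Qed.

Lemma ReJ z : complex.Re z^* = complex.Re z. Proof. by case: z. Qed.

Lemma ImJ z : complex.Im z^* = - complex.Im z. Proof. by case: z. Qed.

Definition cE := (ReD, ImD, ReN, ImN, ReM, ImM, ReJ, ImJ).

Lemma cjD z w : (z + w)^* = z^* + w^*. Proof. exact: rmorphD. Qed.

Lemma cjM z w : (z * w)^* = z^* * w^*. Proof. exact: rmorphM. Qed.

Lemma cjN z : (- z)^* = - z^*. Proof. exact: rmorphN. Qed.

Lemma cj0 : 0^* = 0 :> C. Proof. exact: rmorph0. Qed.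

Lemma cj1 : 1^* = 1 :> C. Proof. exact: rmorph1. Qed.

Lemma cjK z : z^*^* = z. Proof. exact: conjCK. Qed.

Lemma cj_sum (I : Type) (r : seq I) (P : pred I) (F : I -> C) :
  (\sum_(i <- r | P i) F i)^* = \sum_(i <- r | P i) (F i)^*.
Proof. exact: rmorph_sum. Qed.

Lemma complex_eq z w :
  complex.Re z = complex.Re w -> complex.Im z = complex.Im w -> z = w.
Proof. by case: z w => ? ? [? ?] /= -> ->. Qed.

Lemma cn2_ge0 z : 0 <= cn2 z.
Proof. by rewrite addr_ge0 ?sqr_ge0. Qed.

Lemma cn2_eq0 z : cn2 z = 0 -> z = 0.
Proof.
move=> /eqP; rewrite paddr_eq0 ?sqr_ge0// !sqrf_eq0 => /andP[/eqP h1 /eqP h2].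
exact: complex_eq.
Qed.

Lemma cn2_0 : cn2 0 = 0. Proof. by rewrite /cn2 /= expr0n addr0. Qed.

Lemma cn2_1 : cn2 1 = 1. Proof. by rewrite /cn2 /= expr0n addr0 expr1n. Qed.

Lemma cn2M z w : cn2 (z * w) = cn2 z * cn2 w.
Proof. by rewrite /cn2 !cE; ring. Qed.

Lemma cn2N z : cn2 (- z) = cn2 z.
Proof. by rewrite /cn2 !cE !sqrrN. Qed.

Lemma cn2J z : cn2 z^* = cn2 z.
Proof. by rewrite /cn2 !cE sqrrN. Qed.

Lemma cn2D_le z w : cn2 (z + w) <= 2 * cn2 z + 2 * cn2 w.
Proof.
rewrite /cn2 !cE.
have := sqr_ge0 (complex.Re z - complex.Re w).
by have := sqr_ge0 (complex.Im z - complex.Im w); nra.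
Qed.

Lemma mulcJ z : z * z^* = (cn2 z)%:C%C.
Proof. by apply: complex_eq; rewrite !cE /= ?/cn2; ring. Qed.

Lemma cn2_norm z : (cn2 z)%:C%C = `|z| ^+ 2.
Proof. by rewrite /cn2 add_Re2_Im2. Qed.

Lemma cn2_norm1 z : `|z| = 1 -> cn2 z = 1.
Proof. by move=> h; apply/complexI; rewrite cn2_norm h expr1n. Qed.

End ComplexNumbers.

Section Hilbert.
Context {R : realType}.
Local Notation C := R[i].

(** Completeness is required only for sequences with steps of norm at most [2^-k]. All limits below
    are taken along such sequences, and for L2 this rate makes the functions converge almost
    everywhere without passing to a subsequence. *)
Structure hilb := Hilb {
  hcar :> lmodType C;
  ip : hcar -> hcar -> C;
  ip_linl : forall (c : C) x y z, ip (c *: x + y) z = c * ip x z + ip y z;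
  ip_conj : forall x y, ip y x = (ip x y)^*;
  ip_ge0 : forall x, 0 <= complex.Re (ip x x);
  ip_eq0 : forall x, complex.Re (ip x x) = 0 -> x = 0;
  ip_complete : forall f : nat -> hcar,
    (forall k, complex.Re (ip (f k.+1 - f k) (f k.+1 - f k)) <= 4^-1 ^+ k) ->
    exists g, forall e : R, 0 < e -> exists N, forall k, (N <= k)%N ->
      complex.Re (ip (g - f k) (g - f k)) < e }.

Definition nsq (H : hilb) (x : H) : R := complex.Re (ip x x).

Section Basic.
Variable H : hilb.
Implicit Types (x y z : H) (c : C).

Lemma ipDl x y z : ip (x + y) z = ip x z + ip y z.
Proof. by have := ip_linl 1 x y z; rewrite scale1r mul1r. Qed.

Lemma ip0l z : ip 0 z = 0.
Proof. by apply: (addIr (ip (0 : H) z)); rewrite -ipDl !add0r. Qed.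

Lemma ipZl c x z : ip (c *: x) z = c * ip x z.
Proof. by have := ip_linl c x 0 z; rewrite addr0 ip0l addr0. Qed.

Lemma ipNl x z : ip (- x) z = - ip x z.
Proof. by rewrite -scaleN1r ipZl mulN1r. Qed.

Lemma ipBl x y z : ip (x - y) z = ip x z - ip y z.
Proof. by rewrite ipDl ipNl. Qed.

Lemma ipDr x y z : ip z (x + y) = ip z x + ip z y.
Proof. by rewrite ip_conj ipDl cjD -!ip_conj. Qed.

Lemma ip0r z : ip z 0 = 0.
Proof. by rewrite ip_conj ip0l cj0. Qed.

Lemma ipZr c x z : ip z (c *: x) = c^* * ip z x.
Proof. by rewrite ip_conj ipZl cjM -ip_conj. Qed.

Lemma ipNr x z : ip z (- x) = - ip z x.
Proof. by rewrite ip_conj ipNl cjN -ip_conj. Qed.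

Lemma ip_suml (I : Type) (r : seq I) (P : pred I) (F : I -> H) z :
  ip (\sum_(i <- r | P i) F i) z = \sum_(i <- r | P i) ip (F i) z.
Proof.
by apply: (big_morph (fun x => ip x z)) => [x y|]; rewrite ?ipDl ?ip0l.
Qed.

Lemma ip_sumr (I : Type) (r : seq I) (P : pred I) (F : I -> H) z :
  ip z (\sum_(i <- r | P i) F i) = \sum_(i <- r | P i) ip z (F i).
Proof. by apply: (big_morph (ip z)) => [x y|]; rewrite ?ipDr ?ip0r. Qed.

Lemma nsq_ge0 x : 0 <= nsq x. Proof. exact: ip_ge0. Qed.

Lemma nsq_eq0 x : nsq x = 0 -> x = 0. Proof. exact: ip_eq0. Qed.

Lemma nsq_le0 x : nsq x <= 0 -> x = 0.
Proof. by move=> h; apply/nsq_eq0/eqP; rewrite eq_le h nsq_ge0. Qed.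

Lemma nsq0 : nsq (0 : H) = 0. Proof. by rewrite /nsq ip0l. Qed.

Lemma nsq_gt0 x : x != 0 -> 0 < nsq x.
Proof.
by move=> x0; rewrite lt_def nsq_ge0 andbT; apply/eqP => /nsq_eq0/eqP; exact/negP.
Qed.

Lemma ipxx x : ip x x = (nsq x)%:C%C.
Proof.
apply: complex_eq => //=; have /(congr1 (@complex.Im R)) := ip_conj x x.
by rewrite ImJ => h; lra.
Qed.

Lemma nsqD x y : nsq (x + y) = nsq x + nsq y + 2 * complex.Re (ip x y).
Proof. by rewrite /nsq ipDl !ipDr !ReD (ip_conj x y) ReJ; ring. Qed.

Lemma nsqN x : nsq (- x) = nsq x.
Proof. by rewrite /nsq ipNl ipNr opprK. Qed.

Lemma nsqB x y : nsq (x - y) = nsq x + nsq y - 2 * complex.Re (ip x y).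
Proof. by rewrite nsqD nsqN ipNr ReN mulrN. Qed.

Lemma nsqC x y : nsq (x - y) = nsq (y - x).
Proof. by rewrite -nsqN opprB. Qed.

Lemma nsqZ c x : nsq (c *: x) = cn2 c * nsq x.
Proof. by rewrite {1}/nsq ipZl ipZr mulrA mulcJ ipxx !cE /= mul0r subr0. Qed.

Lemma nsqD_le x y : nsq (x + y) <= 2 * nsq x + 2 * nsq y.
Proof. by have := nsq_ge0 (x - y); rewrite nsqB nsqD; lra. Qed.

Lemma nsqB_le x y : nsq (x - y) <= 2 * nsq x + 2 * nsq y.
Proof. by rewrite -(nsqN y); exact: nsqD_le. Qed.

Lemma nsq_orth x y : ip x y = 0 -> nsq (x + y) = nsq x + nsq y.
Proof. by move=> h; rewrite nsqD h mulr0 addr0. Qed.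

Lemma nsq_tri x y z : nsq (x - z) <= 2 * nsq (x - y) + 2 * nsq (y - z).
Proof.
by have -> : x - z = (x - y) + (y - z); [rewrite addrA subrK|exact: nsqD_le].
Qed.

Lemma nsq_project x y : nsq y != 0 ->
  nsq (x - (ip x y / (nsq y)%:C%C) *: y) = nsq x - cn2 (ip x y) / nsq y.
Proof.
move=> y0; set w := ip x y.
have -> : w / (nsq y)%:C%C = ((nsq y)^-1)%:C%C * w.
  by rewrite mulrC fmorphV.
rewrite nsqB nsqZ ipZr -/w !cn2M cjM ReM !cE /= /cn2 /=.
by field.
Qed.

Lemma cauchy_schwarz x y : cn2 (ip x y) <= nsq x * nsq y.
Proof.
have [y0|y0] := eqVneq (nsq y) 0.
  by rewrite (nsq_eq0 y0) ip0r nsq0 mulr0 cn2_0.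
have := nsq_ge0 (x - (ip x y / (nsq y)%:C%C) *: y).
rewrite nsq_project// subr_ge0 ler_pdivrMr// lt_def y0 nsq_ge0//.
Qed.

Definition subsp (A : set H) := A 0 /\ forall c x y, A x -> A y -> A (c *: x + y).

Definition hclosed (A : set H) :=
  forall w, (forall e : R, 0 < e -> exists2 a, A a & nsq (w - a) < e) -> A w.

Definition hclosure (A : set H) : set H :=
  [set w | forall e : R, 0 < e -> exists2 a, A a & nsq (w - a) < e].

Section Subspace.
Variable A : set H.
Hypothesis sA : subsp A.

Lemma subsp0 : A 0. Proof. by case: sA. Qed.

Lemma subspD x y : A x -> A y -> A (x + y).
Proof. by case: sA => _ h Ax Ay; rewrite -[x]scale1r; apply: h. Qed.

Lemma subspZ c x : A x -> A (c *: x).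
Proof. by case: sA => A0 h Ax; rewrite -[_ *: _]addr0; apply: h. Qed.

Lemma subspN x : A x -> A (- x).
Proof. by move=> Ax; rewrite -scaleN1r; apply: subspZ. Qed.

Lemma subspB x y : A x -> A y -> A (x - y).
Proof. by move=> Ax Ay; apply: subspD => //; apply: subspN. Qed.

Lemma subsp_sum (I : Type) (r : seq I) (P : pred I) (F : I -> H) :
  (forall i, P i -> A (F i)) -> A (\sum_(i <- r | P i) F i).
Proof. by move=> h; apply: big_ind => //; [exact: subsp0|exact: subspD]. Qed.

Lemma subsp_closure : subsp (hclosure A).
Proof.
split=> [e e0|c x y hx hy e e0].
  by exists 0; [exact: subsp0|rewrite subrr nsq0].
have c0 := cn2_ge0 c.
have [|a Aa ha] := hx (e / (4 * (cn2 c + 1))).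
  by rewrite divr_gt0// mulr_gt0// ltr_wpDl.
have [|b Ab hb] := hy (e / 4); first by rewrite divr_gt0.
exists (c *: a + b); first by apply: subspD => //; apply: subspZ.
rewrite opprD addrACA -scalerBr; apply: le_lt_trans (nsqD_le _ _) _.
rewrite nsqZ.
have : cn2 c * nsq (x - a) <= e / 4.
  move: ha; rewrite ltr_pdivlMr ?mulr_gt0// ?ltr_wpDl// => ha.
  have := nsq_ge0 (x - a); nra.
by lra.
Qed.

End Subspace.

Lemma hclosed_closure (A : set H) : hclosed (hclosure A).
Proof.
move=> w h e e0; have [|a /= ha wa] := h (e / 4); first by rewrite divr_gt0.
have [|b Ab ab] := ha (e / 4); first by rewrite divr_gt0.
by exists b => //; apply: le_lt_trans (nsq_tri w a b) _; lra.
Qed.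

Lemma sub_hclosure (A : set H) x : A x -> hclosure A x.
Proof. by move=> Ax e e0; exists x => //; rewrite subrr nsq0. Qed.

Lemma hclosure_sub (A B : set H) : hclosed B -> (forall x, A x -> B x) ->
  forall x, hclosure A x -> B x.
Proof.
move=> cB AB x hx; apply: cB => e e0; have [a Aa xa] := hx _ e0.
by exists a => //; apply: AB.
Qed.

Lemma hclosed_ker (phi : H -> C) (M : R) :
  (forall x y, phi (x - y) = phi x - phi y) ->
  (forall x, cn2 (phi x) <= M * nsq x) -> hclosed [set x | phi x = 0].
Proof.
move=> phiB phiM w h; apply: cn2_eq0; apply/eqP; rewrite eq_le cn2_ge0 andbT.
apply/ler_addgt0Pl => e e0; rewrite addr0.
have [|a /= az wa] := h (e / (`|M| + 1)); first by rewrite divr_gt0// ltr_wpDl.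
have -> : phi w = phi (w - a) by rewrite phiB az subr0.
apply: le_trans (phiM _) _.
move: wa; rewrite ltr_pdivlMr ?ltr_wpDl// => wa.
by have := nsq_ge0 (w - a); have := ler_norm M; nra.
Qed.

Lemma hclosed_orth z : hclosed [set x | ip x z = 0].
Proof.
apply: (@hclosed_ker _ (nsq z)) => [x y|x]; first exact: ipBl.
by rewrite mulrC; exact: cauchy_schwarz.
Qed.

Lemma subsp_orth z : subsp [set x | ip x z = 0].
Proof.
by split=> [/=|c x y /= hx hy]; rewrite ?ip0l// ip_linl hx hy mulr0 addr0.
Qed.

Lemma geom_small (e : R) : 0 < e -> exists N, forall k, (N <= k)%N -> 4^-1 ^+ k < e.
Proof.
move=> e0; have h : (4^-1 : R) ^+ n @[n --> \oo] --> (0 : R).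
  by apply: cvg_expr; rewrite ger0_norm ?invr_ge0// invf_lt1// ltr1n.
move/cvgrPdist_lt: h => /(_ e e0)[N _ hN].
exists N => k Nk; have := hN k Nk.
by rewrite /= sub0r normrN ger0_norm// exprn_ge0// invr_ge0.
Qed.

Lemma cauchy_limit (A : set H) (f : nat -> H) : hclosed A -> (forall k, A (f k)) ->
  (forall k, nsq (f k.+1 - f k) <= 4^-1 ^+ k) ->
  exists2 g, A g & forall e : R, 0 < e -> exists N, forall k, (N <= k)%N ->
      nsq (g - f k) < e.
Proof.
move=> cA Af hf; have [g hg] := ip_complete hf; exists g => //.
by apply: cA => e e0; have [N hN] := hg e e0; exists (f N) => //; apply: hN.
Qed.

(** A minimizing sequence for the distance is Cauchy by the parallelogram law, and its limit is the
    projection. *)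
Lemma projection (A : set H) : subsp A -> hclosed A ->
  forall x, exists2 p, A p & forall a, A a -> ip (x - p) a = 0.
Proof.
move=> sA cA x.
pose D := [set nsq (x - a) | a in A].
have D0 : has_inf D.
  split; first by exists (nsq (x - 0)); exists 0 => //; apply: subsp0.
  by exists 0 => _ [a _ <-]; apply: nsq_ge0.
have infD a : A a -> inf D <= nsq (x - a).
  by move=> Aa; apply: ge_inf; [case: D0|exists a].
(* The slack allowed to the [k]-th near-minimizer. By the parallelogram law consecutive ones then
   differ by at most [5/8 * 4^-k] in square norm. *)
have q0 k : 0 < 4^-1 ^+ k / 4 :> R by rewrite divr_gt0// exprn_gt0 ?invr_gt0.
have ex k : exists a, A a /\ nsq (x - a) < inf D + 4^-1 ^+ k / 4.
  by have [_ [a Aa <-] h] := inf_adherent (q0 k) D0; exists a.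
have [f hf] := choice ex.
have fstep k : nsq (f k.+1 - f k) <= 4^-1 ^+ k.
  have [A1 h1] := hf k; have [A2 h2] := hf k.+1.
  have := infD (2^-1 *: (f k + f k.+1)).
  move=> /(_ (subspZ sA _ (subspD sA A1 A2))).
  have -> : x - 2^-1 *: (f k + f k.+1) =
     2^-1 *: ((x - f k) + (x - f k.+1)).
    rewrite addrACA -opprD scalerBr; congr (_ - _).
    have -> : x + x = (2 : C) *: x by rewrite scaler_nat mulr2n.
    by rewrite scalerA mulVf ?scale1r// pnatr_eq0.
  have -> : f k.+1 - f k = (x - f k) - (x - f k.+1).
    by rewrite opprB [RHS]addrC addrA subrK.
  rewrite nsqZ (nsqD (x - f k)) (nsqB (x - f k)).
  have -> : cn2 (2^-1 : C) = 4^-1.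
    apply: (@mulIf _ 4); first by rewrite pnatr_eq0.
    rewrite mulVf ?pnatr_eq0//.
    have -> : 4 = cn2 (2 : C) by rewrite /cn2 /=; ring.
    by rewrite -cn2M mulVf ?cn2_1// pnatr_eq0.
  move: h2; rewrite exprS => h2 h3.
  have := q0 k; lra.
have [|p Ap hp] := cauchy_limit cA _ fstep; first by move=> k; case: (hf k).
exists p => // a Aa.
have [na|na] := eqVneq (nsq a) 0; first by rewrite (nsq_eq0 na) ip0r.
have pa : 0 < nsq a by rewrite lt_def na nsq_ge0.
(* Moving from [f k] by the best multiple of [a] lowers the square distance by
   [cn2 (ip (x - f k) a) / nsq a], but not below the infimum. *)
have near k : cn2 (ip (x - f k) a) <= 4^-1 ^+ k * nsq a.
  have [A1 h1] := hf k.
  have := infD (f k + (ip (x - f k) a / (nsq a)%:C%C) *: a).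
  move=> /(_ (subspD sA A1 (subspZ sA _ Aa))).
  rewrite opprD addrA nsq_project// => h2.
  rewrite -ler_pdivrMr//; have := q0 k; lra.
apply: cn2_eq0; apply/eqP; rewrite eq_le cn2_ge0 andbT.
apply/ler_addgt0Pl => e e0; rewrite addr0.
have [|N1 h1] := hp (e / (4 * nsq a)); first by rewrite divr_gt0// mulr_gt0.
have [|N2 h2] := @geom_small (e / (4 * nsq a)); first by rewrite divr_gt0// mulr_gt0.
pose k := maxn N1 N2.
have {}h1 := h1 k (leq_maxl _ _); have {}h2 := h2 k (leq_maxr _ _).
have -> : ip (x - p) a = ip (x - f k) a - ip (p - f k) a.
  by rewrite -ipBl opprB addrA subrK.
apply: le_trans (cn2D_le _ _) _; rewrite cn2N.
have := cauchy_schwarz (p - f k) a; have := near k.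
move: h1 h2; rewrite !ltr_pdivlMr ?mulr_gt0//; nra.
Qed.

Lemma projection_best (A : set H) x p a : subsp A -> A p ->
  (forall a, A a -> ip (x - p) a = 0) -> A a -> nsq (x - p) <= nsq (x - a).
Proof.
move=> sA Ap hp Aa.
have -> : x - a = (x - p) + (p - a) by rewrite addrA subrK.
by rewrite (nsq_orth (x := x - p)) ?lerDl ?nsq_ge0//; apply: hp; apply: subspB.
Qed.

(** The difference of [w] and its projection onto the closure of [M] lies in [A] and is orthogonal
    to [M]. *)
Lemma dense_of_orth (M A : set H) : subsp M -> subsp A -> hclosed A ->
  (forall x, M x -> A x) ->
  (forall k, A k -> (forall m, M m -> ip k m = 0) -> k = 0) ->
  forall w, A w -> hclosure M w.
Proof.
move=> sM sA cA MA h w Aw.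
have [p Mp hp] := projection (subsp_closure sM) (@hclosed_closure M) w.
have Ap : A p by apply: hclosure_sub Mp.
suff /subr0_eq -> : w - p = 0 by [].
by apply: h => [|m Mm]; [exact: subspB|apply/hp/sub_hclosure].
Qed.

End Basic.
End Hilbert.
Arguments ip {R h}.

(** * Closed ranges of bounded operators *)

Section ClosedRange.
Context {R : realType}.
Local Notation C := R[i].

Definition hlin (H K : hilb (R := R)) (f : H -> K) :=
  forall (c : C) x y, f (c *: x + y) = c *: f x + f y.

Section Linear.
Variables (H K : hilb (R := R)) (f : H -> K).
Hypothesis lf : hlin f.

Lemma hlinD x y : f (x + y) = f x + f y.
Proof. by have := lf 1 x y; rewrite !scale1r. Qed.

Lemma hlin0 : f 0 = 0.
Proof. by apply: (addIr (f 0)); rewrite -hlinD !add0r. Qed.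

Lemma hlinZ c x : f (c *: x) = c *: f x.
Proof. by have := lf c x 0; rewrite !addr0 hlin0 addr0. Qed.

Lemma hlinN x : f (- x) = - f x.
Proof. by rewrite -scaleN1r hlinZ scaleN1r. Qed.

Lemma hlinB x y : f (x - y) = f x - f y.
Proof. by rewrite hlinD hlinN. Qed.

Lemma hlin_sum (I : Type) (r : seq I) (P : pred I) (F : I -> H) :
  f (\sum_(i <- r | P i) F i) = \sum_(i <- r | P i) f (F i).
Proof. by apply: (big_morph f) => [x y|]; [exact: hlinD|exact: hlin0]. Qed.

End Linear.

(** Replace [v] by its component [v'] orthogonal to [M]; if this is zero, nothing is added.
    Otherwise the coefficient [c] of a limit [w] is found by pairing with [v'], and removing the
    component along [v'] from an error [w - a] does not increase it. *)
Lemma hclosed_add_line (H : hilb (R := R)) (M : set H) (v : H) :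
  subsp M -> hclosed M ->
  hclosed [set w | exists c, exists2 m, M m & w = m + c *: v].
Proof.
move=> sM cM w hw.
have [m0 Mm0 hm0] := projection sM cM v.
pose v' := v - m0.
have [v0|v0] := eqVneq (nsq v') 0.
  have vE : v = m0 by apply: subr0_eq; exact: (nsq_eq0 v0).
  exists 0, w; last by rewrite scale0r addr0.
  apply: cM => e e0; have [_ [c [m Mm ->]] wa] := hw e e0.
  exists (m + c *: v) => //; apply: (subspD sM Mm); apply: subspZ => //.
  by rewrite vE.
pose c := ip w v' / (nsq v')%:C%C.
exists c, (w - c *: v); last by rewrite subrK.
have -> : w - c *: v = (w - c *: v') - c *: m0.
  by rewrite -addrA -opprD -scalerDr subrK.
apply: (subspB sM); last exact: subspZ.
apply: cM => e e0; have [_ [d [m Mm ->]] wa] := hw e e0.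
exists (m + d *: m0); first by apply: (subspD sM) => //; apply: subspZ.
set a := m + d *: v in wa.
have aE : a = m + d *: m0 + d *: v'.
  by rewrite /a -addrA -scalerDr [m0 + _]addrC subrK.
have : ip (w - a) v' / (nsq v')%:C%C = c - d.
  rewrite ipBl mulrBl -/c; congr (_ - _).
  rewrite aE ipDl ipZl ipxx.
  have -> : ip (m + d *: m0) v' = 0.
    by rewrite ip_conj hm0 ?cj0//; apply: (subspD sM) => //; apply: subspZ.
  by rewrite add0r mulfK// ; apply/eqP => /(congr1 (@complex.Re R))/=; exact/eqP.
move=> hcd; have := nsq_project (w - a) v0; rewrite hcd => hp.
have -> : w - c *: v' - (m + d *: m0) = w - a - (c - d) *: v'.
  rewrite aE scalerBl; move: (m + _) (d *: v') (c *: v') => x y z.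
  by rewrite opprB opprD -!addrA addKr [- z - x]addrC.
rewrite hp; apply: le_lt_trans wa; rewrite gerBl divr_ge0 ?cn2_ge0 ?nsq_ge0//.
Qed.

(** Consider the Hermitian form [nsq x - c0 * nsq (f x)]. If it is nowhere positive on [A], then [f]
    is bounded below and completeness applies. Otherwise a vector [p0] where it is positive is split
    off orthogonally for this form: the complement [A'] satisfies the hypothesis with one vector
    fewer, and the range loses only a line. *)
Lemma closed_range N (P K : hilb (R := R)) (f : P -> K) (A : set P) (M c0 : R) :
  hlin f -> (forall x, nsq (f x) <= M * nsq x) -> subsp A -> hclosed A -> 0 <= c0 ->
  (forall p : 'I_N -> P, (forall i, A (p i)) -> exists c : 'I_N -> C,
    (exists i, c i != 0) /\
    nsq (\sum_i c i *: p i) <= c0 * nsq (f (\sum_i c i *: p i))) ->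
  hclosed (f @` A).
Proof.
move=> lf fM + + c00; elim: N A => [A _ _ h|N IH A sA cA h].
  (* For [N = 0] the hypothesis asks for a nonzero coefficient in an empty family. *)
  by have [|c [[[]]]] := h (fun=> 0); first by case.
have [good|] := pselect (forall p, A p -> nsq p <= c0 * nsq (f p)).
  move=> w hw.
  have q0 k : 0 < 4^-1 ^+ k / (4 * (c0 + 1)) :> R.
    by rewrite divr_gt0 ?exprn_gt0 ?invr_gt0// mulr_gt0// ltr_wpDl.
  have ex k : exists p, A p /\ nsq (w - f p) < 4^-1 ^+ k / (4 * (c0 + 1)).
    by have [_ [p Ap <-] wp] := hw _ (q0 k); exists p.
  have [p hp] := choice ex.
  have step k : nsq (p k.+1 - p k) <= 4^-1 ^+ k.
    have [A1 h1] := hp k; have [A2 h2] := hp k.+1.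
    apply: le_trans (good _ (subspB sA A2 A1)) _; rewrite hlinB//.
    have := nsq_tri (f (p k.+1)) w (f (p k)).
    rewrite (nsqC _ w); move: h1 h2; rewrite exprS.
    have := q0 k; have : 0 < (4^-1 : R) ^+ k by rewrite exprn_gt0 ?invr_gt0.
    set d := 4^-1 ^+ k; set n1 := nsq _; set n2 := nsq _; set n3 := nsq _.
    rewrite !ltr_pdivlMr ?mulr_gt0 ?ltr_wpDl//; nra.
  have [|g Ag hg] := cauchy_limit cA _ step; first by move=> k; case: (hp k).
  exists g => //; apply/eqP; rewrite eq_sym -subr_eq0; apply/eqP/nsq_eq0/eqP.
  rewrite eq_le nsq_ge0 andbT.
  apply/ler_addgt0Pl => e e0; rewrite addr0.
  have [|N1 h1] := hg (e / (4 * (`|M| + 1))).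
    by rewrite divr_gt0// mulr_gt0// ltr_wpDl.
  have [|N2 h2] := @geom_small R (e * (c0 + 1)); first by rewrite mulr_gt0// ltr_wpDl.
  pose k := maxn N1 N2.
  have {}h1 := h1 k (leq_maxl _ _); have {}h2 := h2 k (leq_maxr _ _).
  have [_ h3] := hp k.
  apply: le_trans (nsq_tri w (f (p k)) (f g)) _.
  rewrite -hlinB//; have := fM (p k - g); rewrite (nsqC _ g).
  have : nsq (w - f (p k)) <= e / 4.
    apply/ltW/(lt_le_trans h3); rewrite ler_pdivrMr ?mulr_gt0 ?ltr_wpDl//; lra.
  move: h1; rewrite ltr_pdivlMr ?mulr_gt0 ?ltr_wpDl// => h1.
  have := nsq_ge0 (g - p k); have := ler_norm M; nra.
move=> /existsNP[p0 /not_implyP[Ap0 /negP]]; rewrite -ltNge => bad.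
(* The polarization of the form at [p0]; it vanishes on the complement of [p0]. *)
pose b x := ip x p0 - c0%:C%C * ip (f x) (f p0).
have bB x y : b (x - y) = b x - b y.
  by rewrite /b hlinB// !ipBl mulrBr opprB addrACA opprB [in RHS]addrC; ring.
pose A' := A `&` [set x | b x = 0].
have sA' : subsp A'.
  split; first by split; [exact: subsp0|rewrite /= /b hlin0// !ip0l mulr0 subr0].
  move=> c x y [Ax bx] [Ay by_]; split; first by case: sA => _; apply.
  rewrite /= /b lf !ip_linl.
  have -> : c * ip x p0 + ip y p0 - c0%:C%C * (c * ip (f x) (f p0) + ip (f y) (f p0))
    = c * b x + b y by rewrite /b; ring.
  by rewrite bx by_ mulr0 addr0.
have cA' : hclosed A'.
  move=> w hw; split.
    by apply: cA => e e0; have [a [Aa _] wa] := hw e e0; exists a.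
  apply: (@hclosed_ker _ _ b (2 * nsq p0 + 2 * c0 ^+ 2 * (`|M| * nsq (f p0))) bB).
    move=> x; apply: le_trans (cn2D_le _ _) _; rewrite cn2N cn2M.
    have := cauchy_schwarz x p0; have := cauchy_schwarz (f x) (f p0).
    have -> : cn2 (c0%:C%C : C) = c0 ^+ 2 by rewrite /cn2 /=; ring.
    have : nsq (f x) * nsq (f p0) <= `|M| * nsq x * nsq (f p0).
      rewrite ler_wpM2r ?nsq_ge0//; apply: le_trans (fM x) _.
      by rewrite ler_wpM2r ?nsq_ge0// ler_norm.
    have := sqr_ge0 c0; move: (c0 ^+ 2) => k k0 h1 h2 h3.
    have : k * cn2 (ip (f x) (f p0)) <= k * (`|M| * nsq x * nsq (f p0)).
      by rewrite ler_wpM2l//; apply: le_trans h1.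
    by lra.
  by move=> e e0; have [a [_ ba] wa] := hw e e0; exists a.
have qD x c : b x = 0 -> nsq (x + c *: p0) - c0 * nsq (f (x + c *: p0)) =
    nsq x - c0 * nsq (f x) + cn2 c * (nsq p0 - c0 * nsq (f p0)).
  move=> bx; rewrite (hlinD lf) (hlinZ lf) !nsqD !nsqZ !ipZr.
  have : complex.Re (c^* * b x) = 0 by rewrite bx mulr0.
  have -> : c^* * b x = c^* * ip x p0 - c0%:C%C * (c^* * ip (f x) (f p0)).
    by rewrite /b; ring.
  rewrite ReD ReN (ReM c0%:C%C) /= mul0r subr0.
  set r1 := complex.Re _; set r2 := complex.Re _ => r12.
  have -> : r1 = c0 * r2 by lra.
  by ring.
have bp0 : b p0 = (nsq p0 - c0 * nsq (f p0))%:C%C.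
  by rewrite /b !ipxx rmorphB rmorphM.
have q0 : 0 < nsq p0 - c0 * nsq (f p0) by rewrite subr_gt0.
have clA' : hclosed (f @` A').
  apply: IH => // p hp.
  (* The hypothesis is applied to [p0] followed by the vectors [p j] of [A']. On the combination
     found, the form is its value at the part [s] in [A'] plus a nonnegative contribution of [p0],
     so [s] inherits the inequality. If all coefficients of [s] vanished, that of [p0] would vanish
     as well. *)
  have [i|c [[i ci] hc]] := h (fun i => oapp p p0 (unlift ord0 i)).
    by case: (unliftP ord0 i) => [j|] _ //=; case: (hp j).
  exists (fun j => c (lift ord0 j)).
  move: hc; rewrite big_ord_recl unlift_none /=.
  under eq_bigr do rewrite liftK /=.
  set s := \sum_(j < N) _; rewrite addrC => hc.
  have bs : b s = 0.
    have : A' s by apply: (subsp_sum sA') => j _; apply: subspZ (hp j).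
    by case.
  have := qD s (c ord0) bs.
  move=> hq; have cc := cn2_ge0 (c ord0).
  split; last first.
    have : nsq s - c0 * nsq (f s) <= 0; last by lra.
    have : 0 <= cn2 (c ord0) * (nsq p0 - c0 * nsq (f p0)) by rewrite mulr_ge0// ltW.
    by lra.
  apply/not_existsP => nc.
  have s0 : s = 0.
    by apply: big1 => j _; have := nc j; move/negP; rewrite negbK => /eqP ->; rewrite scale0r.
  have : cn2 (c ord0) * (nsq p0 - c0 * nsq (f p0)) <= 0.
    by move: hq; rewrite s0 (hlin0 lf) !nsq0 mulr0; rewrite s0 in hc; lra.
  rewrite pmulr_lle0// => c00'.
  have c0z : c ord0 = 0 by apply: cn2_eq0; apply/eqP; rewrite eq_le c00' cc.
  move: ci; case: (unliftP ord0 i) => [j|] ->; last by rewrite c0z eqxx.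
  exact: nc.
have sfA' : subsp (f @` A').
  split; first by exists 0; [exact: subsp0|exact: hlin0].
  move=> c _ _ [x A'x <-] [y A'y <-]; exists (c *: x + y); last exact: lf.
  by case: sA' => _; apply.
have -> : f @` A = [set w | exists c, exists2 m, (f @` A') m & w = m + c *: f p0].
  apply/seteqP; split=> [_ [x Ax <-]|_ [c [_ [x [Ax _] <-] ->]]] /=.
    pose c := b x / (nsq p0 - c0 * nsq (f p0))%:C%C.
    exists c, (f (x - c *: p0)); last by rewrite -hlinZ// -hlinD// subrK.
    exists (x - c *: p0) => //; split; first by apply: (subspB sA) => //; apply: subspZ.
    rewrite /= bB.
    have -> : b (c *: p0) = c * b p0.
      by rewrite /b (hlinZ lf) !ipZl mulrBr; congr (_ - _); rewrite mulrCA.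
    rewrite bp0 /c divfK ?subrr//.
    by apply/eqP => /(congr1 (@complex.Re R)) /= h0; move: q0; rewrite h0 ltxx.
  exists (x + c *: p0); first by apply: (subspD sA) => //; apply: subspZ.
  by rewrite hlinD// hlinZ.
exact: hclosed_add_line.
Qed.

End ClosedRange.

Lemma row_kernel (F : fieldType) m n (A : 'M[F]_(m, n)) : (n < m)%N ->
  exists2 x : 'rV_m, x != 0 & x *m A = 0.
Proof.
move=> nm; have : kermx A != 0.
  rewrite -mxrank_eq0 mxrank_ker -lt0n subn_gt0.
  exact: leq_ltn_trans (rank_leq_col A) nm.
by case/rowV0Pn => x /sub_kermxP xA x0; exists x.
Qed.

(** * Dimensions of subspaces *)

Section Dimension.
Context {R : realType}.
Local Notation C := R[i].
Local Notation hilb := (hilb (R := R)).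

Definition dimH (H : hilb) (S : set H) (k : nat) :=
  exists e : 'I_k -> H, [/\ forall i, S (e i),
    forall c : 'I_k -> C, \sum_i c i *: e i = 0 -> forall i, c i = 0 &
    forall x, S x -> exists c : 'I_k -> C, x = \sum_i c i *: e i].

Lemma dimH_le (H : hilb) (S : set H) k k' : dimH S k -> dimH S k' -> (k' <= k)%N.
Proof.
move=> [e [_ _ spn]] [e' [Se' fr _]]; rewrite leqNgt; apply/negP => kk'.
have [c hc] := choice (fun i => spn (e' i) (Se' i)).
have [x x0 xc] := row_kernel (\matrix_(i, j) c i j) kk'.
have : \sum_i x 0 i *: e' i = 0.
  under eq_bigr do rewrite hc scaler_sumr.
  rewrite exchange_big /=; apply: big1 => j _.
  under eq_bigr do rewrite scalerA.
  rewrite -scaler_suml; suff -> : \sum_i x 0 i * c i j = 0 by rewrite scale0r.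
  move/matrixP: xc => /(_ 0 j); rewrite !mxE; apply: etrans.
  by apply: eq_bigr => i _; rewrite mxE.
move/fr => xi0; move/eqP: x0; apply; apply/rowP => i; rewrite mxE; exact: xi0.
Qed.

Lemma dimH_uniq (H : hilb) (S : set H) k k' : dimH S k -> dimH S k' -> k = k'.
Proof.
by move=> h h'; apply/eqP; rewrite eqn_leq (dimH_le h h') (dimH_le h' h).
Qed.

Lemma dimH0 (H : hilb) (S : set H) : S 0 -> (forall x, S x -> x = 0) -> dimH S 0.
Proof.
move=> S0 h; exists (fun=> 0); split=> [//|c _ []//|x /h ->].
by exists (fun=> 0); rewrite big_ord0.
Qed.

(** Rank and nullity: a basis of the kernel is completed by lifts of a basis of the image. *)
Lemma dimH_exact (H H1 : hilb) (phi : H -> H1) (S : set H) (S1 : set H1) k m :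
  hlin phi -> subsp S -> (forall x, S x -> S1 (phi x)) ->
  (forall y, S1 y -> exists2 x, S x & phi x = y) ->
  dimH (S `&` [set x | phi x = 0]) k -> dimH S1 m -> dimH S (k + m).
Proof.
move=> lp sS hS onto [e [Se fre spe]] [d [Sd frd spd]].
have /choice[D hD] i : exists x, S x /\ phi x = d i.
  by have [x] := onto _ (Sd i); exists x.
exists (fun i => match fintype.split i with inl i => e i | inr j => D j end).
have sumE (c : 'I_(k + m) -> C) :
    \sum_i c i *: (match fintype.split i with inl i => e i | inr j => D j end) =
    \sum_i c (lshift m i) *: e i + \sum_j c (rshift k j) *: D j.
  rewrite big_split_ord /=; congr (_ + _); apply: eq_bigr => i _.
    by rewrite -[lshift m i]/(fintype.unsplit (inl i)) unsplitK.
  by rewrite -[rshift k i]/(fintype.unsplit (inr i)) unsplitK.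
have phiE (c : 'I_k -> C) : phi (\sum_i c i *: e i) = 0.
  rewrite (hlin_sum lp); apply: big1 => i _; rewrite (hlinZ lp).
  by have [_ /= ->] := Se i; rewrite scaler0.
have phiD (c : 'I_m -> C) : phi (\sum_i c i *: D i) = \sum_i c i *: d i.
  rewrite (hlin_sum lp); apply: eq_bigr => i _; rewrite (hlinZ lp).
  by have [_ ->] := hD i.
split=> [i|c|x Sx].
- by case: (fintype.split i) => j; [case: (Se j)|case: (hD j)].
- rewrite sumE => s0.
  have cr j : c (rshift k j) = 0.
    move: j; apply: frd; rewrite -phiD; move/(congr1 phi): s0.
    by rewrite (hlinD lp) phiE add0r (hlin0 lp).
  have cl j : c (lshift m j) = 0.
    move: j; apply: fre; move: s0; rewrite [X in _ + X]big1 ?addr0// => j _.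
    by rewrite cr scale0r.
  by move=> i; case: (splitP i) => j ij;
    [rewrite -(cl j)|rewrite -(cr j)]; congr c; apply: val_inj.
have [c2 hc2] := spd _ (hS _ Sx).
have [|c1 hc1] := spe (x - \sum_j c2 j *: D j).
  split; last by rewrite /= (hlinB lp) phiD -hc2 subrr.
  apply: (subspB sS) => //; apply: (subsp_sum sS) => j _.
  by apply: (subspZ sS); case: (hD j).
exists (fun i => match fintype.split i with inl i => c1 i | inr j => c2 j end).
rewrite sumE.
rewrite (eq_bigr (fun i => c1 i *: e i)); last first.
  by move=> i _; rewrite -[lshift m i]/(fintype.unsplit (inl i)) unsplitK.
rewrite [X in _ + X](eq_bigr (fun i => c2 i *: D i)) ?subrK -?hc1 ?subrK//.
by move=> i _; rewrite -[rshift k i]/(fintype.unsplit (inr i)) unsplitK.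
Qed.

End Dimension.

(** * Direct sums of Hilbert spaces *)

Section Product.
Context {R : realType}.
Local Notation C := R[i].
Variables H K : hilb (R := R).

Definition prod_ip (x y : (H * K)%type) : C := ip x.1 y.1 + ip x.2 y.2.

Fact prod_linl (c : C) x y z :
  prod_ip (c *: x + y) z = c * prod_ip x z + prod_ip y z.
Proof. by rewrite /prod_ip /= !ip_linl; ring. Qed.

Fact prod_conj x y : prod_ip y x = (prod_ip x y)^*.
Proof. by rewrite /prod_ip cjD -!ip_conj. Qed.

Fact prod_nsqE x : complex.Re (prod_ip x x) = nsq x.1 + nsq x.2.
Proof. by rewrite /prod_ip ReD. Qed.

Fact prod_ge0 x : 0 <= complex.Re (prod_ip x x).
Proof. by rewrite prod_nsqE addr_ge0 ?nsq_ge0. Qed.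

Fact prod_eq0 x : complex.Re (prod_ip x x) = 0 -> x = 0.
Proof.
rewrite prod_nsqE => /eqP; rewrite paddr_eq0 ?nsq_ge0// => /andP[/eqP h1 /eqP h2].
by case: x h1 h2 => x y /= /nsq_eq0 -> /nsq_eq0 ->.
Qed.

Fact prod_complete (f : nat -> (H * K)%type) :
  (forall k, complex.Re (prod_ip (f k.+1 - f k) (f k.+1 - f k)) <= 4^-1 ^+ k) ->
  exists g, forall e : R, 0 < e -> exists N, forall k, (N <= k)%N ->
    complex.Re (prod_ip (g - f k) (g - f k)) < e.
Proof.
move=> h.
have [|g1 h1] := @ip_complete _ H (fun k => (f k).1).
  move=> k; apply: le_trans (h k).
  by rewrite prod_nsqE /= lerDl; exact: nsq_ge0.
have [|g2 h2] := @ip_complete _ K (fun k => (f k).2).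
  move=> k; apply: le_trans (h k).
  by rewrite prod_nsqE /= lerDr; exact: nsq_ge0.
exists (g1, g2) => e e0; have e20 : 0 < e / 2 by rewrite divr_gt0.
have [N1 {}h1] := h1 _ e20; have [N2 {}h2] := h2 _ e20.
exists (maxn N1 N2) => k; rewrite geq_max => /andP[k1 k2].
rewrite prod_nsqE /=; have := h1 k k1; have := h2 k k2; rewrite -!/(nsq _); lra.
Qed.

Definition hprod : hilb := Hilb prod_linl prod_conj prod_ge0 prod_eq0 prod_complete.

Lemma nsq_prod (x : hprod) : nsq x = nsq x.1 + nsq x.2.
Proof. exact: prod_nsqE. Qed.

End Product.

(** * Compressions of an operator and one step of a factorization *)

Section Stage.
Context {R : realType}.
Local Notation C := R[i].
Local Notation hilb := (hilb (R := R)).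

(* an orthogonal decomposition of [H] into copies of [L] and [H1] *)
Structure hsplit (H L H1 : hilb) := HSplit {
  fst_part : H -> L;
  snd_part : H -> H1;
  glue : L -> H1 -> H;
  fst_lin : hlin fst_part;
  snd_lin : hlin snd_part;
  ip_split : forall x y, ip x y =
    ip (fst_part x) (fst_part y) + ip (snd_part x) (snd_part y);
  fst_glue : forall a h, fst_part (glue a h) = a;
  snd_glue : forall a h, snd_part (glue a h) = h }.

Section SplitTheory.
Variables (H L H1 : hilb) (s : hsplit H L H1).

Lemma nsq_split x : nsq x = nsq (fst_part s x) + nsq (snd_part s x).
Proof. by rewrite /nsq (ip_split s) ReD. Qed.

Lemma split_inj x y :
  fst_part s x = fst_part s y -> snd_part s x = snd_part s y -> x = y.
Proof.
move=> h1 h2; apply: subr0_eq; apply: nsq_eq0; rewrite nsq_split.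
by rewrite !hlinB; [rewrite h1 h2 !subrr !nsq0 addr0|exact: snd_lin|exact: fst_lin].
Qed.

Lemma glueE x : glue s (fst_part s x) (snd_part s x) = x.
Proof. by apply: split_inj; rewrite ?fst_glue ?snd_glue. Qed.

Lemma glue_lin c a b h k : glue s (c *: a + b) (c *: h + k) =
  c *: glue s a h + glue s b k.
Proof.
by apply: split_inj; rewrite ?fst_lin ?snd_lin ?fst_glue ?snd_glue.
Qed.

Lemma glue_sum (I : Type) (r : seq I) (P : pred I) (a : I -> L) (h : I -> H1) :
  glue s (\sum_(i <- r | P i) a i) (\sum_(i <- r | P i) h i) =
  \sum_(i <- r | P i) glue s (a i) (h i).
Proof.
apply: split_inj; rewrite ?fst_glue ?snd_glue (hlin_sum (fst_lin s), hlin_sum (snd_lin s)).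
  by apply: eq_bigr => i _; rewrite fst_glue.
by apply: eq_bigr => i _; rewrite snd_glue.
Qed.

End SplitTheory.

(* The maximum over [z] in a closed [Y] of [nsq (F f) - nsq (F f - z)] is the
   square norm of the projection of [F f] onto [Y], so this bounds the number of
   singular values of the compression of [F] to [X] and [Y] whose squares exceed
   [tau2]. *)
Definition few_large (H H' : hilb) (F : H -> H') (X : set H) (Y : set H') (tau2 : R) :=
  exists N, forall f : 'I_N -> H, (forall i, X (f i)) ->
    exists c : 'I_N -> C, (exists i, c i != 0) /\
      forall z, Y z -> nsq (F (\sum_i c i *: f i)) - nsq (F (\sum_i c i *: f i) - z)
        <= tau2 * nsq (\sum_i c i *: f i).

(* The adjoint of [F] is not available for abstract Hilbert spaces: the last
   condition says that [g s] is an eigenvector of [F^* F], with eigenvalue [s ^+ 2]. *)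
Definition spectral_part (H H' : hilb) (F : H -> H') (X : set H) (Y : set H')
    (Z : seq R) : set H :=
  [set f | [/\ X f, Y (F f) & exists2 g : R -> H, f = \sum_(s <- Z) g s &
    forall s, s \in Z -> forall x, ip (F (g s)) (F x) = (s ^+ 2)%:C%C * ip (g s) x]].

Lemma subsp_spectral_part (H H' : hilb) (F : H -> H') X Y Z :
  hlin F -> subsp X -> subsp Y -> subsp (spectral_part F X Y Z).
Proof.
move=> lF sX sY; split.
  split; [exact: subsp0|rewrite hlin0//; exact: subsp0|].
  by exists (fun=> 0) => [|s _ x]; rewrite ?big1 ?hlin0 ?ip0l ?mulr0.
move=> c x y [Xx Yx [g gx hg]] [Xy Yy [h hy hh]]; split.
- by case: sX => _; apply.
- by rewrite lF; case: sY => _; apply.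
exists (fun s => c *: g s + h s); first by rewrite big_split -scaler_sumr gx hy.
by move=> s sZ w; rewrite lF !ip_linl hg// hh//; ring.
Qed.

(** An eigenvector for [s ^+ 2] is stretched by exactly [s], more than the bound on [F] allows. *)
Lemma spectral_part_trivial (H H' : hilb) (F : H -> H') X Y Z (t2 : R) :
  (forall x, nsq (F x) <= t2 * nsq x) -> (forall s, s \in Z -> t2 < s ^+ 2) ->
  forall x, spectral_part F X Y Z x -> x = 0.
Proof.
move=> bF hZ x [_ _ [g -> hg]]; rewrite big_seq; apply: big1 => s sZ.
apply: nsq_le0; have := bF (g s); have := hZ _ sZ.
have -> : nsq (F (g s)) = s ^+ 2 * nsq (g s).
  by rewrite {1}/nsq hg// ipxx ReM /= mul0r subr0.
by have := nsq_ge0 (g s); nra.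
Qed.

(** * One reduction step in abstract Hilbert spaces *)

Section Reduction.
Variables (H H' L H1 H1' : hilb) (s : hsplit H L H1) (s' : hsplit H' L H1').
Variables (X : set H) (Y : set H') (X1 : set H1) (Y1 : set H1') (A B : set L).
Variables (u : L -> L) (t : R) (F : H -> H') (F1 : H1 -> H1').
Hypotheses (sX : subsp X) (cX : hclosed X) (sY : subsp Y) (cY : hclosed Y).
Hypotheses (sX1 : subsp X1) (cX1 : hclosed X1) (sY1 : subsp Y1) (cY1 : hclosed Y1).
Hypotheses (lu : hlin u) (iu : forall a b, ip (u a) (u b) = ip a b).
Hypotheses (lF : hlin F) (lF1 : hlin F1).
Hypothesis Ffst : forall f, fst_part s' (F f) = t%:C%C *: u (fst_part s f).
Hypothesis Fsnd : forall f, snd_part s' (F f) = F1 (snd_part s f).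
Hypothesis t0 : 0 < t.
Hypothesis Fle : forall f, nsq (F f) <= t ^+ 2 * nsq f.
Hypothesis Xsnd : forall f, X f -> X1 (snd_part s f).
Hypothesis Xglue : forall a, X (glue s a 0) <-> A a.
Hypothesis Xdense : forall h, X1 h -> hclosure (snd_part s @` X) h.
Hypothesis Ysnd : forall f, Y f -> Y1 (snd_part s' f).
Hypothesis Yglue : forall a, Y (glue s' a 0) <-> B a.
Hypothesis Ydense : forall h, Y1 h -> hclosure (snd_part s' @` Y) h.
Hypothesis onto : forall a, exists c d, [/\ A c, B d & a = u c + d].

Lemma F1_le h : nsq (F1 h) <= t ^+ 2 * nsq h.
Proof.
have := Fle (glue s 0 h); rewrite (nsq_split s) (nsq_split s') Ffst Fsnd !fst_glue snd_glue.
by rewrite (hlin0 lu) scaler0 !nsq0 !add0r.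
Qed.

Lemma nsq_tu a : nsq (t%:C%C *: u a) = t ^+ 2 * nsq a.
Proof. by rewrite nsqZ /nsq iu /cn2 /=; congr (_ * _); ring. Qed.

Let P : set (hprod H H') :=
  [set p | [/\ X p.1, Y p.2 & fst_part s' p.2 = t%:C%C *: u (fst_part s p.1)]].
Let pi (p : hprod H H') : hprod H1 H1' := (snd_part s p.1, snd_part s' p.2).

Let lpi : hlin pi.
Proof. by move=> c x y; rewrite /pi /= (snd_lin s) (snd_lin s'). Qed.

Let sP : subsp P.
Proof.
split; first split; [exact: subsp0|exact: subsp0| |].
  by rewrite (hlin0 (fst_lin s)) (hlin0 (fst_lin s')) (hlin0 lu) scaler0.
move=> c x y [X1' Y1' e1] [X2 Y2 e2]; split=> /=.
- by case: sX => _; apply.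
- by case: sY => _; apply.
by rewrite (fst_lin s) (fst_lin s') e1 e2 lu scalerDr !scalerA mulrC.
Qed.

Let phi (x : hprod H H') : hprod L L := (fst_part s' x.2 - t%:C%C *: u (fst_part s x.1), 0).

Let cP : hclosed P.
Proof.
move=> w hw; have wX : X w.1.
  apply: cX => e e0; have [p [Xp _ _] wp] := hw e e0; exists p.1 => //.
  by apply: le_lt_trans wp; rewrite nsq_prod lerDl nsq_ge0.
have wY : Y w.2.
  apply: cY => e e0; have [p [_ Yp _] wp] := hw e e0; exists p.2 => //.
  by apply: le_lt_trans wp; rewrite nsq_prod lerDr nsq_ge0.
split=> //; apply/subr0_eq/nsq_eq0/eqP; rewrite eq_le nsq_ge0 andbT.
apply/ler_addgt0Pl => e e0; rewrite addr0.
have t1 : 0 < 2 + 2 * t ^+ 2 by rewrite ltr_pwDl// mulr_ge0// sqr_ge0.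
have [|p [_ _ ep] wp] := hw (e / (2 + 2 * t ^+ 2)); first by rewrite divr_gt0.
move: wp; rewrite ltr_pdivlMr// nsq_prod /= => wp.
have -> : fst_part s' w.2 - t%:C%C *: u (fst_part s w.1) =
    fst_part s' (w.2 - p.2) - t%:C%C *: u (fst_part s (w.1 - p.1)).
  rewrite (hlinB (fst_lin s)) (hlinB (fst_lin s')) (hlinB lu) scalerBr ep.
  by rewrite opprB addrA subrK.
apply: le_trans (nsqB_le _ _) _; rewrite nsq_tu.
move: wp; rewrite (nsq_split s) (nsq_split s' (w.2 - p.2)).
have := nsq_ge0 (snd_part s (w.1 - p.1)); have := nsq_ge0 (snd_part s' (w.2 - p.2)).
have := nsq_ge0 (fst_part s (w.1 - p.1)); have := nsq_ge0 (fst_part s' (w.2 - p.2)).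
have := sqr_ge0 t; move: (t ^+ 2) => k.
move: (nsq _) (nsq _) (nsq _) (nsq _) => n1 n2 n3 n4; nra.
Qed.

(* The pairs [(f, z)] in [X * Y] with [fst_part z = t u (fst_part f)] form a closed
   subspace, whose image under [snd_part] in both components is closed because at
   most finitely many singular values of the compression exceed [tau2], and dense. *)
Lemma exact_lift (tau2 : R) : 0 <= tau2 < t ^+ 2 -> few_large F X Y tau2 ->
  forall h y, X1 h -> Y1 y -> exists f z, [/\ X f, Y z, snd_part s f = h,
    snd_part s' z = y & fst_part s' z = t%:C%C *: u (fst_part s f)].
Proof.
move=> /andP[tau0 taut] [N hN] h y X1h Y1y.
have d0 : 0 < t ^+ 2 - tau2 by rewrite subr_gt0.
(* By [key] below, the square norm of the first component of [q.1] is at most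
   [(tau2 + 2 t^2 + 2) / (t^2 - tau2)] times that of [pi q]. For [q] in [P] the two first components
   together have [1 + t^2] times that square norm, and the last summand 1 accounts for [pi q]
   itself. *)
pose c0 := (1 + t ^+ 2) * (tau2 + 2 * t ^+ 2 + 2) / (t ^+ 2 - tau2) + 1.
have t20 := sqr_ge0 t.
have c00 : 0 <= c0.
  rewrite addr_ge0//; apply: divr_ge0; last exact: ltW.
  by apply: mulr_ge0; rewrite !addr_ge0// mulr_ge0.
have clo : hclosed (pi @` P).
  apply: (@closed_range _ N _ _ pi P 1 c0) => //.
    by move=> x; rewrite mul1r !nsq_prod (nsq_split s) (nsq_split s' x.2) lerD ?lerDr ?nsq_ge0.
  move=> p Pp; have [|c [ci hc]] := hN (fun i => (p i).1).
    by move=> i; case: (Pp i).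
  exists c; split=> //; set q := \sum_i _.
  have q1 : q.1 = \sum_i c i *: (p i).1 by apply: (big_morph fst).
  have q2 : q.2 = \sum_i c i *: (p i).2 by apply: (big_morph snd).
  have [Xq Yq eq] : P q.
    by apply: (subsp_sum sP) => i _; apply: (subspZ sP).
  have := hc _ Yq; rewrite -q1 (nsq_split s' (F _)) (nsq_split s' (F _ - _)).
  rewrite (hlinB (fst_lin s')) (hlinB (snd_lin s')) Ffst Fsnd eq subrr nsq0 nsq_tu.
  rewrite !nsq_prod (nsq_split s q.1) (nsq_split s' q.2) eq nsq_tu.
  have := F1_le (snd_part s q.1); have := nsqB_le (F1 (snd_part s q.1)) (snd_part s' q.2).
  have := nsq_ge0 (snd_part s q.1); have := nsq_ge0 (snd_part s' q.2).
  have := nsq_ge0 (fst_part s q.1); have := nsq_ge0 (F1 (snd_part s q.1)).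
  rewrite /pi /=.
  set n1 := nsq (F1 _); set n2 := nsq (fst_part _ _); set n3 := nsq (snd_part s' _).
  set n4 := nsq (snd_part s _); set n5 := nsq (F1 _ - _) => k1 k2 k3 k4 k5 k6 k7.
  have key : (t ^+ 2 - tau2) * n2 <= (tau2 + 2 * t ^+ 2 + 2) * (n4 + n3).
    have : 0 <= tau2 * n3 by rewrite mulr_ge0.
    have : 0 <= t ^+ 2 * n3 by rewrite mulr_ge0.
    by nra.
  have : n2 * (1 + t ^+ 2) <=
      (1 + t ^+ 2) * (tau2 + 2 * t ^+ 2 + 2) / (t ^+ 2 - tau2) * (n4 + n3).
    rewrite mulrAC ler_pdivlMr//.
    have : 0 <= 1 + t ^+ 2 by rewrite addr_ge0.
    by move: key; move: (_ - _) (1 + _) (_ + 2) => a1 a2 a3 *; nra.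
  by rewrite /c0 mulrDl mul1r; lra.
have [p [Xp Yp ep] [hp yp]] : (pi @` P) (h, y); last first.
  by exists p.1, p.2.
apply: clo => e e0; have e20 : 0 < e / 2 by rewrite divr_gt0.
have [_ [f Xf <-] hf] := Xdense X1h e20.
have [_ [z Yz <-] yz] := Ydense Y1y e20.
(* [onto] is applied to the defect of the relation between the first components. Adding [c] to that
   of [f] and subtracting [t d] from that of [z] restores the relation and leaves the second
   components alone. *)
have [c [d [Ac Bd hcd]]] := onto (t^-1%:C%C *: fst_part s' z - u (fst_part s f)).
pose f' := f + glue s c 0; pose z' := z - glue s' (t%:C%C *: d) 0.
exists (pi (f', z')).
  exists (f', z') => //; split=> /=.
  - by apply: (subspD sX) => //; apply/Xglue.
  - apply: (subspB sY) => //; suff : Y (t%:C%C *: glue s' d 0).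
      have := glue_lin s' t%:C%C d 0 0 0.
      have -> : glue s' 0 0 = 0 :> H'.
        apply: (@split_inj _ _ _ s'); rewrite ?fst_glue ?snd_glue ?hlin0//;
          [exact: fst_lin|exact: snd_lin].
      by rewrite scaler0 !addr0 => ->.
    by apply: (subspZ sY); apply/Yglue.
  rewrite /f' /z' (hlinB (fst_lin s')) (hlinD (fst_lin s)) !fst_glue (hlinD lu).
  move: hcd => /(congr1 (fun x => t%:C%C *: x)).
  rewrite scalerBr scalerA -rmorphM mulfV ?gt_eqF// scale1r => /eqP.
  rewrite subr_eq => /eqP ->; rewrite !scalerDr addrAC addrK.
  by rewrite addrC.
rewrite nsq_prod /= /f' /z' (hlinB (snd_lin s')) (hlinD (snd_lin s)) !snd_glue.
by rewrite addr0 subr0; lra.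
Qed.

(** Lift each [h i], together with the projection [y i] of [F1 (h i)] onto [Y1], to a pair in [X]
    and [Y]. Then [F f - z] has no first component, so the inequality for [F] becomes the one for
    [F1] up to the term [(tau2 - t^2) * nsq (fst_part s g)], which is not positive. Among the
    elements of [Y1] the projection is the worst case. *)
Lemma few_large_reduce (tau2 : R) : 0 <= tau2 < t ^+ 2 ->
  few_large F X Y tau2 -> few_large F1 X1 Y1 tau2.
Proof.
move=> tau hF; have [N hN] := hF; exists N => h X1h.
have /choice[y hy] i : exists y, Y1 y /\ forall a, Y1 a -> ip (F1 (h i) - y) a = 0.
  by have [p] := projection sY1 cY1 (F1 (h i)); exists p.
have /choice[f hf] i : exists f : H * H', [/\ X f.1, Y f.2, snd_part s f.1 = h i,
    snd_part s' f.2 = y i & fst_part s' f.2 = t%:C%C *: u (fst_part s f.1)].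
  have [Y1y _] := hy i.
  by have [f [z hfz]] := exact_lift tau hF (X1h i) Y1y; exists (f, z).
have [|c [ci hc]] := hN (fun i => (f i).1); first by move=> i; case: (hf i).
exists c; split=> // w Y1w.
pose g := \sum_i c i *: (f i).1; pose z := \sum_i c i *: (f i).2.
pose v := \sum_i c i *: y i.
have gh : snd_part s g = \sum_i c i *: h i.
  rewrite (hlin_sum (snd_lin s)); apply: eq_bigr => i _.
  by rewrite (hlinZ (snd_lin s)); case: (hf i) => _ _ ->.
have zv : snd_part s' z = v.
  rewrite (hlin_sum (snd_lin s')); apply: eq_bigr => i _.
  by rewrite (hlinZ (snd_lin s')); case: (hf i) => _ _ _ ->.
have Yz : Y z.
  by apply: (subsp_sum sY) => i _; apply: (subspZ sY); case: (hf i).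
have zg : fst_part s' z = t%:C%C *: u (fst_part s g).
  rewrite (hlin_sum (fst_lin s')) (hlin_sum (fst_lin s)) (hlin_sum lu) scaler_sumr.
  apply: eq_bigr => i _; rewrite (hlinZ (fst_lin s')) (hlinZ (fst_lin s)) (hlinZ lu).
  by case: (hf i) => _ _ _ _ ->; rewrite !scalerA mulrC.
have Y1v : Y1 v.
  by apply: (subsp_sum sY1) => i _; apply: (subspZ sY1); case: (hy i).
have best : nsq (F1 (snd_part s g) - v) <= nsq (F1 (snd_part s g) - w).
  apply: (projection_best sY1) => // a Y1a.
  rewrite gh (hlin_sum lF1) /v -sumrB ip_suml; apply: big1 => i _.
  by rewrite (hlinZ lF1) -scalerBr ipZl; have [_ ->] := hy i; rewrite ?mulr0.
have := hc _ Yz; rewrite -/g -gh (nsq_split s' (F _)) (nsq_split s' (F _ - _)).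
rewrite (hlinB (fst_lin s')) (hlinB (snd_lin s')) Ffst Fsnd zg zv subrr nsq0 nsq_tu.
rewrite (nsq_split s g); case/andP: tau => tau0 taut.
by have := nsq_ge0 (fst_part s g); nra.
Qed.

(** Dropping the first component maps one spectral part onto the other, by [exact_lift] with
    [y = F1 h]. The kernel consists of the [glue a 0] with [a] in [A] and [u a] in [B]. *)
Lemma spectral_part_dim (tau2 : R) (Z : seq R) (k m : nat) :
  0 <= tau2 < t ^+ 2 -> few_large F X Y tau2 -> uniq Z -> t \in Z ->
  dimH [set a | A a /\ B (u a)] k ->
  dimH (spectral_part F1 X1 Y1 Z) m -> dimH (spectral_part F X Y Z) (k + m).
Proof.
move=> tau hF uZ tZ dk dm.
have tne : t%:C%C != 0 :> C.
  by apply/eqP => /(congr1 (@complex.Re R)) /=; apply/eqP; rewrite gt_eqF.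
have snd_spec f : spectral_part F X Y Z f -> spectral_part F1 X1 Y1 Z (snd_part s f).
  move=> [Xf Yf [g fg hg]]; split; first exact: Xsnd.
    by rewrite -Fsnd; apply: Ysnd.
  exists (fun r => snd_part s (g r)).
    by rewrite fg (hlin_sum (snd_lin s)).
  move=> r rZ y; have := hg r rZ (glue s 0 y).
  rewrite !(ip_split s) !(ip_split s') !Ffst !Fsnd !fst_glue snd_glue.
  by rewrite (hlin0 lu) scaler0 !ip0r !add0r.
have glue_spec a h : (exists2 g : R -> H1, h = \sum_(r <- Z) g r &
    forall r, r \in Z -> forall x, ip (F1 (g r)) (F1 x) = (r ^+ 2)%:C%C * ip (g r) x) ->
  exists2 g : R -> H, glue s a h = \sum_(r <- Z) g r &
    forall r, r \in Z -> forall x, ip (F (g r)) (F x) = (r ^+ 2)%:C%C * ip (g r) x.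
  (* On first components [F] is [t] times an isometry, so the whole of [a] can be assigned to the
     eigenvalue [t ^+ 2]; this is where [t \in Z] enters. *)
  move=> [g -> hg]; exists (fun r => glue s (if r == t then a else 0) (g r)).
    rewrite -glue_sum; congr glue.
    by rewrite (bigD1_seq t)//= eqxx big1 ?addr0// => r /negPf ->.
  move=> r rZ x; rewrite !(ip_split s) !(ip_split s') !Ffst !Fsnd !fst_glue snd_glue.
  rewrite hg// mulrDr; congr (_ + _).
  rewrite ipZl ipZr iu mulrA; case: eqP => [->|_]; last by rewrite !ip0l !mulr0.
  congr (_ * _); apply: complex_eq; rewrite !cE /=; ring.
apply: (dimH_exact (snd_lin s)) dm => //; first exact: subsp_spectral_part.
  move=> h [X1h Y1h eh]; have [f [z [Xf Yz fh zh zf]]] := exact_lift tau hF X1h Y1h.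
  exists f => //; have Ff : F f = z.
    by apply: (@split_inj _ _ _ s'); rewrite ?Ffst ?Fsnd ?zf ?fh ?zh.
  by split; rewrite ?Ff// -(glueE s f) fh; apply: glue_spec.
have [e [Se fre spe]] := dk.
have glue0_sum (c : 'I_k -> C) :
    \sum_i c i *: glue s (e i) 0 = glue s (\sum_i c i *: e i) 0.
  have -> : (0 : H1) = \sum_(i < k) 0 by rewrite big1.
  rewrite glue_sum; apply: eq_bigr => i _.
  by apply: (@split_inj _ _ _ s); rewrite ?(hlinZ (fst_lin s)) ?(hlinZ (snd_lin s))
    ?fst_glue ?snd_glue ?scaler0 // big1 ?scaler0.
exists (fun i => glue s (e i) 0); split.
- move=> i; have [Ai Bi] := Se i; split; last by rewrite /= snd_glue.
  split; first by apply/Xglue.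
    have -> : F (glue s (e i) 0) = t%:C%C *: glue s' (u (e i)) 0.
      apply: (@split_inj _ _ _ s'); rewrite ?Ffst ?Fsnd ?(hlinZ (fst_lin s'))
        ?(hlinZ (snd_lin s')) ?fst_glue ?snd_glue ?scaler0 ?(hlin0 lF1)//.
    by apply: (subspZ sY); apply/Yglue.
  apply: glue_spec; exists (fun=> 0) => [|r _ x]; first by rewrite big1.
  by rewrite (hlin0 lF1) !ip0l mulr0.
- move=> c; rewrite glue0_sum => /(congr1 (fst_part s)).
  by rewrite fst_glue (hlin0 (fst_lin s)); apply: fre.
move=> x [[Xx Yx _] /= x0].
have xg : x = glue s (fst_part s x) 0 by rewrite -{1}(glueE s x) x0.
have [|c hc] := spe (fst_part s x); last first.
  by exists c; rewrite glue0_sum -hc.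
split; first by apply/Xglue; rewrite -xg.
apply/Yglue; have : Y (t^-1%:C%C *: F x) by apply: (subspZ sY).
congr Y; apply: (@split_inj _ _ _ s'); rewrite ?(hlinZ (fst_lin s')) ?(hlinZ (snd_lin s'))
  ?Ffst ?Fsnd ?fst_glue ?snd_glue ?x0 ?(hlin0 lF1) ?scaler0//.
by rewrite scalerA -rmorphM mulVf ?scale1r// gt_eqF.
Qed.

End Reduction.
End Stage.

(** * Square integrable functions on the circle *)

Section Ae.
Context {R : realType}.
Local Notation mu := (circ R).

Lemma aeS (P Q : R -> Prop) : (forall x, P x -> Q x) ->
  {ae mu, forall x, P x} -> {ae mu, forall x, Q x}.
Proof.
move=> PQ; apply: (@negligibleS _ (measurableTypeR R) _ mu) => x nQ /PQ; exact: nQ.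
Qed.

Lemma aeI (P Q : R -> Prop) : {ae mu, forall x, P x} -> {ae mu, forall x, Q x} ->
  {ae mu, forall x, P x /\ Q x}.
Proof.
move=> h1 h2; have := @negligibleU _ (measurableTypeR R) _ mu _ _ h1 h2.
apply: negligibleS => x /=; have [Px|nP _] := pselect (P x); last by left.
by have [Qx|nQ _] := pselect (Q x); [case|right].
Qed.

Lemma aeS2 (P Q S : R -> Prop) : (forall x, P x -> Q x -> S x) ->
  {ae mu, forall x, P x} -> {ae mu, forall x, Q x} -> {ae mu, forall x, S x}.
Proof. by move=> h h1 h2; apply: aeS (aeI h1 h2) => x []; exact: h. Qed.

Lemma ae_all (P : R -> Prop) : (forall x, P x) -> {ae mu, forall x, P x}.
Proof. by move=> h; apply: aeW => x; exact: h. Qed.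

Lemma ae_forall_fin (I : finType) (P : I -> R -> Prop) :
  (forall i, {ae mu, forall x, P i x}) -> {ae mu, forall x, forall i, P i x}.
Proof.
move=> h; suff : {ae mu, forall x, forall i, i \in enum I -> P i x}.
  by apply: aeS => x hx i; apply: hx; rewrite mem_enum.
elim: (enum I) => [|i s IH]; first exact: ae_all.
by apply: (aeS2 _ (h i) IH) => x Px hx j; rewrite inE => /orP[/eqP ->|/hx].
Qed.

End Ae.

(** * Integrals of real and complex functions on the circle *)

Section Integration.
Context {R : realType}.
Local Notation C := R[i].
Local Notation mu := (circ R).
Local Notation T := (measurableTypeR R).
Implicit Types (f g : R -> C) (h : R -> R).

Lemma circ_setT : mu setT = 1%E.
Proof.
have -> : mu setT = lebesgue_measure (setT `&` [set` `[0%R : R, 1%R[]) by [].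
by rewrite setTI lebesgue_measure_itv /= lte_fin ltr01 oppr0 adde0.
Qed.

Lemma circ_fin : (mu setT < +oo)%E. Proof. by rewrite circ_setT ltry. Qed.

Definition cmeas f :=
  measurable_fun (setT : set T) (fun x => complex.Re (f x)) /\
  measurable_fun (setT : set T) (fun x => complex.Im (f x)).

Lemma cmeas_eq f g : f =1 g -> cmeas f -> cmeas g.
Proof. by move=> /funext ->. Qed.

Lemma cmeasD f g : cmeas f -> cmeas g -> cmeas (fun x => f x + g x).
Proof.
move=> [f1 f2] [g1 g2]; split.
  by under eq_fun do rewrite ReD; exact: measurable_funD.
by under eq_fun do rewrite ImD; exact: measurable_funD.
Qed.

Lemma cmeasM f g : cmeas f -> cmeas g -> cmeas (fun x => f x * g x).
Proof.
move=> [f1 f2] [g1 g2]; split.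
  by under eq_fun do rewrite ReM; apply: measurable_funB; exact: measurable_funM.
by under eq_fun do rewrite ImM; apply: measurable_funD; exact: measurable_funM.
Qed.

Lemma cmeasJ f : cmeas f -> cmeas (fun x => (f x)^*).
Proof.
move=> [f1 f2]; split; first by under eq_fun do rewrite ReJ.
by under eq_fun do rewrite ImJ; exact: measurableT_comp.
Qed.

Lemma cmeas_cst z : cmeas (fun=> z).
Proof. by split; exact: measurable_cst. Qed.

Lemma cmeas_sum (I : Type) (r : seq I) (F : I -> R -> C) :
  (forall i, cmeas (F i)) -> cmeas (fun x => \sum_(i <- r) F i x).
Proof.
move=> h; elim: r => [|i r IH].
  by apply: cmeas_eq (cmeas_cst 0) => x; rewrite big_nil.
by apply: cmeas_eq (cmeasD (h i) IH) => x; rewrite big_cons.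
Qed.

Lemma cmeas_real h : measurable_fun (setT : set T) h -> cmeas (fun x => (h x)%:C%C).
Proof. by move=> mh; split=> //=; exact: measurable_cst. Qed.

Lemma measurable_cn2 f : cmeas f -> measurable_fun (setT : set T) (fun x => cn2 (f x)).
Proof. by move=> [f1 f2]; apply: measurable_funD; exact: measurable_funX. Qed.

Definition rintg h := mu.-integrable (setT : set T) (EFin \o h).

Lemma rintg_meas h : rintg h -> measurable_fun (setT : set T) h.
Proof. by move=> /measurable_int /measurable_EFinP. Qed.

Lemma rintg_le h h' : measurable_fun (setT : set T) h -> rintg h' ->
  (forall x, `|h x| <= h' x) -> rintg h.
Proof.
move=> mh ih hh; apply: le_integrable ih => //; first exact/measurable_EFinP.
move=> x _ /=; rewrite lee_fin; apply: le_trans (hh x) (ler_norm _).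
Qed.

Lemma rintgD h h' : rintg h -> rintg h' -> rintg (fun x => h x + h' x).
Proof. by move=> i1 i2; apply: eq_integrable (integrableD _ i1 i2). Qed.

Lemma rintgZ (a : R) h : rintg h -> rintg (fun x => a * h x).
Proof. by move=> i1; apply: eq_integrable (integrableZl _ a i1). Qed.

Lemma rintgN h : rintg h -> rintg (fun x => - h x).
Proof. by move=> i1; apply: eq_integrable (integrableN i1). Qed.

Lemma rintg_cst (a : R) : rintg (fun=> a).
Proof.
apply: measurable_bounded_integrable => //; [exact: circ_fin|].
exact: bounded_cst.
Qed.

Lemma rintg_ae h h' : ae_eq_fun h h' -> rintg h -> measurable_fun (setT : set T) h' ->
  rintg h'.
Proof.
move=> hh ih mh'; have mh := rintg_meas ih.
apply/integrableP; split; first exact/measurable_EFinP.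
have /integrableP[_] := ih; congr (_ < _)%E.
apply: ae_eq_integral => //.
- by apply/measurableT_comp => //; exact/measurable_EFinP.
- by apply/measurableT_comp => //; exact/measurable_EFinP.
by apply: aeS hh => x /= ->.
Qed.

Definition rint h : R := Rintegral mu (setT : set T) h.

Lemma rintD h h' : rintg h -> rintg h' ->
  rint (fun x => h x + h' x) = rint h + rint h'.
Proof. by move=> i1 i2; rewrite /rint RintegralD. Qed.

Lemma rintZ a h : rintg h -> rint (fun x => a * h x) = a * rint h.
Proof. by move=> i1; rewrite /rint RintegralZl. Qed.

Lemma rintN h : rintg h -> rint (fun x => - h x) = - rint h.
Proof.
move=> i1; rewrite -mulN1r -rintZ//; congr rint.
by apply/funext => x; rewrite mulN1r.
Qed.

Lemma rint_ge0 h : (forall x, 0 <= h x) -> 0 <= rint h.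
Proof. by move=> h0; apply: Rintegral_ge0. Qed.

Lemma rint_le h h' : rintg h -> rintg h' -> (forall x, h x <= h' x) -> rint h <= rint h'.
Proof. by move=> i1 i2 hh; apply: le_Rintegral. Qed.

Lemma rint_ae h h' : ae_eq_fun h h' -> measurable_fun (setT : set T) h ->
  measurable_fun (setT : set T) h' -> rint h = rint h'.
Proof.
move=> hh m1 m2; rewrite /rint /Rintegral; congr fine.
apply: ae_eq_integral => //; [exact/measurable_EFinP..|].
by apply: aeS hh => x /= ->.
Qed.

Lemma rintE h : rintg h -> (\int[mu]_(x in (setT : set T)) (h x)%:E = (rint h)%:E)%E.
Proof.
by move=> ih; rewrite /rint /Rintegral fineK//; apply: integrable_fin_num.
Qed.

Lemma rint_eq0 h : rintg h -> (forall x, 0 <= h x) -> rint h = 0 ->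
  ae_eq_fun h (fun=> 0).
Proof.
move=> ih h0 hi0; have mh := rintg_meas ih.
have /ae_eq_integral_abs : measurable_fun (setT : set T) (EFin \o h).
  exact/measurable_EFinP.
move=> /(_ mu measurableT)[+ _] => ab.
have {}ab : ae_eq mu setT (EFin \o h) (cst 0%E).
  apply: ab; under eq_integral do rewrite /= ger0_norm//.
  by rewrite rintE// hi0.
by apply: aeS ab => x /= /(_ I)[].
Qed.

Definition cintg f := rintg (fun x => complex.Re (f x)) /\ rintg (fun x => complex.Im (f x)).

Lemma cintg_meas f : cintg f -> cmeas f.
Proof. by case=> /rintg_meas ? /rintg_meas. Qed.

Lemma cintg_le f h : cmeas f -> rintg h ->
  (forall x, `|complex.Re (f x)| <= h x /\ `|complex.Im (f x)| <= h x) -> cintg f.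
Proof.
by move=> [m1 m2] ih fh; split; apply: rintg_le ih _ => // x; case: (fh x).
Qed.

Lemma cintgD f g : cintg f -> cintg g -> cintg (fun x => f x + g x).
Proof.
move=> [f1 f2] [g1 g2]; split.
  by under eq_fun do rewrite ReD; exact: rintgD.
by under eq_fun do rewrite ImD; exact: rintgD.
Qed.

Lemma cintgZ z f : cintg f -> cintg (fun x => z * f x).
Proof.
move=> [f1 f2]; split.
  by under eq_fun do rewrite ReM; apply: rintgD; [|apply: rintgN]; exact: rintgZ.
by under eq_fun do rewrite ImM; apply: rintgD; exact: rintgZ.
Qed.

Lemma cintg_cst z : cintg (fun=> z).
Proof. by split; exact: rintg_cst. Qed.

Lemma cintg_sum (I : Type) (r : seq I) (F : I -> R -> C) :
  (forall i, cintg (F i)) -> cintg (fun x => \sum_(i <- r) F i x).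
Proof.
move=> h; elim: r => [|i r IH].
  rewrite (_ : (fun _ => _) = fun=> 0); first exact: cintg_cst.
  by apply/funext => x; rewrite big_nil.
rewrite (_ : (fun _ => _) = fun x => F i x + \sum_(j <- r) F j x).
  exact: cintgD.
by apply/funext => x; rewrite big_cons.
Qed.

Lemma cint_ae f g : ae_eq_fun f g -> cmeas f -> cmeas g -> cintegral f = cintegral g.
Proof.
move=> fg [f1 f2] [g1 g2].
by congr Complex; apply: rint_ae => //; apply: aeS fg => x ->.
Qed.

Lemma cintD f g : cintg f -> cintg g ->
  cintegral (fun x => f x + g x) = cintegral f + cintegral g.
Proof.
move=> [f1 f2] [g1 g2]; apply: complex_eq; rewrite !cE /cintegral /= -!/(rint _).
  by under eq_fun do rewrite ReD; rewrite rintD.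
by under eq_fun do rewrite ImD; rewrite rintD.
Qed.

Lemma cintZ z f : cintg f -> cintegral (fun x => z * f x) = z * cintegral f.
Proof.
move=> [f1 f2]; apply: complex_eq; rewrite !cE /cintegral /= -!/(rint _).
  under eq_fun do rewrite ReM; rewrite rintD ?rintN ?rintZ//; try exact: rintgZ.
  by apply: rintgN; exact: rintgZ.
by under eq_fun do rewrite ImM; rewrite rintD ?rintZ//; exact: rintgZ.
Qed.

Lemma cintJ f : cintg f -> cintegral (fun x => (f x)^*) = (cintegral f)^*.
Proof.
move=> [f1 f2]; apply: complex_eq; rewrite !cE /cintegral /= -!/(rint _).
  by under eq_fun do rewrite ReJ.
by under eq_fun do rewrite ImJ; rewrite rintN.
Qed.

Lemma cintg_mul f g : cmeas f -> cmeas g -> rintg (fun x => cn2 (f x)) ->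
  rintg (fun x => cn2 (g x)) -> cintg (fun x => f x * g x).
Proof.
move=> mf mg f2 g2; apply: (@cintg_le _ (fun x => cn2 (f x) + cn2 (g x))).
- exact: cmeasM.
- exact: rintgD.
move=> x; rewrite ReM ImM /cn2 !ler_norml.
move: (complex.Re _) (complex.Im _) (complex.Re _) (complex.Im _) => a b c d.
have := sqr_ge0 (a - c); have := sqr_ge0 (b - d); have := sqr_ge0 (a + c).
have := sqr_ge0 (b + d); have := sqr_ge0 (a - d); have := sqr_ge0 (b - c).
have := sqr_ge0 (a + d); have := sqr_ge0 (b + c).
by move=> *; split; apply/andP; split; nra.
Qed.

Lemma ae_eq_funP (V : Type) (f g : R -> V) : f =1 g -> ae_eq_fun f g.
Proof. by move=> fg; apply: aeW => x; exact: fg. Qed.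

Lemma ae_eq_fun_sym (V : Type) (f g : R -> V) : ae_eq_fun f g -> ae_eq_fun g f.
Proof. by apply: aeS => x ->. Qed.

Lemma ae_eq_fun_trans (V : Type) (f g h : R -> V) :
  ae_eq_fun f g -> ae_eq_fun g h -> ae_eq_fun f h.
Proof. by apply: aeS2 => x -> ->. Qed.

End Integration.

(** * Square norms and inner products of column vectors *)

Section VectorNorm.
Context {R : realType}.
Local Notation C := R[i].

Definition vn2 n (v : 'cV[C]_n) : R := \sum_(i < n) cn2 (v i 0).

Lemma vn2_ge0 n (v : 'cV[C]_n) : 0 <= vn2 v.
Proof. by apply: sumr_ge0 => i _; exact: cn2_ge0. Qed.

Lemma vnormE n (v : 'cV[C]_n) : vnorm v = Num.sqrt (vn2 v).
Proof. by []. Qed.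

Lemma vnorm_sq n (v : 'cV[C]_n) : vnorm v ^+ 2 = vn2 v.
Proof. by rewrite vnormE sqr_sqrtr// vn2_ge0. Qed.

Lemma vn2_eq0 n (v : 'cV[C]_n) : vn2 v = 0 -> v = 0.
Proof.
move=> /eqP; rewrite psumr_eq0; last by move=> i _; exact: cn2_ge0.
move=> /allP h; apply/colP => i; rewrite mxE; apply: cn2_eq0.
by apply/eqP; apply: (implyP (h i _)) => //; rewrite mem_index_enum.
Qed.

Lemma vn20 n : vn2 (0 : 'cV[C]_n) = 0.
Proof. by rewrite /vn2 big1// => i _; rewrite mxE cn2_0. Qed.

Lemma vn2D_le n (v w : 'cV[C]_n) : vn2 (v + w) <= 2 * vn2 v + 2 * vn2 w.
Proof.
rewrite /vn2 !mulr_sumr -big_split /=; apply: ler_sum => i _.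
by rewrite mxE cn2D_le.
Qed.

Lemma vn2Z n c (v : 'cV[C]_n) : vn2 (c *: v) = cn2 c * vn2 v.
Proof. by rewrite /vn2 mulr_sumr; apply: eq_bigr => i _; rewrite mxE cn2M. Qed.

Lemma vn2_split n1 n2 (v : 'cV[C]_(n1 + n2)) :
  vn2 v = vn2 (usubmx v) + vn2 (dsubmx v).
Proof.
rewrite /vn2 big_split_ord /=.
by congr (_ + _); apply: eq_bigr => i _; rewrite mxE.
Qed.

Lemma cn2_le_vn2 n (v : 'cV[C]_n) i : cn2 (v i 0) <= vn2 v.
Proof.
rewrite /vn2 (bigD1 i)//= lerDl; apply: sumr_ge0 => j _; exact: cn2_ge0.
Qed.

Definition vip n (v w : 'cV[C]_n) : C := \sum_(i < n) v i 0 * (w i 0)^*.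

Lemma vip_self n (v : 'cV[C]_n) : vip v v = (vn2 v)%:C%C.
Proof.
rewrite /vip /vn2 [RHS]rmorph_sum; apply: eq_bigr => i _; exact: mulcJ.
Qed.

Lemma vipC n (v w : 'cV[C]_n) : vip w v = (vip v w)^*.
Proof. by rewrite /vip cj_sum; apply: eq_bigr => i _; rewrite cjM cjK mulrC. Qed.

Lemma vipE n (v w : 'cV[C]_n) : vip v w = ((adjmx w) *m v) 0 0.
Proof.
by rewrite mxE; apply: eq_bigr => i _; rewrite /adjmx !mxE mulrC.
Qed.

Lemma adjmxM m n p (A : 'M[C]_(m, n)) (B : 'M[C]_(n, p)) :
  adjmx (A *m B) = adjmx B *m adjmx A.
Proof. by rewrite /adjmx /conj_mx trmx_mul map_mxM. Qed.

Lemma adjmxK m n (A : 'M[C]_(m, n)) : adjmx (adjmx A) = A.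
Proof. by apply/matrixP => i j; rewrite !mxE cjK. Qed.

Lemma vip_adj m n (A : 'M[C]_(m, n)) v w : vip (A *m v) w = vip v (adjmx A *m w).
Proof. by rewrite !vipE adjmxM adjmxK mulmxA. Qed.

Lemma vn2_unitary m n (A : 'M[C]_(m, n)) v : adjmx A *m A = 1%:M -> vn2 (A *m v) = vn2 v.
Proof.
move=> AA; apply: complexI; rewrite -[LHS]vip_self vip_adj mulmxA AA mul1mx.
exact: vip_self.
Qed.

End VectorNorm.

Section SquareIntegrable.
Context {R : realType}.
Local Notation C := R[i].
Local Notation mu := (circ R).
Local Notation T := (measurableTypeR R).

Lemma measurable_vn2 n (f : R -> 'cV[C]_n) : measurable_mx f ->
  measurable_fun (setT : set T) (fun x => vn2 (f x)).
Proof.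
by move=> mf; apply: measurable_sum => i; apply: measurable_cn2; exact: mf.
Qed.

Lemma norm2E n (f : R -> 'cV[C]_n) :
  norm2 f = ((\int[mu]_(x in (setT : set T)) (vn2 (f x))%:E) `^ 2^-1)%E.
Proof.
rewrite /norm2 unlock /Lnorm /=; congr poweR; apply: eq_integral => x _.
by rewrite /= ger0_norm ?sqrtr_ge0// powR_mulrn ?sqrtr_ge0// vnorm_sq.
Qed.

Lemma L2P n (f : R -> 'cV[C]_n) :
  L2 n f <-> measurable_mx f /\ rintg (fun x => vn2 (f x)).
Proof.
rewrite /L2 /= norm2E; split=> -[mf hf]; split=> //.
  apply/integrableP; split; first by apply/measurable_EFinP; exact: measurable_vn2.
  have /lty_poweRy : (2^-1 : R) != 0 by rewrite invr_eq0 pnatr_eq0.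
  move=> /(_ _ hf).
  congr (_ < _)%E.
  by apply: eq_integral => x _ /=; rewrite ger0_norm ?vn2_ge0.
apply: poweR_lty; have /integrableP[_] := hf; congr (_ < _)%E.
by apply: eq_integral => x _ /=; rewrite ger0_norm ?vn2_ge0.
Qed.

Lemma norm2_L2 n (f : R -> 'cV[C]_n) : L2 n f ->
  norm2 f = (Num.sqrt (rint (fun x => vn2 (f x))))%:E.
Proof.
move=> /L2P[mf hf]; rewrite norm2E rintE// poweR_EFin powR12_sqrt//.
by apply: rint_ge0 => x; exact: vn2_ge0.
Qed.

Lemma L2_meas n (f : R -> 'cV[C]_n) : L2 n f -> measurable_mx f.
Proof. by case. Qed.

Lemma L2_rintg n (f : R -> 'cV[C]_n) : L2 n f -> rintg (fun x => vn2 (f x)).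
Proof. by case/L2P. Qed.

Lemma L2_le n m (f : R -> 'cV[C]_n) (g : R -> 'cV[C]_m) (M : R) : measurable_mx f ->
  L2 m g -> {ae mu, forall x, vn2 (f x) <= M * vn2 (g x)} -> L2 n f.
Proof.
move=> mf /L2P[mg hg] hfg; apply/L2P; split=> //.
have mfM := measurable_vn2 mf; have mgM := measurable_vn2 mg.
(* The domination holds only almost everywhere; the minimum obeys it everywhere and agrees with
   [vn2 (f x)] almost everywhere. *)
apply: (@rintg_ae _ (fun x => Num.min (vn2 (f x)) (`|M| * vn2 (g x)))) => //.
  apply: aeS hfg => x h; apply/min_idPl; apply: le_trans h _.
  by rewrite ler_wpM2r ?vn2_ge0// ler_norm.
apply: (rintg_le _ (rintgZ `|M| hg)).
  by apply: measurable_minr => //; exact: measurable_funM.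
move=> x; rewrite ger0_norm ?ge_min ?lexx ?orbT//.
by rewrite le_min vn2_ge0 mulr_ge0// vn2_ge0.
Qed.

Lemma L20 n : L2 n (fun=> 0 : 'cV[C]_n).
Proof.
apply/L2P; split; last by under eq_fun do rewrite vn20; exact: rintg_cst.
by move=> i j; under eq_fun do rewrite mxE; split; exact: measurable_cst.
Qed.

Lemma measurable_mx_lin n (c : C) (f g : R -> 'cV[C]_n) : measurable_mx f ->
  measurable_mx g -> measurable_mx (fun x => c *: f x + g x).
Proof.
move=> mf mg i j; apply: (@cmeas_eq _ (fun x => c * f x i j + g x i j)).
  by move=> x; rewrite !mxE.
apply: cmeasD; [apply: cmeasM|exact: mg]; [exact: cmeas_cst|exact: mf].
Qed.

Lemma L2_lin n (c : C) (f g : R -> 'cV[C]_n) : L2 n f -> L2 n g ->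
  L2 n (fun x => c *: f x + g x).
Proof.
move=> /L2P[mf hf] /L2P[mg hg].
have mfg := measurable_mx_lin c mf mg; apply/L2P; split=> //.
apply: (rintg_le (measurable_vn2 mfg)).
  exact: (rintgD (rintgZ (2 * cn2 c) hf) (rintgZ 2 hg)).
move=> x; rewrite ger0_norm ?vn2_ge0//; apply: le_trans (vn2D_le _ _) _.
by rewrite vn2Z mulrA.
Qed.

Lemma cintg_vip n (f g : R -> 'cV[C]_n) : L2 n f -> L2 n g ->
  cintg (fun x => vip (f x) (g x)).
Proof.
move=> /L2P[mf hf] /L2P[mg hg]; apply: cintg_sum => i; apply: cintg_mul.
- exact: mf.
- by apply: cmeasJ; exact: mg.
- apply: (rintg_le _ hf); first by apply: measurable_cn2; exact: mf.
  by move=> x; rewrite ger0_norm ?cn2_ge0// cn2_le_vn2.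
- apply: (rintg_le _ hg).
    by apply: measurable_cn2; apply: cmeasJ; exact: mg.
  by move=> x; rewrite cn2J ger0_norm ?cn2_ge0// cn2_le_vn2.
Qed.

Lemma cmeas_vip n (f g : R -> 'cV[C]_n) : measurable_mx f -> measurable_mx g ->
  cmeas (fun x => vip (f x) (g x)).
Proof.
move=> mf mg; apply: cmeas_sum => i; apply: cmeasM; first exact: mf.
by apply: cmeasJ; exact: mg.
Qed.

Lemma inner2E n (f g : R -> 'cV[C]_n) : inner2 f g = cintegral (fun x => vip (f x) (g x)).
Proof. by []. Qed.

Lemma inner2_ae n (f g f' g' : R -> 'cV[C]_n) : L2 n f -> L2 n g -> L2 n f' ->
  L2 n g' -> ae_eq_fun f f' -> ae_eq_fun g g' -> inner2 f g = inner2 f' g'.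
Proof.
move=> Lf Lg Lf' Lg' ff' gg'; rewrite !inner2E; apply: cint_ae.
- by apply: aeS2 ff' gg' => x -> ->.
- by apply: cmeas_vip; apply: L2_meas.
- by apply: cmeas_vip; apply: L2_meas.
Qed.

End SquareIntegrable.

(** * The space L2 modulo null functions *)

Section LSpace.
Context {R : realType}.
Local Notation C := R[i].
Local Notation mu := (circ R).
Variable n : nat.
Local Notation V := 'cV[C]_n.

(* a representative of the class of [f] modulo almost everywhere equality that
   depends only on the class *)
Definition canon (f : R -> V) : R -> V :=
  xget (fun=> 0) [set g | L2 n g /\ ae_eq_fun g f].

Lemma canon_ae (f : R -> V) : L2 n f -> ae_eq_fun (canon f) f.
Proof.
move=> Lf; suff [] : [set g | L2 n g /\ ae_eq_fun g f] (canon f) by [].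
by apply: xgetPex; exists f; split=> //; exact: ae_eq_funP.
Qed.

Lemma canon_L2 (f : R -> V) : L2 n (canon f).
Proof. by rewrite /canon; case: xgetP => [g _ []|] // _; exact: L20. Qed.

Lemma canon_eq (f g : R -> V) : ae_eq_fun f g -> canon f = canon g.
Proof.
move=> fg; rewrite /canon; congr xget; apply/seteqP.
split=> h [Lh hh]; split=> //; apply: ae_eq_fun_trans hh _ => //.
exact: ae_eq_fun_sym.
Qed.

(** The quotient of L2 by almost everywhere equality, realized as the type of canonical
    representatives, so that equality of classes is equality and the module laws can be stated with
    it. *)
Record lspace := LSpace { lrep : R -> V; lrepP : exists2 g : R -> V, L2 n g & lrep = canon g }.

HB.instance Definition _ := gen_eqMixin lspace.
HB.instance Definition _ := gen_choiceMixin lspace.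

Definition cls (f : R -> V) : lspace :=
  LSpace (ex_intro2 _ _ (canon f) (canon_L2 f) (erefl (canon (canon f)))).

Lemma lrep_L2 x : L2 n (lrep x).
Proof. by case: x => f [g Lg /= ->]; exact: canon_L2. Qed.

Lemma lrep_cls (f : R -> V) : L2 n f -> ae_eq_fun (lrep (cls f)) f.
Proof.
move=> Lf; apply: ae_eq_fun_trans (canon_ae _) (canon_ae Lf); exact: canon_L2.
Qed.

Lemma lspaceP x y : ae_eq_fun (lrep x) (lrep y) -> x = y.
Proof.
case: x y => f [g Lg fg] [f' [g' Lg' fg']] /= ff'.
have e : f = f'.
  rewrite fg fg'; apply: canon_eq; apply: ae_eq_fun_trans (canon_ae Lg').
  by apply: ae_eq_fun_trans (ae_eq_fun_sym (canon_ae Lg)) _; rewrite -fg -fg'.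
by rewrite {ff'}; move: fg' fg; rewrite e => p q; congr LSpace; exact: Prop_irrelevance.
Qed.

Lemma cls_eq (f g : R -> V) : L2 n f -> L2 n g -> ae_eq_fun f g -> cls f = cls g.
Proof.
move=> Lf Lg fg; apply: lspaceP; apply: ae_eq_fun_trans (lrep_cls Lf) _.
by apply: ae_eq_fun_trans fg (ae_eq_fun_sym (lrep_cls Lg)).
Qed.

Lemma cls_inj (f g : R -> V) : L2 n f -> L2 n g -> cls f = cls g -> ae_eq_fun f g.
Proof.
move=> Lf Lg fg; apply: ae_eq_fun_trans (ae_eq_fun_sym (lrep_cls Lf)) _.
by rewrite fg; exact: lrep_cls.
Qed.

Lemma lrepK x : cls (lrep x) = x.
Proof. by apply: lspaceP; apply: lrep_cls; exact: lrep_L2. Qed.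

Lemma cls_repr (f : R -> V) x : L2 n f -> ae_eq_fun (lrep x) f -> cls f = x.
Proof.
by move=> Lf h; rewrite -[RHS]lrepK; apply: cls_eq => //; [exact: lrep_L2|exact: ae_eq_fun_sym].
Qed.

Definition ladd x y := cls (fun t => lrep x t + lrep y t).
Definition lopp x := cls (fun t => - lrep x t).
Definition lscale (c : C) x := cls (fun t => c *: lrep x t).

Lemma L2D (f g : R -> V) : L2 n f -> L2 n g -> L2 n (fun x => f x + g x).
Proof.
by move=> Lf Lg; under eq_fun do rewrite -[f _]scale1r; exact: L2_lin.
Qed.

Lemma L2Z c (f : R -> V) : L2 n f -> L2 n (fun x => c *: f x).
Proof.
by move=> Lf; under eq_fun do rewrite -[_ *: _]addr0; apply: L2_lin => //; exact: L20.
Qed.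

Lemma L2N (f : R -> V) : L2 n f -> L2 n (fun x => - f x).
Proof. by move=> Lf; under eq_fun do rewrite -scaleN1r; exact: L2Z. Qed.

Lemma lrep_add x y : ae_eq_fun (lrep (ladd x y)) (fun t => lrep x t + lrep y t).
Proof. by apply: lrep_cls; apply: L2D; exact: lrep_L2. Qed.

Lemma lrep_opp x : ae_eq_fun (lrep (lopp x)) (fun t => - lrep x t).
Proof. by apply: lrep_cls; apply: L2N; exact: lrep_L2. Qed.

Lemma lrep_scale c x : ae_eq_fun (lrep (lscale c x)) (fun t => c *: lrep x t).
Proof. by apply: lrep_cls; apply: L2Z; exact: lrep_L2. Qed.

Fact laddA : associative ladd.
Proof.
move=> x y z; apply: lspaceP; apply: aeS (aeI (aeI (lrep_add x (ladd y z))
  (lrep_add (ladd x y) z)) (aeI (lrep_add x y) (lrep_add y z))).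
by move=> t [[-> ->] [-> ->]]; rewrite addrA.
Qed.

Fact laddC : commutative ladd.
Proof. by move=> x y; congr cls; apply/funext => t; rewrite addrC. Qed.

Fact ladd0 : left_id (cls (fun=> 0)) ladd.
Proof.
move=> x; apply: lspaceP.
apply: aeS (aeI (lrep_add (cls (fun=> 0)) x) (lrep_cls (L20 n))) => t [-> ->].
by rewrite add0r.
Qed.

Fact laddN : left_inverse (cls (fun=> 0)) lopp ladd.
Proof.
move=> x; apply: lspaceP.
apply: aeS (aeI (lrep_add (lopp x) x) (aeI (lrep_opp x) (lrep_cls (L20 n)))).
by move=> t [-> [-> ->]]; rewrite addNr.
Qed.

HB.instance Definition _ := GRing.isZmodule.Build lspace laddA laddC ladd0 laddN.

Fact lscaleA a b x : lscale a (lscale b x) = lscale (a * b) x.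
Proof.
apply: lspaceP.
apply: aeS (aeI (lrep_scale a (lscale b x)) (aeI (lrep_scale b x) (lrep_scale (a * b) x))).
move=> t [h1 [h2 h3]]; apply: etrans h1 _; apply: etrans (esym h3).
by rewrite -scalerA; congr (_ *: _); exact: h2.
Qed.

Fact lscale1 : left_id 1 lscale.
Proof.
by move=> x; apply: lspaceP; apply: aeS (lrep_scale 1 x) => t ->; rewrite scale1r.
Qed.

Fact lscaleDr : right_distributive lscale +%R.
Proof.
move=> a x y; apply: lspaceP.
apply: aeS (aeI (aeI (lrep_scale a (x + y)) (lrep_add x y))
  (aeI (lrep_add (lscale a x) (lscale a y)) (aeI (lrep_scale a x) (lrep_scale a y)))).
move=> t [[h1 h2] [h3 [h4 h5]]]; apply: etrans h1 _; apply: etrans (esym h3).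
apply: etrans (congr1 ( *:%R a) h2) _.
by rewrite scalerDr; congr (_ + _); apply: esym; [exact: h4|exact: h5].
Qed.

Fact lscaleDl x : {morph lscale^~ x : a b / a + b}.
Proof.
move=> a b; apply: lspaceP.
apply: aeS (aeI (lrep_scale (a + b) x)
  (aeI (lrep_add (lscale a x) (lscale b x)) (aeI (lrep_scale a x) (lrep_scale b x)))).
move=> t [h1 [h2 [h3 h4]]]; apply: etrans h1 _; apply: etrans (esym h2).
by rewrite scalerDl; congr (_ + _); apply: esym; [exact: h3|exact: h4].
Qed.

HB.instance Definition _ :=
  GRing.Zmodule_isLmodule.Build C lspace lscaleA lscale1 lscaleDr lscaleDl.

Lemma cls_lin c (f g : R -> V) : L2 n f -> L2 n g ->
  cls (fun t => c *: f t + g t) = c *: cls f + cls g.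
Proof.
move=> Lf Lg; apply: cls_repr; first exact: L2_lin.
apply: aeS (aeI (lrep_add (c *: cls f) (cls g)) (aeI (lrep_scale c (cls f))
  (aeI (lrep_cls Lf) (lrep_cls Lg)))).
by move=> t [-> [-> [-> ->]]].
Qed.

Lemma lrep_lin c x y : ae_eq_fun (lrep (c *: x + y)) (fun t => c *: lrep x t + lrep y t).
Proof. by apply: aeS2 (lrep_add (c *: x) y) (lrep_scale c x) => t -> ->. Qed.

Lemma lrep0 : ae_eq_fun (lrep 0) (fun=> 0).
Proof. exact/lrep_cls/L20. Qed.

Lemma lrepB x y : ae_eq_fun (lrep (x - y)) (fun t => lrep x t - lrep y t).
Proof. by apply: aeS2 (lrep_add x (- y)) (lrep_opp y) => t -> ->. Qed.

Lemma clsB (f g : R -> V) : L2 n f -> L2 n g -> cls (fun t => f t - g t) = cls f - cls g.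
Proof.
move=> Lf Lg; apply: cls_repr; first exact: (L2D Lf (L2N Lg)).
apply: aeS2 (lrepB (cls f) (cls g)) (aeI (lrep_cls Lf) (lrep_cls Lg)).
by move=> t -> [-> ->].
Qed.

Definition lip (x y : lspace) : C := inner2 (lrep x) (lrep y).

Lemma lip_cls (f g : R -> V) : L2 n f -> L2 n g -> lip (cls f) (cls g) = inner2 f g.
Proof.
move=> Lf Lg; apply: inner2_ae => //; [exact: lrep_L2..|exact: lrep_cls|exact: lrep_cls].
Qed.

Fact lip_linl c x y z : lip (c *: x + y) z = c * lip x z + lip y z.
Proof.
rewrite /lip (@inner2_ae _ _ _ _ (fun t => c *: lrep x t + lrep y t) (lrep z)) //;
  try (by exact: lrep_L2); last first.
- exact: ae_eq_funP.
- exact: lrep_lin.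
- by apply: L2_lin; exact: lrep_L2.
have i1 := cintg_vip (lrep_L2 x) (lrep_L2 z); have i2 := cintg_vip (lrep_L2 y) (lrep_L2 z).
rewrite !inner2E -cintZ// -cintD//; last exact: cintgZ.
congr cintegral; apply/funext => t; rewrite /vip mulr_sumr -big_split /=.
by apply: eq_bigr => i _; rewrite !mxE mulrDl mulrA.
Qed.

Fact lip_conj x y : lip y x = (lip x y)^*.
Proof.
rewrite /lip !inner2E -cintJ; last by apply: cintg_vip; exact: lrep_L2.
by congr cintegral; apply/funext => t; exact: vipC.
Qed.

Lemma Re_lip x : complex.Re (lip x x) = rint (fun t => vn2 (lrep x t)).
Proof.
by rewrite /lip inner2E /cintegral /=; congr rint; apply/funext => t; rewrite vip_self.
Qed.

Fact lip_ge0 x : 0 <= complex.Re (lip x x).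
Proof. by rewrite Re_lip; apply: rint_ge0 => t; exact: vn2_ge0. Qed.

Fact lip_eq0 x : complex.Re (lip x x) = 0 -> x = 0.
Proof.
rewrite Re_lip => h; apply: lspaceP.
have := rint_eq0 (L2_rintg (lrep_L2 x)) (fun t => vn2_ge0 _) h.
by apply: aeS2 lrep0 => t -> /vn2_eq0 ->.
Qed.

End LSpace.

(** * Completeness of L2 *)

Section Completeness.
Context {R : realType}.
Local Notation C := R[i].
Local Notation mu := (circ R).
Local Notation T := (measurableTypeR R).

Lemma geometric_cauchy_limit (x : nat -> R) (M : R) :
  (forall k j, (k <= j)%N -> (x j - x k) ^+ 2 <= M * 2^-1 ^+ k) ->
  exists2 a : R, x k @[k --> \oo] --> a & forall k, (a - x k) ^+ 2 <= M * 2^-1 ^+ k.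
Proof.
move=> h.
have M0 : 0 <= M.
  by have := h 0 0 (leqnn 0); rewrite expr0 mulr1 subrr expr0n.
have small (e : R) : 0 < e -> exists k, M * 2^-1 ^+ k < e.
  move=> e0; have : M * 2^-1 ^+ n @[n --> \oo] --> M * 0.
    apply: cvgMr; apply: cvg_expr.
    by rewrite ger0_norm ?invr_ge0// invf_lt1// ltr1n.
  rewrite mulr0 => /cvgrPdist_lt/(_ e e0)[N _ hN]; exists N.
  have := hN N (leqnn N); rewrite /= sub0r normrN ger0_norm//.
  by rewrite mulr_ge0// exprn_ge0// invr_ge0.
have cx : cvg (x k @[k --> \oo]).
  apply/cauchy_cvgP/cauchy_exP => e e0.
  have [N hN] : exists k, M * 2^-1 ^+ k < e ^+ 2 by apply: small; rewrite exprn_gt0.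
  exists (x N), N => // j Nj; rewrite /ball /= distrC.
  rewrite -(@ltr_pXn2r _ 2)// ?nnegrE ?ltW// real_normK ?num_real//.
  exact: le_lt_trans (h _ _ Nj) hN.
have [a ha] : exists a : R, x k @[k --> \oo] --> a by exists (lim (x k @[k --> \oo])).
exists a => // k.
have hc : (x j - x k) ^+ 2 @[j --> \oo] --> (a - x k) ^+ 2.
  by rewrite expr2; apply: cvgM; (apply: cvgB => //; exact: cvg_cst).
apply: (cvgr_to_le hc); exists k => // j; exact: h.
Qed.

(** Each use of [vn2D_le] costs a factor 2, which the weights [2 ^+ i.+1] pay for. *)
Lemma telescope_vn2 n (f : nat -> 'cV[C]_n) k m :
  2 ^+ k * vn2 (f (k + m)%N - f k) <=
  \sum_(k <= i < k + m) 2 ^+ i.+1 * vn2 (f i.+1 - f i).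
Proof.
elim: m k => [|m IH] k; first by rewrite addn0 subrr vn20 mulr0 big_geq.
rewrite big_ltn ?addnS ?ltnS ?leq_addr//.
have -> : f (k + m).+1 - f k = (f k.+1 - f k) + (f (k.+1 + m)%N - f k.+1).
  by rewrite addSn [RHS]addrC addrA subrK.
apply: le_trans (_ : 2 ^+ k * (2 * vn2 (f k.+1 - f k) +
    2 * vn2 (f (k.+1 + m)%N - f k.+1)) <= _).
  by rewrite ler_wpM2l ?exprn_ge0// vn2D_le.
rewrite mulrDr !mulrA -exprSr lerD2l -addSn; exact: IH.
Qed.

(** The weighted sum [D] of the squared steps has integral at most the sum of the [2^(i+1) * 4^-i],
    that is 4, so it is finite almost everywhere. Where it is finite, telescoping bounds
    [2^k * vn2 (f j - f k)] by it, which gives a pointwise limit with a rate; integrating the rate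
    gives convergence in norm. *)
Lemma L2_complete n (f : nat -> R -> 'cV[C]_n) : (forall k, L2 n (f k)) ->
  (forall k, rint (fun t => vn2 (f k.+1 t - f k t)) <= 4^-1 ^+ k) ->
  exists2 g, L2 n g & exists K, forall k, rint (fun t => vn2 (g t - f k t)) <= K * 2^-1 ^+ k.
Proof.
move=> Lf hf.
have Ld k : L2 n (fun t => f k.+1 t - f k t) by apply: L2D => //; apply: L2N.
pose w i t := 2 ^+ i.+1 * vn2 (f i.+1 t - f i t).
have w0 i t : 0 <= w i t by rewrite mulr_ge0 ?exprn_ge0// vn2_ge0.
have iw i : rintg (w i) by apply: rintgZ; exact: L2_rintg.
pose D t := (\sum_(0 <= i <oo) (w i t)%:E)%E.
have mw i : measurable_fun (setT : set T) (fun t => (w i t)%:E).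
  by apply/measurable_EFinP; exact: (rintg_meas (iw i)).
have D0 t : (0 <= D t)%E by apply: nneseries_ge0 => i _ _; rewrite lee_fin.
have mD : measurable_fun (setT : set T) D.
  apply: (@ge0_emeasurable_sum _ T _ _ (fun i (t : T) => (w i t)%:E) xpredT).
    by move=> i t _ _; rewrite lee_fin.
  by move=> i _; exact: mw.
have intD : (\int[mu]_(t in (setT : set T)) D t <= EFin 4%R)%E.
  rewrite integral_nneseries//; last by move=> i t _; rewrite lee_fin.
  apply: le_trans (@epsilon_trick0 R 4 xpredT _); last by [].
  apply: lee_nneseries => i _; first by move=> _; rewrite rintE// lee_fin; exact: rint_ge0.
  rewrite rintE// lee_fin rintZ; last exact: L2_rintg.
  apply: le_trans (ler_wpM2l _ (hf i)) _; first by rewrite exprn_ge0.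
  rewrite natrX ler_pdivlMr ?exprn_gt0// mulrAC -exprMn.
  rewrite (_ : (2 * 2 : R) = 4); last by ring.
  by rewrite exprSr mulrAC -exprMn mulfV ?expr1n ?mul1r// pnatr_eq0.
have iD : mu.-integrable (setT : set T) D.
  apply/integrableP; split; first exact: mD.
  apply: (@le_lt_trans _ _ (EFin 4)); last exact: ltry.
  by apply: le_trans intD; rewrite le_eqVlt; apply/orP; left; apply/eqP;
    apply: eq_integral => t _; rewrite gee0_abs.
have finD : {ae mu, forall t, D t \is a fin_num}.
  by apply: aeS (integrable_ae _ iD) => // t /(_ I).
pose r t := fine (D t).
have mr : measurable_fun (setT : set T) r.
  by apply: (measurableT_comp _ mD); exact: fine_measurable.
have ir : rintg r.
  apply/integrableP; split; first exact/measurable_EFinP.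
  have /integrableP[_] := iD; congr (_ < _)%E; apply: ae_eq_integral => //.
  - exact: (measurableT_comp _ mD).
  - by apply: measurableT_comp => //; exact/measurable_EFinP.
  by apply: aeS finD => t ft _; rewrite /comp /r fineK.
have bnd t k j : D t \is a fin_num -> (k <= j)%N -> vn2 (f j t - f k t) <= r t * 2^-1 ^+ k.
  move=> ft kj; have := telescope_vn2 (fun i => f i t) k (j - k); rewrite subnKC//.
  rewrite exprVn ler_pdivlMr ?exprn_gt0// mulrC => h; apply: le_trans h _.
  have : (\sum_(0 <= i < j) (w i t)%:E <= D t)%E.
    by apply: nneseries_lim_ge => i _ _; rewrite lee_fin.
  rewrite -(fineK ft) sumEFin lee_fin; apply: le_trans.
  rewrite [leRHS](big_cat_nat (n := k))//= lerDr.
  by apply: sumr_ge0 => i _; exact: w0.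
(* The upper limit is measurable whether or not the sequence converges, and it is the limit wherever
   [D] is finite. *)
pose gr i t := fine (limn_esup (fun k => (complex.Re (f k t i 0))%:E)).
pose gi i t := fine (limn_esup (fun k => (complex.Im (f k t i 0))%:E)).
pose g t : 'cV[C]_n := \col_i Complex (gr i t) (gi i t).
have mg : measurable_mx g.
  move=> i j; rewrite (_ : (fun x => _) = gr i); last first.
    by apply/funext => t; rewrite mxE.
  rewrite (_ : (fun x => complex.Im _) = gi i); last first.
    by apply/funext => t; rewrite mxE.
  have [h1 h2] : (forall k, measurable_fun (setT : set T) (fun x => (complex.Re (f k x i 0))%:E)) /\
      (forall k, measurable_fun (setT : set T) (fun x => (complex.Im (f k x i 0))%:E)).
    by split=> k; apply/measurable_EFinP; case: (L2_meas (Lf k) i 0).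
  split.
    by apply: (measurableT_comp (fine_measurable measurableT));
      exact: measurable_fun_limn_esup.
  by apply: (measurableT_comp (fine_measurable measurableT));
    exact: measurable_fun_limn_esup.
have glim t k : D t \is a fin_num -> vn2 (g t - f k t) <= (2 * n%:R * r t) * 2^-1 ^+ k.
  move=> ft; have comp i : cn2 ((g t - f k t) i 0) <= 2 * (r t * 2^-1 ^+ k).
    have le2 (a b : nat) : (a <= b)%N -> cn2 (f b t i 0 - f a t i 0) <= r t * 2^-1 ^+ a.
      move=> ab; apply: le_trans (bnd t _ _ ft ab).
      by have := cn2_le_vn2 (f b t - f a t) i; rewrite !mxE.
    have [|a1 c1 h1] := @geometric_cauchy_limit (fun k => complex.Re (f k t i 0)) (r t).
      move=> a b ab; apply: le_trans (le2 a b ab).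
      by rewrite /cn2 ReD ReN lerDl sqr_ge0.
    have [|a2 c2 h2] := @geometric_cauchy_limit (fun k => complex.Im (f k t i 0)) (r t).
      move=> a b ab; apply: le_trans (le2 a b ab).
      by rewrite /cn2 ImD ImN lerDr sqr_ge0.
    have e1 : gr i t = a1.
      rewrite /gr; have /cvg_limn_einf_sup[_ ->//] :
        (complex.Re (f k t i 0))%:E @[k --> \oo] --> a1%:E.
      by apply: cvg_EFin; [exact: nearW|exact: c1].
    have e2 : gi i t = a2.
      rewrite /gi; have /cvg_limn_einf_sup[_ ->//] :
        (complex.Im (f k t i 0))%:E @[k --> \oo] --> a2%:E.
      by apply: cvg_EFin; [exact: nearW|exact: c2].
    rewrite !mxE /cn2 !cE /= e1 e2; have := h1 k; have := h2 k; lra.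
  rewrite /vn2; apply: le_trans (ler_sum _ (fun i _ => comp i)) _.
  rewrite sumr_const card_ord -[leLHS]mulr_natl.
  by rewrite le_eqVlt; apply/orP; left; apply/eqP; ring.
have mgf k : measurable_mx (fun t => g t - f k t).
  have := measurable_mx_lin (-1) (L2_meas (Lf k)) mg.
  by under eq_fun do rewrite scaleN1r addrC.
have Lgf k : L2 n (fun t => g t - f k t).
  apply/L2P; split=> //.
  have i2 := rintgZ (2 * n%:R * 2^-1 ^+ k) ir.
  (* As in [L2_le], the minimum turns a bound valid almost everywhere into one valid everywhere. *)
  apply: (@rintg_ae _ (fun t => Num.min (vn2 (g t - f k t)) (2 * n%:R * 2^-1 ^+ k * r t))).
  - apply: aeS finD => t ft; apply/min_idPl; apply: le_trans (glim t k ft) _.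
    by rewrite mulrAC.
  - apply: (rintg_le _ i2).
      by apply: measurable_minr; [exact: measurable_vn2|exact: rintg_meas].
    move=> t; rewrite ger0_norm ?ge_min ?lexx ?orbT//.
    rewrite le_min vn2_ge0 !mulr_ge0// ?exprn_ge0 ?invr_ge0//.
    exact/fine_ge0.
  - exact: measurable_vn2.
exists g.
  by have := L2D (Lgf 0) (Lf 0); under eq_fun do rewrite subrK.
exists (2 * n%:R * rint r) => k.
have irk := rintgZ (2 * n%:R * 2^-1 ^+ k) ir.
rewrite mulrAC -rintZ//.
have -> : rint (fun t => vn2 (g t - f k t)) =
    rint (fun t => Num.min (vn2 (g t - f k t)) (2 * n%:R * 2^-1 ^+ k * r t)).
  apply: rint_ae.
  - apply: aeS finD => t ft; apply/esym/min_idPl; apply: le_trans (glim t k ft) _.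
    by rewrite mulrAC.
  - exact: measurable_vn2.
  - by apply: measurable_minr; [exact: measurable_vn2|exact: rintg_meas].
apply: rint_le => //; last by move=> t; rewrite ge_min lexx orbT.
apply: (rintg_le _ irk).
  by apply: measurable_minr; [exact: measurable_vn2|exact: rintg_meas].
move=> t; rewrite ger0_norm ?ge_min ?lexx ?orbT//.
rewrite le_min vn2_ge0 !mulr_ge0// ?exprn_ge0 ?invr_ge0//.
exact/fine_ge0.
Qed.

Lemma L2_meas_vn2 n (f : R -> 'cV[C]_n) : L2 n f ->
  measurable_fun (setT : set T) (fun x => vn2 (f x)).
Proof. by move=> Lf; exact: measurable_vn2 (L2_meas Lf). Qed.

Variable n : nat.

Lemma Re_lip_sub (x y : @lspace R n) :
  complex.Re (lip (x - y) (x - y)) = rint (fun t => vn2 (lrep x t - lrep y t)).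
Proof.
rewrite Re_lip; apply: rint_ae.
- by apply: aeS (lrepB x y) => t ->.
- exact: (L2_meas_vn2 (lrep_L2 _)).
- exact: (L2_meas_vn2 (L2D (lrep_L2 x) (L2N (lrep_L2 y)))).
Qed.

Fact lspace_complete (f : nat -> @lspace R n) :
  (forall k, complex.Re (lip (f k.+1 - f k) (f k.+1 - f k)) <= 4^-1 ^+ k) ->
  exists g, forall e : R, 0 < e -> exists N, forall k, (N <= k)%N ->
    complex.Re (lip (g - f k) (g - f k)) < e.
Proof.
move=> h; have [|k|g Lg [K hK]] := @L2_complete n (fun k => lrep (f k)).
- by move=> k; exact: lrep_L2.
- by rewrite -Re_lip_sub.
exists (cls g) => e e0.
have [N hN] : exists N, forall k, (N <= k)%N -> K * 2^-1 ^+ k < e.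
  have : K * 2^-1 ^+ n @[n --> \oo] --> K * 0.
    apply: cvgMr; apply: cvg_expr.
    by rewrite ger0_norm ?invr_ge0// invf_lt1// ltr1n.
  rewrite mulr0 => /cvgrPdist_lt/(_ e e0)[N _ hN]; exists N => k Nk.
  have := hN k Nk; rewrite /= sub0r normrN; apply: le_lt_trans; exact: ler_norm.
exists N => k Nk; apply: le_lt_trans (hN k Nk); apply: le_trans (hK k).
rewrite Re_lip_sub le_eqVlt; apply/orP; left; apply/eqP; apply: rint_ae.
- by apply: aeS (lrep_cls Lg) => t ->.
- exact: (L2_meas_vn2 (L2D (lrep_L2 _) (L2N (lrep_L2 _)))).
- exact: (L2_meas_vn2 (L2D Lg (L2N (lrep_L2 _)))).
Qed.

Definition Hil : hilb := Hilb (@lip_linl R n) (@lip_conj R n) (@lip_ge0 R n)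
  (@lip_eq0 R n) lspace_complete.

Lemma nsq_Hil (x : Hil) : nsq x = rint (fun t => vn2 (lrep x t)).
Proof. exact: Re_lip. Qed.

Lemma nsq_cls (f : R -> 'cV[C]_n) : L2 n f -> nsq (cls f : Hil) = rint (fun t => vn2 (f t)).
Proof.
move=> Lf; rewrite nsq_Hil; apply: rint_ae.
- by apply: aeS (lrep_cls Lf) => t ->.
- exact: (L2_meas_vn2 (lrep_L2 _)).
- exact: (L2_meas_vn2 Lf).
Qed.

Lemma ip_cls (f g : R -> 'cV[C]_n) : L2 n f -> L2 n g ->
  ip (cls f : Hil) (cls g) = inner2 f g.
Proof. exact: lip_cls. Qed.

Lemma norm2_nsq (f : R -> 'cV[C]_n) : L2 n f ->
  norm2 f = (Num.sqrt (nsq (cls f : Hil)))%:E.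
Proof. by move=> Lf; rewrite nsq_cls// norm2_L2. Qed.

End Completeness.
Arguments Hil {R} n.

(** * Multiplication by bounded matrix functions *)

Section Multiplication.
Context {R : realType}.
Local Notation C := R[i].
Local Notation mu := (circ R).
Local Notation T := (measurableTypeR R).

(** Boundedness is expressed by entries, which passes directly to blocks, transposes, products and
    adjoints. *)
Definition bmx m n (F : R -> 'M[C]_(m, n)) := measurable_mx F /\
  exists M : R, {ae mu, forall x, forall i j, cn2 (F x i j) <= M}.

Lemma cn2_sum_le (I : finType) (F : I -> C) :
  cn2 (\sum_i F i) <= #|I|%:R * \sum_i cn2 (F i).
Proof.
have ind (r : seq I) : cn2 (\sum_(i <- r) F i) <= (size r)%:R * \sum_(i <- r) cn2 (F i).
  elim: r => [|i r IH]; first by rewrite !big_nil cn2_0 mulr0.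
  rewrite !big_cons /=; set S := \sum_(_ <- r) F _ in IH *.
  set Q := \sum_(_ <- r) cn2 _ in IH *.
  have Q0 : 0 <= Q by apply: sumr_ge0 => j _; exact: cn2_ge0.
  have s0 : 0 <= (size r)%:R :> R by [].
  case: r @S @Q IH Q0 s0 => [|j r] S Q IH Q0 s0.
    by rewrite /S big_nil addr0 /= mul1r lerDl.
  set s : R := (size (j :: r))%:R in IH s0 *.
  have s1 : 0 < s by rewrite ltr0n.
  rewrite -[X in X * _]/((size (j :: r)).+1%:R) -addn1 natrD -/s.
  have : cn2 (F i + S) <= (1 + s) * cn2 (F i) + (1 + s^-1) * cn2 S.
    rewrite /cn2 !cE.
    move: (complex.Re (F i)) (complex.Im (F i)) (complex.Re S) (complex.Im S) => a b c d.
    (* The weight [s], the number of terms already added, is chosen so that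
       [(1 + s^-1) * s = s + 1]. *)
    have sq x y : (x + y) ^+ 2 <= (1 + s) * x ^+ 2 + (1 + s^-1) * y ^+ 2.
      rewrite -subr_ge0.
      have -> : (1 + s) * x ^+ 2 + (1 + s^-1) * y ^+ 2 - (x + y) ^+ 2 =
          s^-1 * (s * x - y) ^+ 2 by field; rewrite gt_eqF.
      by rewrite mulr_ge0 ?invr_ge0 ?sqr_ge0.
    by have := sq a c; have := sq b d; lra.
  have : (1 + s^-1) * cn2 S <= (1 + s^-1) * (s * Q).
    by rewrite ler_wpM2l// addr_ge0// invr_ge0.
  have -> : (1 + s^-1) * (s * Q) = (s + 1) * Q by field; rewrite gt_eqF.
  by lra.
by have := ind (index_enum I); rewrite -[index_enum I]enumT -cardE.
Qed.

Lemma bmx_vn2 m n (F : R -> 'M[C]_(m, n)) : bmx F ->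
  exists M : R, {ae mu, forall x, forall v, vn2 (F x *m v) <= M * vn2 v}.
Proof.
move=> [_ [M hM]]; exists (m%:R * (n%:R * M)).
apply: aeS hM => x hx v.
have row i : cn2 ((F x *m v) i 0) <= n%:R * M * vn2 v.
  rewrite mxE; apply: le_trans (cn2_sum_le _) _; rewrite card_ord -mulrA.
  rewrite ler_wpM2l// /vn2 mulr_sumr; apply: ler_sum => j _.
  by rewrite cn2M ler_wpM2r// cn2_ge0.
rewrite {1}/vn2; apply: le_trans (ler_sum _ (fun i _ => row i)) _.
by rewrite sumr_const card_ord -[leLHS]mulr_natl !mulrA.
Qed.

Lemma measurable_mulmx m n p (F : R -> 'M[C]_(m, n)) (G : R -> 'M[C]_(n, p)) :
  measurable_mx F -> measurable_mx G -> measurable_mx (fun x => F x *m G x).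
Proof.
move=> mF mG i j; apply: (@cmeas_eq _ (fun x => \sum_k F x i k * G x k j)).
  by move=> x; rewrite mxE.
by apply: cmeas_sum => k; apply: cmeasM; [exact: mF|exact: mG].
Qed.

Lemma L2_mul m n (F : R -> 'M[C]_(m, n)) f : bmx F -> L2 n f -> L2 m (fun x => F x *m f x).
Proof.
move=> bF Lf; have [M hM] := bmx_vn2 bF; apply: (@L2_le _ _ _ _ f M) => //.
  by apply: measurable_mulmx; [case: bF|exact: L2_meas].
by apply: aeS hM => x.
Qed.

Definition mulop m n (F : R -> 'M[C]_(m, n)) (x : Hil n) : Hil m :=
  cls (fun t => F t *m lrep x t).

Lemma lrep_mulop m n (F : R -> 'M[C]_(m, n)) x : bmx F ->
  ae_eq_fun (lrep (mulop F x)) (fun t => F t *m lrep x t).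
Proof. by move=> bF; apply: lrep_cls; apply: L2_mul => //; exact: lrep_L2. Qed.

Lemma mulop_cls m n (F : R -> 'M[C]_(m, n)) f : bmx F -> L2 n f ->
  mulop F (cls f) = cls (fun t => F t *m f t).
Proof.
move=> bF Lf; apply: cls_eq; [apply: L2_mul => //; exact: lrep_L2|exact: L2_mul|].
by apply: aeS (lrep_cls Lf) => t ->.
Qed.

Lemma mulop_lin m n (F : R -> 'M[C]_(m, n)) : bmx F -> hlin (mulop F).
Proof.
move=> bF c x y; rewrite /mulop.
rewrite -(@cls_lin R m c (fun t => F t *m lrep x t) (fun t => F t *m lrep y t));
  try (by apply: L2_mul => //; exact: lrep_L2).
apply: cls_eq; first by apply: L2_mul => //; exact: lrep_L2.
  by apply: L2_lin; apply: L2_mul => //; exact: lrep_L2.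
by apply: aeS (lrep_lin c x y) => t ->; rewrite mulmxDr scalemxAr.
Qed.

Lemma mulop_comp m n p (F : R -> 'M[C]_(m, n)) (G : R -> 'M[C]_(n, p)) x :
  bmx F -> bmx G -> mulop F (mulop G x) = mulop (fun t => F t *m G t) x.
Proof.
move=> bF bG; rewrite /mulop; apply: lspaceP.
have LG := L2_mul bG (lrep_L2 x).
apply: ae_eq_fun_trans (lrep_mulop (mulop G x) bF) _.
have L : L2 m (fun t => F t *m (G t *m lrep x t)) by exact: L2_mul.
have e : (fun t => F t *m (G t *m lrep x t)) = (fun t => F t *m G t *m lrep x t).
  by apply/funext => t; rewrite mulmxA.
rewrite e in L; apply: ae_eq_fun_sym; apply: ae_eq_fun_trans (lrep_cls L) _.
apply: ae_eq_fun_sym; apply: aeS (lrep_mulop x bG) => t h.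
by rewrite -mulmxA; congr (_ *m _); exact: h.
Qed.

Lemma mulop_eq m n (F G : R -> 'M[C]_(m, n)) x : bmx F -> bmx G ->
  ae_eq_fun F G -> mulop F x = mulop G x.
Proof.
move=> bF bG FG; apply: cls_eq; try (by apply: L2_mul => //; exact: lrep_L2).
by apply: aeS FG => t ->.
Qed.

Lemma bmx_adj m n (F : R -> 'M[C]_(m, n)) : bmx F -> bmx (fun t => adjmx (F t)).
Proof.
move=> [mF [M hM]]; split.
  move=> i j; apply: (@cmeas_eq _ (fun x => (F x j i)^*)).
    by move=> x; rewrite !mxE.
  by apply: cmeasJ; exact: mF.
by exists M; apply: aeS hM => x h i j; rewrite !mxE cn2J.
Qed.

Lemma mulop_adj m n (F : R -> 'M[C]_(m, n)) x y : bmx F ->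
  ip (mulop F x) y = ip x (mulop (fun t => adjmx (F t)) y).
Proof.
move=> bF; have bF' := bmx_adj bF.
rewrite -(lrepK x) -(lrepK y) !mulop_cls ?ip_cls ?inner2E; try exact: lrep_L2;
  try (by apply: L2_mul => //; exact: lrep_L2); try by [].
by congr cintegral; apply/funext => t; exact: vip_adj.
Qed.

Lemma mulop1 n (F : R -> 'M[C]_n) x : bmx F -> {ae mu, forall t, F t = 1%:M} ->
  mulop F x = x.
Proof.
move=> bF hF; apply: cls_repr; first by apply: L2_mul => //; exact: lrep_L2.
by apply: aeS hF => t ->; rewrite mul1mx.
Qed.

Lemma bmxM m n p (F : R -> 'M[C]_(m, n)) (G : R -> 'M[C]_(n, p)) :
  bmx F -> bmx G -> bmx (fun t => F t *m G t).
Proof.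
move=> [mF [M hM]] [mG [M' hM']]; split; first exact: measurable_mulmx.
exists (n%:R * (n%:R * (M * M'))); apply: aeS2 hM hM' => x h h' i j.
rewrite mxE; apply: le_trans (cn2_sum_le _) _; rewrite card_ord ler_wpM2l//.
apply: le_trans (_ : \sum_(k < n) M * M' <= _).
  apply: ler_sum => k _; rewrite cn2M; apply: ler_pM => //; exact: cn2_ge0.
by rewrite sumr_const card_ord -[leLHS]mulr_natl.
Qed.

Lemma bmx_cst m n (A : 'M[C]_(m, n)) : bmx (fun=> A).
Proof.
split; first by move=> i j; exact: cmeas_cst.
exists (\sum_i \sum_j cn2 (A i j)); apply: ae_all => x i j.
rewrite (bigD1 i)//= (bigD1 j)//= -addrA lerDl addr_ge0//.
  by apply: sumr_ge0 => k _; exact: cn2_ge0.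
by apply: sumr_ge0 => k _; apply: sumr_ge0 => l _; exact: cn2_ge0.
Qed.

End Multiplication.

(** * Fourier coefficients and Hardy spaces *)

Section Characters.
Context {R : realType}.
Local Notation C := R[i].
Local Notation mu := (circ R).
Local Notation T := (measurableTypeR R).

Lemma cisD (a b : R) : cis (a + b) = cis a * cis b.
Proof. by apply: complex_eq; rewrite !cE /= ?cosD ?sinD//; ring. Qed.

Lemma cisN (a : R) : cis (- a) = (cis a)^*.
Proof. by apply: complex_eq; rewrite !cE /= ?cosN ?sinN. Qed.

Lemma cis0 : cis 0 = 1 :> C.
Proof. by apply: complex_eq; rewrite /= ?cos0 ?sin0. Qed.

Lemma cn2_cis (a : R) : cn2 (cis a) = 1.
Proof. exact: cos2Dsin2. Qed.

Lemma cis_int (k : int) : cis (2 * pi * k%:~R) = 1 :> C.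
Proof.
have h (n : nat) : cis (2 * pi * n%:R) = 1 :> C.
  elim: n => [|n IH]; first by rewrite mulr0 cis0.
  rewrite -(addn1 n) natrD mulrDr cisD IH mul1r mulr1 mulr_natl.
  by apply: complex_eq; rewrite /= ?cos2pi ?sin2pi.
case: k => n; first exact: h.
by rewrite NegzE mulrNz mulrN cisN h cj1.
Qed.

Definition chi (k : int) (x : R) : C := cis (2 * pi * k%:~R * x).

Lemma chiD k l x : chi (k + l) x = chi k x * chi l x.
Proof. by rewrite /chi -cisD; congr cis; rewrite intrD; ring. Qed.

Lemma chiN k x : chi (- k) x = (chi k x)^*.
Proof. by rewrite /chi -cisN; congr cis; rewrite intrN; ring. Qed.

Lemma chi0 x : chi 0 x = 1.
Proof. by rewrite /chi mulr0 mul0r cis0. Qed.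

Lemma cn2_chi k x : cn2 (chi k x) = 1.
Proof. exact: cn2_cis. Qed.

Lemma measurable_linear (a : R) : measurable_fun (setT : set T) (fun x : R => a * x).
Proof. exact: measurable_funM. Qed.

Lemma cmeas_cis (a : R) : cmeas (fun x => cis (a * x)).
Proof.
split.
  apply: (measurableT_comp _ (measurable_linear a)).
  by apply: continuous_measurable_fun => x; exact: continuous_cos.
apply: (measurableT_comp _ (measurable_linear a)).
by apply: continuous_measurable_fun => x; exact: continuous_sin.
Qed.

Lemma cmeas_chi k : cmeas (chi k).
Proof. exact: cmeas_cis. Qed.

Lemma cintg_mulb (f g : R -> C) (M : R) : cintg f -> cmeas g ->
  (forall x, cn2 (g x) <= M) -> cintg (fun x => f x * g x).
Proof.
move=> [f1 f2] mg gM.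
have mf : cmeas f by apply: cintg_meas.
have a1 := rintgZ (`|M| + 1) (integrable_norm f1).
have a2 := rintgZ (`|M| + 1) (integrable_norm f2).
apply: (@cintg_le _ _ _ (cmeasM mf mg) (rintgD a1 a2)) => x.
have hb y : y ^+ 2 <= M -> `|y| <= `|M| + 1.
  move=> yM; have : `|y| ^+ 2 <= `|M| by rewrite real_normK ?num_real//; apply: le_trans yM (ler_norm _).
  by have := normr_ge0 y; nra.
have hRe : `|complex.Re (g x)| <= `|M| + 1.
  by apply/hb/(le_trans _ (gM x)); rewrite lerDl sqr_ge0.
have hIm : `|complex.Im (g x)| <= `|M| + 1.
  by apply/hb/(le_trans _ (gM x)); rewrite lerDr sqr_ge0.
rewrite ReM ImM /=; split.
  apply: le_trans (ler_normB _ _) _; rewrite !normrM [leLHS]addrC addrC.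
  by rewrite lerD// mulrC ler_wpM2r.
apply: le_trans (ler_normD _ _) _; rewrite !normrM.
by rewrite lerD// mulrC ler_wpM2r.
Qed.

Lemma circ_integral (g : R -> R) : rintg g ->
  @integrable _ T R lebesgue_measure `[0%R, 1%R[%classic (EFin \o g) /\
  (\int[mu]_(x in (setT : set T)) (g x)%:E =
   \int[lebesgue_measure]_(x in `[0%R, 1%R[) (g x)%:E)%E.
Proof.
move=> ig; have mg := rintg_meas ig.
pose D : set T := `[0%R : R, 1%R[%classic; pose N : set T := ~` D.
have mD : measurable D by exact: measurable_itv.
have mN : measurable N by exact: measurableC.
have N0 : mu N = 0%E.
  by rewrite [LHS](_ : _ = lebesgue_measure (N `&` D))// /N setICl measure0.
have sameD (A : set T) : measurable A -> A `<=` D -> mu A = lebesgue_measure A.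
  by move=> mA AD; rewrite [LHS](_ : _ = lebesgue_measure (A `&` D))// setIidl.
have TD : setT `\` N = D by rewrite setDE setCK setTI.
split.
  apply/integrableP; split.
    by apply: measurable_funTS; apply/measurable_EFinP.
  have /integrableP[_] := ig; congr (_ < _)%E.
  rewrite (@ge0_negligible_integral _ T _ mu _ N)//.
    by rewrite TD; apply: eq_measure_integral => A mA AD; exact: sameD.
  by apply: measurableT_comp => //; exact/measurable_EFinP.
rewrite (@negligible_integral _ T _ mu _ N)//.
by rewrite TD; apply: eq_measure_integral => A mA AD; exact: sameD.
Qed.

Lemma rint_bounded (g : R -> R) : measurable_fun (setT : set T) g ->
  (forall x, `|g x| <= 1) -> rintg g.
Proof. by move=> mg h; apply: (rintg_le mg (rintg_cst 1)). Qed.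

Lemma rint_FTC (g G : R -> R) : continuous g -> (forall x, `|g x| <= 1) ->
  (forall x : R, is_derive x 1 G (g x)) -> rint g = G 1 - G 0.
Proof.
move=> cg g1 dG.
have mg : measurable_fun (setT : set T) g by apply: continuous_measurable_fun.
have [ig e] := circ_integral (rint_bounded mg g1).
have cG x : {for x, continuous G}.
  by apply: differentiable_continuous; apply/derivable1_diffP; case: (dG x).
apply/EFin_inj; rewrite -rintE; last exact: rint_bounded.
rewrite e integral_itv_bndo_bndc; last first.
  by apply/measurable_EFinP; apply: measurable_funTS.
rewrite (@continuous_FTC2 _ g G) ?EFinB//.
- exact: continuous_subspaceT.
- split=> [x _||]; first by case: (dG x).
    exact: cvg_at_right_filter (cG 0).
  exact: cvg_at_left_filter (cG 1).
by move=> x _; rewrite derive1E; have [_] := dG x.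
Qed.

Lemma rint_cst (a : R) : rint (fun=> a) = a.
Proof.
apply: EFin_inj; rewrite -rintE; last exact: rintg_cst.
by rewrite integral_cst// [X in (_ * X)%E]circ_setT mule1.
Qed.

(** For [k != 0] the primitives [sin (a x) / a] and [- cos (a x) / a] take equal values at 0 and
    1. *)
Lemma cint_chi k : cintegral (chi k) = (k == 0)%:R.
Proof.
case: eqVneq => [->|k0].
  rewrite /cintegral; apply: complex_eq => /=; rewrite -!/(rint _).
    by under eq_fun do rewrite /chi mulr0 mul0r /= cos0; rewrite rint_cst.
  by under eq_fun do rewrite /chi mulr0 mul0r /= sin0; rewrite rint_cst.
pose a : R := 2 * pi * k%:~R.
have a0 : a != 0.
  by rewrite !mulf_neq0// ?intr_eq0// ?gt_eqF// ?pi_gt0// ltr0n.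
have [ca sa] : cos a = 1 /\ sin a = 0.
  by have := cis_int k; rewrite -/a => -[-> ->].
have la (x : R) : is_derive x 1 (fun y : R => a * y) a.
  have h : is_derive x 1 (a \*: (@id R)) (a *: 1) by exact: is_deriveZ.
  by rewrite -[X in is_derive _ _ _ X]mulr1.
have dsin (x : R) : is_derive x 1 (fun x => a^-1 * sin (a * x)) (cos (a * x)).
  have h := is_derive1_comp (is_derive_sin (a * x)) (la x).
  have -> : cos (a * x) = a^-1 *: (cos (a * x) * a).
    by rewrite /GRing.scale /= [RHS]mulrC mulfK.
  exact: is_deriveZ.
have dcos (x : R) : is_derive x 1 (fun x => - a^-1 * cos (a * x)) (sin (a * x)).
  have h := is_derive1_comp (is_derive_cos (a * x)) (la x).
  have -> : sin (a * x) = - a^-1 *: (- sin (a * x) * a).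
    by rewrite /GRing.scale /= !mulNr mulrN opprK [RHS]mulrC mulfK.
  exact: is_deriveZ.
have lc : continuous (fun y : R => a * y).
  exact: mulrl_continuous.
have c1 : continuous (fun x : R => cos (a * x)).
  by move=> x; apply: (continuous_comp (lc x)); exact: continuous_cos.
have c2 : continuous (fun x : R => sin (a * x)).
  by move=> x; apply: (continuous_comp (lc x)); exact: continuous_sin.
rewrite /cintegral; apply: complex_eq => /=; rewrite -!/(rint _).
  rewrite (rint_FTC c1 _ dsin); last by move=> x; exact: cos_max.
  by rewrite mulr1 mulr0 sa sin0 subrr.
rewrite (rint_FTC c2 _ dcos); last by move=> x; exact: sin_max.
by rewrite mulr1 mulr0 ca cos0 subrr.
Qed.

End Characters.

(** * Uniqueness of Fourier coefficients *)

Section FourierUniqueness.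
Context {R : realType}.
Local Notation C := R[i].
Local Notation mu := (circ R).
Local Notation T := (measurableTypeR R).

Lemma bernoulli_le (a : R) (m : nat) : 0 <= a <= 1 -> 1 - m%:R * a <= (1 - a) ^+ m.
Proof.
move=> /andP[a0 a1]; elim: m => [|m IH]; first by rewrite mul0r subr0 expr0.
rewrite exprSr; apply: le_trans (_ : (1 - m%:R * a) * (1 - a) <= _).
  rewrite -(addn1 m) natrD mulrDl mul1r.
  have : 0 <= m%:R * a * a by rewrite !mulr_ge0.
  by nra.
by rewrite ler_wpM2r// subr_ge0.
Qed.

(** Bernoulli's inequality for [1 + a], combined with [(1 - a)^m * (1 + a)^m <= 1]. *)
Lemma bernoulli_inv (a : R) (m : nat) : 0 <= a <= 1 ->
  (1 - a) ^+ m <= (1 + m%:R * a)^-1.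
Proof.
move=> /andP[a0 a1]; have p : 0 < 1 + m%:R * a by rewrite ltr_pwDl// mulr_ge0.
rewrite -[leRHS]mul1r ler_pdivlMr//.
apply: le_trans (_ : (1 - a) ^+ m * (1 + a) ^+ m <= _).
  rewrite ler_wpM2l ?exprn_ge0 ?subr_ge0//.
  have : 1 + m%:R * a <= (1 + a) ^+ m.
    elim: m {p} => [|m IH]; first by rewrite mul0r addr0 expr0.
    rewrite exprSr; apply: le_trans (_ : (1 + m%:R * a) * (1 + a) <= _).
      rewrite -(addn1 m) natrD mulrDl mul1r.
      have : 0 <= m%:R * a * a by rewrite !mulr_ge0.
      by nra.
    by rewrite ler_wpM2r// addr_ge0.
  by [].
by rewrite -exprMn exprn_ile1//; nra.
Qed.

(** Polynomials with values in [0, 1] on [0, 1] that tend to 1 below 1/2 and to 0 above it, as in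
    elementary proofs of the Stone-Weierstrass theorem. Composed with a trigonometric polynomial
    they approximate the indicator function of a level set by trigonometric polynomials. *)
Definition bump (n : nat) (y : R) := (1 - y ^+ n) ^+ (2 ^ n)%N.

Lemma bump_lt n y : 0 <= y <= 1 -> 0 <= bump n y <= 1.
Proof.
move=> /andP[y0 y1]; have yn : 0 <= y ^+ n <= 1 by rewrite exprn_ge0// exprn_ile1.
case/andP: yn => yn0 yn1.
by rewrite /bump exprn_ge0 ?subr_ge0//= exprn_ile1 ?subr_ge0// gerBl.
Qed.

Lemma bump_small y : 0 <= y < 2^-1 -> bump n y @[n --> \oo] --> (1 : R).
Proof.
move=> /andP[y0 y1].
have h : 1 - (2 * y) ^+ n @[n --> \oo] --> (1 - 0 : R).
  apply: cvgB; first exact: cvg_cst.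
  apply: cvg_expr; rewrite ger0_norm ?mulr_ge0//; lra.
rewrite subr0 in h; apply: (squeeze_cvgr _ h); last exact: cvg_cst.
apply: nearW => n; have y01 : 0 <= y <= 1 by rewrite y0/=; lra.
have yn : 0 <= y ^+ n <= 1 by case/andP: y01 => *; rewrite exprn_ge0// exprn_ile1.
rewrite (andP (bump_lt n y01)).2 andbT /bump.
by have := bernoulli_le (2 ^ n) yn; rewrite natrX exprMn.
Qed.

Lemma bump_large y : 2^-1 < y <= 1 -> bump n y @[n --> \oo] --> (0 : R).
Proof.
move=> /andP[y0 y1].
have h : (2 * y)^-1 ^+ n @[n --> \oo] --> (0 : R).
  apply: cvg_expr; rewrite ger0_norm ?invr_ge0 ?mulr_ge0//; last by lra.
  by rewrite invf_lt1; lra.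
apply: (squeeze_cvgr _ _ h); last exact: cvg_cst.
apply: nearW => n; have y01 : 0 <= y <= 1 by apply/andP; split; lra.
have yn : 0 <= y ^+ n <= 1 by case/andP: y01 => *; rewrite exprn_ge0// exprn_ile1.
rewrite (andP (bump_lt n y01)).1 /=; apply: le_trans (bernoulli_inv (2 ^ n) yn) _.
have p : 0 < (2 * y) ^+ n by rewrite exprn_gt0//; lra.
rewrite natrX -exprMn exprVn lef_pV2 ?posrE ?lerDr//.
by rewrite addr_gt0.
Qed.

Section Multipliers.
Variable f : R -> C.
Hypothesis fi : cintg f.
Hypothesis f0 : forall k, cintegral (fun x => f x * chi k x) = 0.

(** The bounded multipliers [g] for which [f g] has zero Fourier coefficients. They contain 1 and
    are stable under linear combinations and multiplication by characters, hence by [y], which is a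
    combination of three characters. *)
Let good (g : R -> C) := [/\ cmeas g, exists M : R, forall x, cn2 (g x) <= M &
  forall k, cintegral (fun x => f x * g x * chi k x) = 0].

Let good1 : good (fun=> 1).
Proof.
split; [exact: cmeas_cst|by exists 1 => x; rewrite cn2_1|move=> k].
by rewrite -[RHS](f0 k); congr cintegral; apply/funext => x; rewrite mulr1.
Qed.

Let good_int g k : good g -> cintg (fun x => f x * g x * chi k x).
Proof.
move=> [mg [M gM] _]; apply: (@cintg_mulb _ _ _ 1).
- exact: cintg_mulb gM.
- exact: cmeas_chi.
- by move=> x; rewrite cn2_chi.
Qed.

Let good_lin (a : C) g h : good g -> good h -> good (fun x => a * g x + h x).
Proof.
move=> gg gh; have [mg [M gM] g0] := gg; have [mh [M' hM'] h0] := gh.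
split.
- by apply: cmeasD => //; apply: cmeasM => //; exact: cmeas_cst.
- exists (2 * (cn2 a * M) + 2 * M') => x; apply: le_trans (cn2D_le _ _) _.
  rewrite cn2M lerD// ?ler_wpM2l// ?mulr_ge0 ?cn2_ge0// ler_wpM2l//; exact: cn2_ge0.
move=> k.
rewrite (_ : (fun x => _) = fun x => a * (f x * g x * chi k x) + f x * h x * chi k x).
  rewrite cintD ?cintZ ?g0 ?h0 ?mulr0 ?addr0//; try exact: good_int.
  by apply: cintgZ; exact: good_int.
by apply/funext => x; ring.
Qed.

Let good_chi l g : good g -> good (fun x => chi l x * g x).
Proof.
move=> [mg [M gM] g0]; split.
- by apply: cmeasM => //; exact: cmeas_chi.
- by exists M => x; rewrite cn2M cn2_chi mul1r.
move=> k; rewrite -[RHS](g0 (l + k)); congr cintegral; apply/funext => x.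
by rewrite chiD; ring.
Qed.

Variables (c p q : R).
Let y (x : R) : R := p + q * cos (2 * pi * (x - c)).

Let yE x : (y x)%:C%C = p%:C%C + (q / 2)%:C%C * cis (- (2 * pi * c)) * chi 1 x
  + (q / 2)%:C%C * cis (2 * pi * c) * chi (- 1) x.
Proof.
have -> : y x = p + q * (cos (2 * pi * 1%:~R * x) * cos (2 * pi * c) +
   sin (2 * pi * 1%:~R * x) * sin (2 * pi * c)).
  by rewrite /y -cosB; congr (_ + _ * cos _); ring.
by rewrite chiN /chi cisN; apply: complex_eq; rewrite !cE /=; field.
Qed.

Let good_y g : good g -> good (fun x => (y x)%:C%C * g x).
Proof.
move=> gg.
have h1 := good_chi 1 gg; have h2 := good_chi (-1) gg.
have z0 : good (fun=> 0).
  have := good_lin (-1) good1 good1; congr good.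
  by apply/funext => x; rewrite mulr1 addNr.
have := good_lin p%:C%C gg (good_lin ((q / 2)%:C%C * cis (- (2 * pi * c))) h1
  (good_lin ((q / 2)%:C%C * cis (2 * pi * c)) h2 z0)).
by congr good; apply/funext => x; rewrite yE; ring.
Qed.

Let good_bump n : good (fun x => (bump n (y x))%:C%C).
Proof.
have hp g k : good g -> good (fun x => (y x ^+ k)%:C%C * g x).
  move=> gg; elim: k => [|k IH].
    by move: gg; congr good; apply/funext => x; rewrite expr0 mul1r.
  have := good_y IH; congr good; apply/funext => x.
  by rewrite exprS rmorphM mulrA.
have hb g m : good g -> good (fun x => ((1 - y x ^+ n) ^+ m)%:C%C * g x).
  move=> gg; elim: m => [|m IH].
    by move: gg; congr good; apply/funext => x; rewrite expr0 mul1r.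
  have := good_lin (-1) (hp _ n IH) IH; congr good; apply/funext => x.
  by rewrite exprS !(rmorphM, rmorphB, rmorph1); ring.
by have := hb _ (2 ^ n)%N good1; congr good; apply/funext => x; rewrite mulr1.
Qed.

Lemma bump_orth n : rint (fun x => complex.Re (f x) * bump n (y x)) = 0 /\
  rint (fun x => complex.Im (f x) * bump n (y x)) = 0.
Proof.
have [_ _ /(_ 0)] := good_bump n.
move=> e; split; [have := congr1 (@complex.Re R) e|have := congr1 (@complex.Im R) e];
  rewrite /= => <-; congr Rintegral; apply/funext => x;
  rewrite chi0 mulr1 !cE /=; ring.
Qed.

End Multipliers.

Lemma circ_le_lebesgue (A : set T) : measurable A -> (mu A <= lebesgue_measure A)%E.
Proof.
move=> mA; rewrite [leLHS](_ : _ = lebesgue_measure (A `&` `[0%R : R, 1%R[%classic))//.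
apply: le_measure => [||x []//]; rewrite inE//.
by apply: measurableI => //; exact: measurable_itv.
Qed.

Lemma circ_set1 (a : R) : mu.-negligible ([set a] : set T).
Proof.
apply/negligibleP; first exact: measurable_set1.
apply/eqP; rewrite eq_le measure_ge0 andbT -(lebesgue_measure_set1 a).
by apply: circ_le_lebesgue; exact: measurable_set1.
Qed.

Lemma circ_outside : mu.-negligible (~` (`[0, 1[%classic : set T)).
Proof.
apply/negligibleP; first by apply: measurableC; exact: measurable_itv.
rewrite [LHS](_ : _ =
  lebesgue_measure (~` `[0%R, 1%R[%classic `&` `[0%R : R, 1%R[%classic))//.
by rewrite setICl measure0.
Qed.

Lemma rint_dct (h : nat -> R -> R) (h' g : R -> R) :
  (forall n, measurable_fun (setT : set T) (h n)) ->
  measurable_fun (setT : set T) h' -> rintg g ->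
  {ae mu, forall x, h n x @[n --> \oo] --> h' x} -> (forall n x, `|h n x| <= g x) ->
  rint (h n) @[n --> \oo] --> rint h'.
Proof.
move=> mh mh' ig hh hg.
have [||||| ih _ cv] := @dominated_convergence _ T R mu setT measurableT
    (fun n x => (h n x)%:E) (fun x => (h' x)%:E) (fun x => (g x)%:E).
- by move=> n; exact/measurable_EFinP.
- exact/measurable_EFinP.
- by apply: aeS hh => x hx _; apply: cvg_EFin; [exact: nearW|exact: hx].
- exact: ig.
- by apply: ae_all => x n _; rewrite lee_fin.
have := cv; rewrite rintE// => /fine_cvgP[_]; apply: cvg_trans.
by apply: near_eq_cvg; apply: nearW => n /=.
Qed.

(** The cosine peaks at [x = b / 2] and has the value [cos (pi * b)] at [0] and at [b], so this
    threshold separates the two arcs. *)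
Lemma cos_mono (b x : R) : 0 < b < 1 -> 0 <= x < 1 ->
  [/\ 0 < x < b -> cos (pi * b) < cos (2 * pi * (x - b / 2)) &
      b < x -> cos (2 * pi * (x - b / 2)) < cos (pi * b)].
Proof.
move=> /andP[b0 b1] /andP[x0 x1]; have p0 : 0 < pi :> R by exact: pi_gt0.
have inb : pi * b \in `[0, pi].
  by rewrite in_itv /=; apply/andP; split; nra.
split.
  move=> /andP[xp xb].
  rewrite -(cos_norm (2 * pi * _)) ltr_cos//; last first.
    rewrite in_itv/= normr_ge0/= normrM ger0_norm; last by nra.
    have : `|x - b / 2| <= b / 2 by rewrite ler_norml; lra.
    by nra.
  rewrite normrM ger0_norm; last by nra.
  have : `|x - b / 2| < b / 2 by rewrite ltr_norml; lra.
  by nra.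
move=> bx; have [xh|xh] := leP (x - b / 2) (2^-1).
  rewrite ltr_cos//; first by nra.
  by rewrite in_itv/=; apply/andP; split; nra.
(* Beyond half a period the angle is reflected into [0, pi], where the cosine decreases. *)
have -> : cos (2 * pi * (x - b / 2)) = cos (2 * pi * (1 - (x - b / 2))).
  rewrite -[LHS]cosN -[LHS]cosD2pi -mulr_natl; congr cos; ring.
rewrite ltr_cos//; first by nra.
by rewrite in_itv/=; apply/andP; split; nra.
Qed.

(** The functions [bump n (y x)] are trigonometric polynomials annihilated by [f] that converge
    boundedly to the indicator function of [b < x], except at [0] and [b]; dominated convergence
    concludes. *)
Lemma fourier_tail (f : R -> C) (b : R) : cintg f ->
  (forall k, cintegral (fun x => f x * chi k x) = 0) -> 0 < b < 1 ->
  rint (fun x => complex.Re (f x) * (b < x)%R%:R) = 0 /\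
  rint (fun x => complex.Im (f x) * (b < x)%R%:R) = 0.
Proof.
move=> fi f0 b01; have b01' := b01; case/andP: b01' => b0 b1.
pose th := cos (pi * b).
(* An affine image of the cosine with values in [0, 1] that sends the threshold [th] to 1/2. *)
pose y x : R := (2^-1 - th / 4) + 4^-1 * cos (2 * pi * (x - b / 2)).
have y01 x : 0 <= y x <= 1.
  rewrite /y /th.
  have := cos_geN1 (pi * b); have := cos_le1 (pi * b).
  have := cos_geN1 (2 * pi * (x - b / 2)); have := cos_le1 (2 * pi * (x - b / 2)).
  by move=> *; apply/andP; split; lra.
have my : measurable_fun (setT : set T) y.
  apply: measurable_funD => //; apply: measurable_funM => //.
  have -> : (fun x : R => cos (2 * pi * (x - b / 2))) =
      cos \o (fun x => 2 * pi * x + (- (2 * pi * (b / 2)))).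
    by apply/funext => x /=; congr cos; ring.
  apply: measurableT_comp; last first.
    by apply: measurable_funD => //; exact: measurable_linear.
  by apply: continuous_measurable_fun => x; exact: continuous_cos.
have mb n : measurable_fun (setT : set T) (fun x => bump n (y x)).
  apply: measurable_funX; apply: measurable_funB => //; exact: measurable_funX.
have mi : measurable_fun (setT : set T) (fun x : R => (b < x)%R%:R : R).
  rewrite (_ : (fun x => _) = \1_(`]b, +oo[%classic : set T)).
    by apply: measurable_indic; exact: measurable_itv.
  by apply/funext => x; rewrite indicE mem_setE in_itv/= andbT.
have lim : {ae mu, forall x, bump n (y x) @[n --> \oo] --> ((b < x)%R%:R : R)}.
  have : mu.-negligible ([set 0 : R] `|` [set b] `|` ~` (`[0, 1[%classic : set T)).
    apply: negligibleU; first by apply: negligibleU; exact: circ_set1.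
    exact: circ_outside.
  apply: negligibleS => x /=; apply: contra_notP => /not_orP[].
  move=> /not_orP[/eqP x0 /eqP xb] /contrapT; rewrite /= in_itv/= => /andP[x0' x1].
  have hx : 0 <= x < 1 by rewrite x0'.
  have [h1 h2] := cos_mono b01 hx.
  have {}x0 : 0 < x by rewrite lt_def x0.
  case: ltgtP xb => // bx _.
    apply: bump_small; rewrite (andP (y01 x)).1 /=; rewrite /y.
    by have := h2 bx; rewrite -/th; lra.
  apply: bump_large; rewrite (andP (y01 x)).2 andbT /y.
  by have := h1; rewrite x0 bx => /(_ isT); rewrite -/th; lra.
have main (h : R -> R) : rintg h -> (forall n, rint (fun x => h x * bump n (y x)) = 0) ->
    rint (fun x => h x * (b < x)%R%:R) = 0.
  move=> ih h0; have mh := rintg_meas ih.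
  have : rint (fun x => h x * bump n (y x)) @[n --> \oo] --> rint (fun x => h x * (b < x)%R%:R).
    apply: (@rint_dct _ _ (fun x => `|h x|)).
    - by move=> n; exact: measurable_funM.
    - exact: measurable_funM.
    - exact: integrable_norm.
    - by apply: aeS lim => x hx; apply: cvgMr.
    - move=> n x; rewrite normrM ler_piMr//.
      by have /andP[? ?] := bump_lt n (y01 x); rewrite ger0_norm.
  under eq_fun do rewrite h0; move=> cv.
  by have := cvg_unique _ cv (cvg_cst 0); apply.
have orth := bump_orth fi f0 (b / 2) (2^-1 - th / 4) 4^-1.
split; apply: main => [|n]; [by case: fi|by case: (orth n)|by case: fi|by case: (orth n)].
Qed.

(** The indefinite integral of [h] is constant on ]0, 1[, and its derivative is [h] almost
    everywhere. *)
Lemma rint_tails_eq0 (h : R -> R) : rintg h ->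
  (forall b, 0 < b < 1 -> rint (fun x => h x * (b < x)%R%:R) = 0) ->
  ae_eq_fun h (fun=> 0).
Proof.
move=> ih hb; have mh := rintg_meas ih.
pose D : set T := `[0%R : R, 1%R[%classic.
have mD : measurable D by exact: measurable_itv.
pose H : R -> R := h \_ D.
have [iD _] := circ_integral ih.
have iH : @integrable _ T R lebesgue_measure setT (EFin \o H).
  have := @integrable_mkcond _ T R lebesgue_measure D (EFin \o h) mD.
  by rewrite -restrict_EFin => <-.
have := @FTC1Ny R H.
move=> /(_ _ _)[].
- by move=> y; apply: integrableS iH.
- split; [by case/integrableP: iH => /measurable_EFinP|exact: openT|].
  move=> K _ cK; have mK : measurable (K : set T) by exact: compact_measurable.
  by have /integrableP[_] := @integrableS _ T R lebesgue_measure setT K _ measurableT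
    mK (@subsetT _ _) iH.
set F := fun x : R => \int[lebesgue_measure]_(t in `]-oo, x]) H t.
have Fconst y : 0 < y < 1 -> F y = rint h.
  move=> y01; have -> : F y = rint (fun x => h x * (x <= y)%R%:R).
    have i1 : rintg (fun x => h x * (x <= y)%R%:R).
      apply: (rintg_le _ (integrable_norm ih)).
        apply: measurable_funM => //.
        rewrite (_ : (fun x => _) = \1_(`]-oo, y]%classic : set T)).
          by apply: measurable_indic; exact: measurable_itv.
        by apply/funext => x; rewrite indicE mem_setE in_itv.
      by move=> x; rewrite normrM /=; case: (x <= y); rewrite ?normr1 ?normr0 ?mulr1 ?mulr0.
    have [_ e] := circ_integral i1.
    apply: EFin_inj; rewrite -rintE// e /F /Rintegral; apply: EFin_inj.
    have mI : measurable (`]-oo, y]%classic : set T) by exact: measurable_itv.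
    rewrite fineK; last first.
      exact: (@integrable_fin_num _ T R lebesgue_measure _ mI _
        (@integrableS _ T R lebesgue_measure setT _ _ measurableT mI (@subsetT _ _) iH)).
    rewrite integral_mkcond [in RHS]integral_mkcond; congr EFin; apply: eq_integral => x _.
    rewrite !patchE /H patchE /D !mem_setE !in_itv/=.
    by case: (x <= y); case: (_ && _); rewrite ?mulr1 ?mulr0.
  have -> : (fun x => h x * (x <= y)%R%:R) = (fun x => h x + - 1 * (h x * (y < x)%R%:R)).
    by apply/funext => x; rewrite ltNge; case: (x <= y); rewrite /= ?mulr1 ?mulr0; ring.
  have i2 : rintg (fun x => h x * (y < x)%R%:R).
    apply: (rintg_le _ (integrable_norm ih)).
      apply: measurable_funM => //.
      rewrite (_ : (fun x => _) = \1_(`]y, +oo[%classic : set T)).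
        by apply: measurable_indic; exact: measurable_itv.
      by apply/funext => x; rewrite indicE mem_setE in_itv/= andbT.
    by move=> x; rewrite normrM /=; case: (y < x); rewrite ?normr1 ?normr0 ?mulr1 ?mulr0.
  by rewrite rintD ?rintZ ?hb ?mulr0 ?addr0//; exact: rintgZ.
move=> N [mN N0 NF].
have muN : mu.-negligible (N : set T).
  apply/negligibleP => //; apply/eqP; rewrite eq_le measure_ge0 andbT -N0.
  exact: circ_le_lebesgue.
have := negligibleU muN (negligibleU (circ_set1 0) circ_outside).
apply: negligibleS => x /=; apply: contra_notP => /not_orP[nN].
move=> /not_orP[/eqP x0] /contrapT; rewrite /= in_itv/= => /andP[x0' x1].
have {}x0 : 0 < x by rewrite lt_def x0.
have [_ dF] : derivable F x 1 /\ derive1 F x = H x by apply: contrapT => /NF.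
have : derive1 F x = 0.
  rewrite derive1E (@near_eq_derive _ _ _ F (cst (rint h))) ?derive_cst//.
  near=> z; apply: Fconst; apply/andP; split; near: z.
    exact: lt_nbhsr.
  exact: lt_nbhsl.
by rewrite dF /H patchE mem_set// /D /= in_itv/= x0' x1.
Unshelve. all: by end_near. Qed.

Theorem fourier_unique (f : R -> C) : cintg f ->
  (forall k, cintegral (fun x => f x * chi k x) = 0) -> ae_eq_fun f (fun=> 0).
Proof.
move=> fi f0; have [f1 f2] := fi.
have h1 := rint_tails_eq0 f1 (fun b b01 => (fourier_tail fi f0 b01).1).
have h2 := rint_tails_eq0 f2 (fun b b01 => (fourier_tail fi f0 b01).2).
by apply: aeS2 h1 h2 => x e1 e2; apply: complex_eq.
Qed.

End FourierUniqueness.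

(** * Hardy spaces inside [Hil] *)

Section Hardy.
Context {R : realType}.
Local Notation C := R[i].
Local Notation mu := (circ R).
Local Notation T := (measurableTypeR R).

Definition ekf n (k : int) (i : 'I_n) (x : R) : 'cV[C]_n := chi k x *: delta_mx i 0.

Lemma L2_bounded n (f : R -> 'cV[C]_n) (M : R) : measurable_mx f ->
  (forall x, vn2 (f x) <= M) -> L2 n f.
Proof.
move=> mf fM; apply/L2P; split=> //.
apply: (rintg_le (measurable_vn2 mf) (rintg_cst M)) => x.
by rewrite ger0_norm ?vn2_ge0.
Qed.

Lemma measurable_mx_scale m n (u : R -> C) (F : R -> 'M[C]_(m, n)) :
  cmeas u -> measurable_mx F -> measurable_mx (fun x => u x *: F x).
Proof.
move=> mu' mF i j; apply: (@cmeas_eq _ (fun x => u x * F x i j)).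
  by move=> x; rewrite mxE.
by apply: cmeasM; [exact: mu'|exact: mF].
Qed.

Lemma ekf_L2 n k (i : 'I_n) : L2 n (ekf k i).
Proof.
apply: (@L2_bounded _ _ (vn2 (delta_mx i 0 : 'cV[C]_n))).
  apply: measurable_mx_scale; first exact: cmeas_chi.
  by case: (bmx_cst (delta_mx i 0 : 'cV[C]_n)).
by move=> x; rewrite /ekf vn2Z cn2_chi mul1r.
Qed.

Definition ek n (k : int) (i : 'I_n) : Hil n := cls (ekf k i).

Lemma vip_ekf n (v : 'cV[C]_n) k i x : vip v (ekf k i x) = v i 0 * chi (- k) x.
Proof.
rewrite /vip (bigD1 i)//= big1 ?addr0 => [|j ji].
  by rewrite !mxE !eqxx mulr1 -chiN.
by rewrite !mxE (negPf ji) /= mulr0 cj0 mulr0.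
Qed.

Lemma ip_ek n (x : Hil n) k i :
  ip x (ek k i) = cintegral (fun t : R => lrep x t i 0 * chi (- k) t).
Proof.
rewrite -{1}(lrepK x) ip_cls ?inner2E; [|exact: lrep_L2|exact: ekf_L2].
by congr cintegral; apply/funext => t; exact: vip_ekf.
Qed.

Lemma fourier_coefE n (f : R -> 'cV[C]_n) k i : L2 n f ->
  fourier_coef (fun x => f x i 0) k = ip (cls f : Hil n) (ek k i).
Proof.
move=> Lf; rewrite ip_cls// ?inner2E; last exact: ekf_L2.
rewrite /fourier_coef; congr cintegral; apply/funext => x.
rewrite vip_ekf; congr (_ * _); rewrite /chi; congr cis.
by rewrite intrN; ring.
Qed.

Definition hH2 n : set (Hil n) := [set x | forall i (k : int), k < 0 -> ip x (ek k i) = 0].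
Definition hHm n : set (Hil n) := [set x | forall g, hH2 g -> ip x g = 0].

Lemma H2P n (f : R -> 'cV[C]_n) : L2 n f -> H2 n f <-> hH2 (cls f : Hil n).
Proof.
move=> Lf; split=> [[_ h] i k k0|h]; first by rewrite -fourier_coefE// h.
by split=> // i k k0; rewrite fourier_coefE// h.
Qed.

Lemma H2_lrep n (x : Hil n) : hH2 x -> H2 n (lrep x).
Proof. by move=> h; apply/H2P; [exact: lrep_L2|rewrite lrepK]. Qed.

Lemma HmP n (f : R -> 'cV[C]_n) : L2 n f -> H2minus n f <-> hHm (cls f : Hil n).
Proof.
move=> Lf; split=> [[_ h] g /H2_lrep Hg|h].
  by rewrite -(lrepK g) ip_cls//; [exact: h|exact: lrep_L2].
split=> // g Hg; have Lg : L2 n g by case: Hg.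
by rewrite -ip_cls//; apply: h; apply/H2P.
Qed.

Lemma subsp_forall (H : hilb (R := R)) (I : Type) (A : I -> set H) :
  (forall i, subsp (A i)) -> subsp [set x | forall i, A i x].
Proof.
move=> h; split=> [i|c x y hx hy i]; first by case: (h i).
by case: (h i) => _; apply.
Qed.

Lemma hclosed_forall (H : hilb (R := R)) (I : Type) (A : I -> set H) :
  (forall i, hclosed (A i)) -> hclosed [set x | forall i, A i x].
Proof.
move=> h w hw i; apply: h => e e0; have [a Aa wa] := hw e e0.
by exists a => //; exact: Aa.
Qed.

Lemma subsp_implies (H : hilb (R := R)) (P : Prop) (A : set H) :
  subsp A -> subsp [set x | P -> A x].
Proof.
move=> [A0 hA]; split=> // c x y hx hy p.
by apply: hA; [exact: hx|exact: hy].
Qed.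

Lemma hclosed_implies (H : hilb (R := R)) (P : Prop) (A : set H) :
  hclosed A -> hclosed [set x | P -> A x].
Proof.
move=> hA w hw p; apply: hA => e e0; have [a Aa wa] := hw e e0.
by exists a => //; exact: Aa.
Qed.

Lemma subsp_hH2 n : subsp (@hH2 n).
Proof.
apply: (subsp_forall (A := fun i => _)) => i; apply: (subsp_forall (A := fun k => _)) => k.
by apply: subsp_implies; exact: subsp_orth.
Qed.

Lemma hclosed_hH2 n : hclosed (@hH2 n).
Proof.
apply: (hclosed_forall (A := fun i => _)) => i.
apply: (hclosed_forall (A := fun k => _)) => k.
by apply: hclosed_implies; exact: hclosed_orth.
Qed.

Lemma subsp_hHm n : subsp (@hHm n).
Proof.
apply: (subsp_forall (A := fun g => _)) => g.
by apply: subsp_implies; exact: subsp_orth.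
Qed.

Lemma hclosed_hHm n : hclosed (@hHm n).
Proof.
apply: (hclosed_forall (A := fun g => _)) => g.
by apply: hclosed_implies; exact: hclosed_orth.
Qed.

Lemma cintg_lrep n (x : Hil n) i : cintg (fun t : R => lrep x t i 0).
Proof.
have mx := L2_meas (lrep_L2 x) i 0.
rewrite (_ : (fun t : R => _) = fun t : R => lrep x t i 0 * 1); last first.
  by apply/funext => t; rewrite mulr1.
apply: cintg_mul => //.
  apply: (rintg_le _ (L2_rintg (lrep_L2 x))); first exact: measurable_cn2.
  by move=> t; rewrite ger0_norm ?cn2_ge0 ?cn2_le_vn2.
by under eq_fun do rewrite cn2_1; exact: rintg_cst.
Qed.

Lemma ek_complete n (x : Hil n) : (forall k i, ip x (ek k i) = 0) -> x = 0.
Proof.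
move=> h; apply: lspaceP.
have hi i : ae_eq_fun (fun t : R => lrep x t i 0) (fun=> 0).
  apply: fourier_unique; first exact: cintg_lrep.
  by move=> k; rewrite -[RHS](h (- k) i) ip_ek opprK.
apply: aeS2 (ae_forall_fin hi) (lrep0 n) => t ht ->.
by apply/colP => i; rewrite ht mxE.
Qed.

Lemma ip_ek_ek n k l (i j : 'I_n) : ip (ek k i) (ek l j) = ((k == l) && (i == j))%:R.
Proof.
rewrite ip_cls ?inner2E; [|exact: ekf_L2..].
under eq_fun do rewrite vip_ekf /ekf !mxE eqxx andbT mulrAC -chiD.
rewrite (eq_sym j i); case: (i == j); last first.
  rewrite andbF (_ : (fun x => _) = fun=> 0 * 0); last first.
    by apply/funext => x; rewrite mulr0 mul0r.
  by rewrite (cintZ 0 (cintg_cst 0)) mul0r.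
under eq_fun do rewrite mulr1.
by rewrite cint_chi subr_eq0 andbT.
Qed.

Lemma ek_hH2 n k (i : 'I_n) : 0 <= k -> hH2 (ek k i).
Proof.
move=> k0 j l l0; rewrite ip_ek_ek; case: eqVneq => //= kl.
by move: l0; rewrite -kl ltNge k0.
Qed.

(** Under the condition on the coefficients, the projection of [x] onto [hH2] has all its Fourier
    coefficients zero, hence vanishes. *)
Lemma hHmP n (x : Hil n) : hHm x <-> forall i (k : int), 0 <= k -> ip x (ek k i) = 0.
Proof.
split=> [h i k k0|h g Hg]; first exact/h/ek_hH2.
have [p Hp hp] := projection (@subsp_hH2 n) (@hclosed_hH2 n) x.
suff p0 : p = 0 by have := hp g Hg; rewrite p0 subr0.
apply: ek_complete => k i; have [k0|k0] := leP 0 k; last exact: Hp.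
have -> : p = x - (x - p) by rewrite opprB addrC subrK.
by rewrite ipBl h// hp ?subr0//; exact: ek_hH2.
Qed.

Lemma hH2_orth n (x : Hil n) : (forall g, hHm g -> ip x g = 0) -> hH2 x.
Proof.
move=> h i k k0; apply: h; apply/hHmP => j l l0; rewrite ip_ek_ek.
by case: eqVneq => //= kl; move: k0; rewrite kl ltNge l0.
Qed.

Lemma hH2_hHm_decomp n (x : Hil n) : exists c d, [/\ hH2 c, hHm d & x = c + d].
Proof.
have [p Hp hp] := projection (@subsp_hH2 n) (@hclosed_hH2 n) x.
by exists p, (x - p); split=> //; rewrite addrC subrK.
Qed.

(* the antiunitary involution exchanging [hH2] and [hHm] *)
Definition flip n (x : Hil n) : Hil n :=
  cls (fun t : R => conj_mx (chi 1 t *: lrep x t)).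

Lemma vn2_conj n (v : 'cV[C]_n) : vn2 (conj_mx v) = vn2 v.
Proof. by rewrite /vn2; apply: eq_bigr => i _; rewrite mxE cn2J. Qed.

Lemma measurable_conj m n (F : R -> 'M[C]_(m, n)) :
  measurable_mx F -> measurable_mx (fun x => conj_mx (F x)).
Proof.
move=> mF i j; apply: (@cmeas_eq _ (fun x => (F x i j)^*)).
  by move=> x; rewrite mxE.
by apply: cmeasJ; exact: mF.
Qed.

Lemma flip_L2 n (f : R -> 'cV[C]_n) : L2 n f -> L2 n (fun t : R => conj_mx (chi 1 t *: f t)).
Proof.
move=> Lf; apply: (@L2_le _ _ _ _ f 1) => //.
  apply: measurable_conj; apply: measurable_mx_scale; [exact: cmeas_chi|exact: L2_meas].
by apply: ae_all => t; rewrite vn2_conj vn2Z cn2_chi !mul1r.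
Qed.

Lemma flip_cls n (f : R -> 'cV[C]_n) : L2 n f ->
  flip (cls f) = cls (fun t : R => conj_mx (chi 1 t *: f t)).
Proof.
move=> Lf; apply: cls_eq; [apply: flip_L2; exact: lrep_L2|exact: flip_L2|].
by apply: aeS (lrep_cls Lf) => t ->.
Qed.

Lemma lrep_flip n (x : Hil n) : ae_eq_fun (lrep (flip x)) (fun t : R => conj_mx (chi 1 t *: lrep x t)).
Proof. by apply: lrep_cls; apply: flip_L2; exact: lrep_L2. Qed.

Lemma chi_conj k (t : R) : (chi k t)^* * chi k t = 1.
Proof. by rewrite mulrC mulcJ cn2_chi. Qed.

Lemma ip_flip n (x y : Hil n) : ip (flip x) (flip y) = ip y x.
Proof.
rewrite -(lrepK x) -(lrepK y) !flip_cls ?ip_cls ?inner2E; try exact: lrep_L2;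
  try by apply: flip_L2; exact: lrep_L2.
congr cintegral; apply/funext => t; apply: eq_bigr => i _; rewrite !mxE cjK cjM.
by rewrite mulrACA chi_conj mul1r mulrC.
Qed.

Lemma flipK n (x : Hil n) : flip (flip x) = x.
Proof.
rewrite -[in LHS](lrepK x) !flip_cls ?lrepK; try exact: lrep_L2;
  try by apply: flip_L2; exact: lrep_L2.
rewrite -[RHS]lrepK; congr cls; apply/funext => t; apply/colP => i.
by rewrite !mxE !cjM !cjK mulrA [_ * (chi 1 t)]chi_conj mul1r.
Qed.

Lemma flip_lin n c (x y : Hil n) : flip (c *: x + y) = c^* *: flip x + flip y.
Proof.
have L : L2 n (fun t : R => c *: lrep x t + lrep y t) by apply: L2_lin; exact: lrep_L2.
have -> : c *: x + y = cls (fun t : R => c *: lrep x t + lrep y t).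
  by rewrite cls_lin ?lrepK//; exact: lrep_L2.
rewrite flip_cls// -cls_lin; try by apply: flip_L2; exact: lrep_L2.
congr cls; apply/funext => t; apply/colP => i; rewrite !mxE !(cjM, cjD).
by ring.
Qed.

Lemma flipB n (x y : Hil n) : flip (x - y) = flip x - flip y.
Proof.
have := flip_lin (-1) y x; rewrite !scaleN1r addrC => ->.
by rewrite cjN cj1 scaleN1r addrC.
Qed.

Lemma nsq_flip n (x : Hil n) : nsq (flip x) = nsq x.
Proof. by rewrite /nsq ip_flip. Qed.

Lemma flip_ek n k (i : 'I_n) : flip (ek k i) = ek (- 1 - k) i.
Proof.
rewrite flip_cls; last exact: ekf_L2; congr cls; apply/funext => t.
apply/colP => j; rewrite !mxE !cjM -!chiN mulrA -chiD; congr (chi _ _ * _).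
by case: (_ && _); rewrite ?cj1 ?cj0.
Qed.

Lemma hHm_flip n (x : Hil n) : hHm x <-> hH2 (flip x).
Proof.
have e k i : ip (flip x) (ek k i) = (ip x (ek (-1 - k) i))^*.
  have kE : k = -1 - (-1 - k) by lia.
  by rewrite {1}kE -(flip_ek (-1 - k) i) ip_flip ip_conj.
split=> [/hHmP h i k k0|h]; first by rewrite e h ?cj0//; lia.
apply/hHmP => i k k0; have := h i (-1 - k); rewrite e.
have -> : -1 - (-1 - k) = k by lia.
move=> /(_ _)/(congr1 Num.conj); rewrite cj0 cjK; apply; lia.
Qed.

End Hardy.
Arguments hH2 {R} n.
Arguments hHm {R} n.

(** * Operator norms of matrices *)

Section OperatorNorm.
Context {R : realType}.
Local Notation C := R[i].

Lemma mulmx_bound m n (A : 'M[C]_(m, n)) :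
  exists M : R, forall v, vn2 (A *m v) <= M * vn2 v.
Proof.
pose S := \sum_i \sum_j cn2 (A i j).
have hS i j : cn2 (A i j) <= S.
  rewrite /S (bigD1 i)//= (bigD1 j)//= -addrA lerDl addr_ge0//.
    by apply: sumr_ge0 => k _; exact: cn2_ge0.
  by apply: sumr_ge0 => k _; apply: sumr_ge0 => l _; exact: cn2_ge0.
exists (m%:R * (n%:R * S)) => v.
have row i : cn2 ((A *m v) i 0) <= n%:R * S * vn2 v.
  rewrite mxE; apply: le_trans (cn2_sum_le _) _; rewrite card_ord -mulrA.
  rewrite ler_wpM2l// /vn2 mulr_sumr; apply: ler_sum => j _.
  by rewrite cn2M ler_wpM2r// cn2_ge0.
rewrite {1}/vn2; apply: le_trans (ler_sum _ (fun i _ => row i)) _.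
by rewrite sumr_const card_ord -[leLHS]mulr_natl !mulrA.
Qed.

Lemma vnorm_ge0 n (v : 'cV[C]_n) : 0 <= vnorm v.
Proof. exact: sqrtr_ge0. Qed.

Lemma vnormZr n (c : R) (v : 'cV[C]_n) : 0 <= c -> vnorm (c%:C%C *: v) = c * vnorm v.
Proof.
move=> c0; rewrite !vnormE vn2Z /cn2 /= expr0n addr0 sqrtrM ?sqr_ge0//.
by rewrite sqrtr_sqr ger0_norm.
Qed.

Lemma vnorm_eq0 n (v : 'cV[C]_n) : vnorm v = 0 -> v = 0.
Proof. by move=> h; apply: vn2_eq0; rewrite -vnorm_sq h expr0n. Qed.

Let has_sup_opnorm m n (A : 'M[C]_(m, n)) :
  has_sup [set vnorm (A *m v) | v in [set v | vnorm v <= 1]].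
Proof.
split; first by exists (vnorm (A *m 0)), 0 => //=; rewrite vnormE vn20 sqrtr0.
have [M hM] := mulmx_bound A; exists (Num.sqrt `|M|) => _ [v /= v1 <-].
rewrite vnormE ler_sqrt//; apply: le_trans (hM v) _.
have : vn2 v <= 1 by rewrite -vnorm_sq exprn_ile1// vnorm_ge0.
by have := vn2_ge0 v; have := ler_norm M; have := normr_ge0 M; nra.
Qed.

Lemma opnorm_ge m n (A : 'M[C]_(m, n)) v : vnorm (A *m v) <= opnorm A * vnorm v.
Proof.
have [v0|v0] := eqVneq (vnorm v) 0.
  by rewrite (vnorm_eq0 v0) mulmx0 !vnormE !vn20 sqrtr0 mulr0.
have pv : 0 < vnorm v by rewrite lt_def v0 vnorm_ge0.
rewrite -ler_pdivrMr// mulrC -vnormZr ?invr_ge0 ?vnorm_ge0// scalemxAr.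
apply: ub_le_sup; first by case: (has_sup_opnorm A).
by exists ((vnorm v)^-1%:C%C *: v) => //=; rewrite vnormZr ?invr_ge0 ?vnorm_ge0// mulVf.
Qed.

Lemma opnorm_ge0 m n (A : 'M[C]_(m, n)) : 0 <= opnorm A.
Proof.
apply: ub_le_sup; first by case: (has_sup_opnorm A).
by exists 0; rewrite /= ?mulmx0 vnormE vn20 sqrtr0.
Qed.

Lemma opnorm_vn2 m n (A : 'M[C]_(m, n)) v : vn2 (A *m v) <= opnorm A ^+ 2 * vn2 v.
Proof.
by rewrite -!vnorm_sq -exprMn lerXn2r ?nnegrE ?vnorm_ge0 ?mulr_ge0 ?opnorm_ge0 ?vnorm_ge0// opnorm_ge.
Qed.

Lemma cn2_le_opnorm m n (A : 'M[C]_(m, n)) i j : cn2 (A i j) <= opnorm A ^+ 2.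
Proof.
have -> : A i j = (A *m (delta_mx j 0 : 'cV_n)) i 0.
  rewrite mxE (bigD1 j)//= big1 ?addr0 => [|k kj]; first by rewrite mxE !eqxx mulr1.
  by rewrite mxE (negPf kj) mulr0.
apply: le_trans (cn2_le_vn2 _ _) _; apply: le_trans (opnorm_vn2 _ _) _.
rewrite ler_piMr ?sqr_ge0// /vn2 (bigD1 j)//= big1 ?addr0 => [|k kj].
  by rewrite mxE !eqxx cn2_1.
by rewrite mxE (negPf kj) cn2_0.
Qed.

Lemma Linf_bound m n (F : R -> 'M[C]_(m, n)) : Linf F ->
  exists M : R, {ae circ R, forall x, opnorm (F x) <= M}.
Proof.
move=> [_ h]; have := ess_sup_ge (circ R) (fun x => (opnorm (F x))%:E).
move: h; rewrite /ess_norm_mx; case: (ess_sup _ _) => [r _|//|_] hs.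
  by exists r; apply: aeS hs => x; rewrite lee_fin.
by exists 0; apply: aeS hs => x.
Qed.

Lemma Linf_bmx m n (F : R -> 'M[C]_(m, n)) : Linf F -> bmx F.
Proof.
move=> LF; split; first by case: LF.
have [M hM] := Linf_bound LF; exists (M ^+ 2); apply: aeS hM => x hx i j.
apply: le_trans (cn2_le_opnorm _ _ _) _; rewrite lerXn2r ?nnegrE ?opnorm_ge0//.
exact: le_trans (opnorm_ge0 _) hx.
Qed.

End OperatorNorm.

(** * Scalar multipliers and the shift *)

Section ScalarMultiplication.
Context {R : realType}.
Local Notation C := R[i].
Local Notation mu := (circ R).
Local Notation T := (measurableTypeR R).

Lemma bmx_scalar n (u : R -> C) (M : R) : cmeas u ->
  {ae mu, forall x, cn2 (u x) <= M} -> bmx (fun t => (u t)%:M : 'M[C]_n).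
Proof.
move=> mu' hu; split.
  move=> i j; apply: (@cmeas_eq _ (fun x => u x * (i == j)%:R)).
    by move=> x; rewrite mxE mulr_natr.
  by apply: cmeasM => //; exact: cmeas_cst.
exists `|M|; apply: aeS hu => x hx i j; rewrite mxE; case: (i == j).
  by rewrite mulr1n; apply: le_trans hx (ler_norm _).
by rewrite mulr0n cn2_0.
Qed.

Definition smul n (u : R -> C) (x : Hil n) : Hil n :=
  mulop (fun t => (u t)%:M : 'M[C]_n) x.

Lemma lrep_smul n u (M : R) (x : Hil n) : cmeas u -> {ae mu, forall x, cn2 (u x) <= M} ->
  ae_eq_fun (lrep (smul u x)) (fun t => u t *: lrep x t).
Proof.
move=> mu' hu; have bu := bmx_scalar n mu' hu.
by apply: aeS (lrep_mulop x bu) => t ->; rewrite mul_scalar_mx.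
Qed.

Lemma chi_bound k : {ae mu, forall x, cn2 (chi k x) <= 1}.
Proof. by apply: ae_all => x; rewrite cn2_chi. Qed.

Lemma bmx_chi n k : bmx (fun t => (chi k t)%:M : 'M[C]_n).
Proof. exact: bmx_scalar (cmeas_chi k) (chi_bound k). Qed.

Definition zmul n (k : int) : Hil n -> Hil n := smul (chi k).

Lemma zmul_lin n k : hlin (@zmul n k).
Proof. by apply: mulop_lin; exact: bmx_chi. Qed.

Lemma zmul_add n k l (x : Hil n) : zmul k (zmul l x) = zmul (k + l) x.
Proof.
rewrite /zmul /smul mulop_comp; try exact: bmx_chi.
apply: mulop_eq; [by apply: bmxM; exact: bmx_chi|exact: bmx_chi|].
by apply: ae_eq_funP => t; rewrite -scalar_mxM chiD.
Qed.

Lemma zmul0 n (x : Hil n) : zmul 0 x = x.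
Proof. by apply: mulop1; [exact: bmx_chi|apply: ae_all => t; rewrite chi0]. Qed.

Lemma zmulK n k (x : Hil n) : zmul (- k) (zmul k x) = x.
Proof. by rewrite zmul_add addNr zmul0. Qed.

Lemma zmulVK n k (x : Hil n) : zmul k (zmul (- k) x) = x.
Proof. by rewrite zmul_add addrN zmul0. Qed.

Lemma zmul_adj n k (x y : Hil n) : ip (zmul k x) y = ip x (zmul (- k) y).
Proof.
rewrite /zmul /smul.
have -> : (fun t => (chi (- k) t)%:M : 'M[C]_n) = (fun t => adjmx (chi k t)%:M).
  apply/funext => t; apply/matrixP => i j.
  by rewrite !mxE chiN eq_sym; case: (_ == _); rewrite ?mulr1n ?mulr0n ?cj0.
by apply: mulop_adj; exact: bmx_chi.
Qed.

Lemma ip_zmul n k (x y : Hil n) : ip (zmul k x) (zmul k y) = ip x y.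
Proof. by rewrite zmul_adj zmulK. Qed.

Lemma zmul_ek n k l (i : 'I_n) : zmul k (ek l i) = ek (k + l) i.
Proof.
rewrite /zmul /smul mulop_cls; [|exact: bmx_chi|exact: ekf_L2].
by congr cls; apply/funext => t; rewrite mul_scalar_mx /ekf scalerA chiD.
Qed.

Lemma zmul_hH2 n k (x : Hil n) : 0 <= k -> hH2 n x -> hH2 n (zmul k x).
Proof.
move=> k0 hx i l l0; rewrite zmul_adj zmul_ek; apply: hx; lia.
Qed.

Lemma nsq_mulop m n (F : R -> 'M[C]_(m, n)) : bmx F ->
  exists M : R, forall x, nsq (mulop F x) <= M * nsq x.
Proof.
move=> bF; have [M hM] := bmx_vn2 bF; exists M => x.
have LF := L2_mul bF (lrep_L2 x).
rewrite nsq_cls// nsq_Hil -rintZ; last exact/L2_rintg/lrep_L2.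
rewrite (@rint_ae _ _ (fun t => Num.min (vn2 (F t *m lrep x t)) (M * vn2 (lrep x t)))).
- apply: rint_le; last by move=> t; rewrite ge_min lexx orbT.
    apply: (rintg_ae _ (L2_rintg LF)).
      by apply: aeS hM => t ht; apply/esym/min_idPl.
    apply: measurable_minr; first exact: measurable_vn2 (L2_meas LF).
    by apply: measurable_funM => //; exact: measurable_vn2 (L2_meas (lrep_L2 x)).
  by apply: rintgZ; exact/L2_rintg/lrep_L2.
- by apply: aeS hM => t ht; apply/esym/min_idPl.
- exact: measurable_vn2 (L2_meas LF).
apply: measurable_minr; first exact: measurable_vn2 (L2_meas LF).
by apply: measurable_funM => //; exact: measurable_vn2 (L2_meas (lrep_L2 x)).
Qed.

Lemma nsq_mulop_le m n (F : R -> 'M[C]_(m, n)) (M : R) : bmx F ->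
  {ae mu, forall x, forall v, vn2 (F x *m v) <= M * vn2 v} ->
  forall x, nsq (mulop F x) <= M * nsq x.
Proof.
move=> bF hM x.
have LF := L2_mul bF (lrep_L2 x).
rewrite nsq_cls// nsq_Hil -rintZ; last exact/L2_rintg/lrep_L2.
have mm : measurable_fun (setT : set T)
    (fun t => Num.min (vn2 (F t *m lrep x t)) (M * vn2 (lrep x t))).
  apply: measurable_minr; first exact: measurable_vn2 (L2_meas LF).
  by apply: measurable_funM => //; exact: measurable_vn2 (L2_meas (lrep_L2 x)).
have e : ae_eq_fun (fun t => vn2 (F t *m lrep x t))
    (fun t => Num.min (vn2 (F t *m lrep x t)) (M * vn2 (lrep x t))).
  by apply: aeS hM => t ht; apply/esym/min_idPl.
rewrite (rint_ae e (measurable_vn2 (L2_meas LF)) mm).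
apply: rint_le; last by move=> t; rewrite ge_min lexx orbT.
  exact: rintg_ae e (L2_rintg LF) mm.
by apply: rintgZ; exact/L2_rintg/lrep_L2.
Qed.

Lemma hclosed_preim (H K : hilb (R := R)) (f : H -> K) (B : set K) (M : R) : hlin f ->
  (forall x, nsq (f x) <= M * nsq x) -> hclosed B -> hclosed [set x | B (f x)].
Proof.
move=> lf fM cB w hw; apply: cB => e e0.
have [|a Ba wa] := hw (e / (`|M| + 1)); first by rewrite divr_gt0// ltr_wpDl.
exists (f a) => //; rewrite -hlinB//; apply: le_lt_trans (fM _) _.
move: wa; rewrite ltr_pdivlMr ?ltr_wpDl// => wa.
by have := nsq_ge0 (w - a); have := ler_norm M; nra.
Qed.

Lemma subsp_preim (H K : hilb (R := R)) (f : H -> K) (B : set K) : hlin f ->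
  subsp B -> subsp [set x | B (f x)].
Proof.
move=> lf [B0 hB]; split=> [|c x y hx hy] /=; first by rewrite hlin0.
by rewrite lf; exact: hB.
Qed.

(** By duality: for [k < 0] the adjoint sends [ek k i] into [hHm], because its coefficient with
    index [l >= 0] is the conjugate of a Fourier coefficient of [F] with index [k - l < 0]. *)
Lemma Hinf_mul m n (F : R -> 'M[C]_(m, n)) x : Hinf F -> hH2 n x -> hH2 m (mulop F x).
Proof.
move=> [LF hF] Hx; have bF := Linf_bmx LF; move=> i k k0.
rewrite mulop_adj// ip_conj; set g := mulop _ _.
suff Hg : hHm n g by rewrite (Hg x Hx) cj0.
apply/hHmP => j l l0; rewrite /g ip_conj -mulop_adj//.
rewrite mulop_cls//; last exact: ekf_L2.
have L : L2 m (fun t => F t *m ekf l j t) by apply: L2_mul => //; exact: ekf_L2.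
rewrite ip_cls ?inner2E//; last exact: ekf_L2.
rewrite -[RHS]cj0; congr (_^*); rewrite -(hF i j (k - l)); last by lia.
rewrite /fourier_coef; congr cintegral; apply/funext => t.
rewrite vip_ekf mxE (bigD1 j)//= big1 ?addr0 => [|s sj]; last first.
  by rewrite !mxE (negPf sj) !mulr0.
rewrite !mxE !eqxx mulr1 -mulrA -chiD; congr (_ * _); rewrite /chi; congr cis.
by rewrite !(intrD, intrN); ring.
Qed.

End ScalarMultiplication.
Arguments zmul {R n}.

(** * Zeros of functions in H2 *)

Section ZeroSets.
Context {R : realType}.
Local Notation C := R[i].
Local Notation mu := (circ R).
Local Notation T := (measurableTypeR R).
Variable f : Hil (R := R) 1.
Hypotheses (Hf : hH2 1 f) (f0 : f != 0).

Let inv (A : set (Hil 1)) :=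
  [/\ subsp A, hclosed A, A f & forall x, A x -> A (zmul 1 x)].
(** The closed shift-invariant subspace generated by [f]. *)
Let S : set (Hil 1) := [set x | forall A, inv A -> A x].

Let sS : subsp S.
Proof.
apply: (subsp_forall (A := fun A => [set x | inv A -> A x])) => A.
split=> [[[]]//|c x y hx hy iA]; have [[_ h] _ _ _] := iA.
by apply: h; [exact: hx|exact: hy].
Qed.

Let cS : hclosed S.
Proof.
apply: (hclosed_forall (A := fun A => [set x | inv A -> A x])) => A w hw iA.
have [_ cA _ _] := iA; apply: cA => e e0.
by have [a ha wa] := hw e e0; exists a => //; exact: ha.
Qed.

Let Sf : S f. Proof. by move=> A []. Qed.

Let Sz x : S x -> S (zmul 1 x).
Proof. by move=> Sx A iA; have [_ _ _] := iA; apply; exact: Sx. Qed.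

Let zS : set (Hil 1) := [set x | S (zmul (-1) x)].

Let lz k : hlin (@zmul R 1 k). Proof. exact: zmul_lin. Qed.

Let szS : subsp zS.
Proof. exact: subsp_preim. Qed.

Let czS : hclosed zS.
Proof.
apply: (@hclosed_preim _ _ _ _ _ 1) => // x.
by rewrite mul1r /nsq ip_zmul.
Qed.

Let S_zS x : S x -> zS (zmul 1 x).
Proof. by move=> Sx; rewrite /zS /= zmulK. Qed.

Let SH x : S x -> hH2 1 x.
Proof.
apply; split=> //; [exact: subsp_hH2|exact: hclosed_hH2|move=> y; exact: zmul_hH2].
Qed.

(** If [f] were in [z S], then [S] would be contained in [z S], and all the [z^-k f] would lie in
    [S], hence in H2. Each coefficient of [f] with index [k >= 0] is the coefficient with index -1
    of such a function. *)
Let not_all_zS : ~ zS f.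
Proof.
move=> zSf; have SzS x : S x -> zS x.
  apply; split=> //; last by move=> y zy; rewrite /zS /= zmulK; have := Sz zy; rewrite zmulVK.
have Sk (k : nat) : S (zmul (- k%:Z) f).
  elim: k => [|k IH]; first by rewrite oppr0 zmul0.
  have -> : - k.+1%:Z = -1 + - k%:Z by lia.
  by rewrite -zmul_add; exact: SzS _ IH.
move/eqP: f0; apply; apply: ek_complete => k i.
have [k0|k0] := ltP k 0; first exact: Hf.
have := SH (Sk `|k|.+1%N) i (isT : (-1 : int) < 0).
rewrite zmul_adj zmul_ek opprK.
by have -> : `|k|.+1%:Z + -1 = k by lia.
Qed.

(** The component [g] of [f] orthogonal to [z S] is nonzero and orthogonal to all [z^k g] with
    [k > 0], so the Fourier coefficients of [|g|^2] other than the mean vanish and [|g|] is a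
    nonzero constant. The functions vanishing on the zero set [E] of [f] form a closed invariant
    subspace containing [f], hence containing [g]; so [E] is a null set. *)
Lemma hH2_nonzero : {ae mu, forall t, lrep f t 0 0 != 0}.
Proof.
have [p zp hp] := projection szS czS f.
pose g := f - p.
have Sp : S p.
  by have := Sz zp; rewrite zmulVK.
have Sg : S g by apply: (subspB sS).
have g0 : g != 0.
  by apply/eqP => /subr0_eq fp; apply: not_all_zS; rewrite fp.
have gz (k : nat) : zS (zmul k.+1%:Z g).
  have Sk (j : nat) : S (zmul j%:Z g).
    elim: j => [|j IH]; first by rewrite zmul0.
    have -> : j.+1%:Z = 1 + j%:Z by lia.
    by rewrite -zmul_add; exact: Sz IH.
  have -> : k.+1%:Z = 1 + k%:Z by lia.
  by rewrite -zmul_add; exact: S_zS (Sk k).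
pose w (t : R) := cn2 (lrep g t 0 0).
have iw : rintg w.
  apply: (rintg_le _ (L2_rintg (lrep_L2 g))).
    by apply: measurable_cn2; exact: (L2_meas (lrep_L2 g)).
  by move=> t; rewrite ger0_norm ?cn2_ge0// cn2_le_vn2.
have ipE k : ip g (zmul k g) = cintegral (fun t => (w t)%:C%C * chi (- k) t).
  rewrite -[X in ip X _]lrepK /zmul /smul /mulop ip_cls ?inner2E; last first.
  - by apply: L2_mul; [exact: bmx_chi|exact: lrep_L2].
  - exact: lrep_L2.
  congr cintegral; apply/funext => t.
  rewrite mul_scalar_mx /vip big_ord1 !mxE cjM -chiN mulrCA mulcJ mulrC //.
have wc : {ae mu, forall t, w t = rint w}.
  have ic : cintg (fun t => (w t)%:C%C + (- rint w)%:C%C).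
    apply: cintgD; last exact: cintg_cst.
    by split=> //=; exact: rintg_cst.
  have cI (k : int) : cintegral (fun t => ((w t)%:C%C + (- rint w)%:C%C) * chi k t) = 0.
    have i1 : cintg (fun t => (w t)%:C%C * chi k t).
      apply: (@cintg_mulb _ _ _ 1); [by split=> //=; exact: rintg_cst|exact: cmeas_chi|].
      by move=> x; rewrite cn2_chi.
    have i2 : cintg (chi k : R -> C).
      have hb : forall x : R, cn2 (chi k x) <= 1 by move=> x; rewrite cn2_chi.
      have e : (fun x : R => 1 * chi k x) = chi k by apply/funext => x; rewrite mul1r.
      by rewrite -e; exact: cintg_mulb (cintg_cst 1) (cmeas_chi k) hb.
    under eq_fun do rewrite mulrDl.
    rewrite cintD//; last exact: cintgZ.
    rewrite cintZ// cint_chi; have := ipE (- k); rewrite opprK => <-.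
    have [->|k0] := eqVneq k 0.
      rewrite oppr0 zmul0 ipxx mulr1 nsq_Hil -rmorphD.
      rewrite [X in X + _](_ : _ = rint w) ?subrr//.
      by congr rint; apply/funext => t; rewrite /vn2 big_ord1.
    rewrite mulr0 addr0; case: k k0 i1 i2 => [[|k]|k] // _ _ _.
      by rewrite ip_conj zmul_adj opprK [X in X^*](hp _ (gz k)) cj0.
    by rewrite NegzE opprK; exact: (hp _ (gz k)).
  apply: aeS (fourier_unique ic cI) => t /(congr1 (@complex.Re R)) /=.
  by move=> h; lra.
pose E : set T := [set t | lrep f t 0 0 = 0].
have mf : measurable_fun (setT : set T) (fun t => cn2 (lrep f t 0 0)).
  by apply: measurable_cn2; exact: (L2_meas (lrep_L2 f)).
have mE : measurable E.
  have := mf measurableT [set 0] (measurable_set1 0); rewrite setTI.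
  congr measurable; apply/seteqP; split=> t /=; first exact: cn2_eq0.
  by rewrite /E /= => ->; exact: cn2_0.
pose e (t : R) : C := (\1_E t)%:C%C.
have me : cmeas e by apply: cmeas_real; exact: measurable_indic.
have be : {ae mu, forall x, cn2 (e x) <= 1}.
  apply: ae_all => x; rewrite /e /cn2 /= expr0n addr0 indicE.
  by case: (x \in E); rewrite ?expr1n ?expr0n.
have bE := bmx_scalar 1 me be.
have invE : inv [set x | smul e x = 0].
  have le : hlin (@smul R 1 e) by apply: mulop_lin.
  split.
  - apply: (subsp_preim (B := [set 0])) => //.
    by split=> // c x y /= -> ->; rewrite scaler0 addr0.
  - have [M hM] := nsq_mulop bE.
    apply: (@hclosed_preim _ _ _ _ [set 0] M) => // v hv; apply: nsq_le0.
    apply/ler_addgt0Pl => d d0; rewrite addr0.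
    by have [_ -> /ltW] := hv d d0; rewrite subr0.
  - apply: cls_repr; first by apply: L2_mul; [|exact: lrep_L2].
    apply: aeS (lrep0 1) => t ->; apply/colP => i; rewrite ord1 mul_scalar_mx !mxE.
    rewrite /e indicE; case: (boolP (t \in E)) => [|_]; last by rewrite mul0r.
    by rewrite inE /E /= => ->; rewrite mulr0.
  move=> x /= hx.
  have h1 : smul e (zmul 1 x) = mulop (fun t => (e t)%:M *m (chi 1 t)%:M) x.
    exact: (mulop_comp x bE (bmx_chi 1 1)).
  have h2 : zmul 1 (smul e x) = mulop (fun t => (chi 1 t)%:M *m (e t)%:M) x.
    exact: (mulop_comp x (bmx_chi 1 1) bE).
  have h3 : (fun t => (e t)%:M *m (chi 1 t)%:M) = (fun t => (chi 1 t)%:M *m (e t)%:M : 'M[C]_1).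
    by apply/funext => t; rewrite -!scalar_mxM mulrC.
  by rewrite h1 h3 -h2 hx; exact: (hlin0 (lz 1)).
have gE : smul e g = 0 by exact: (Sg _ invE).
have rw0 : rint w != 0.
  apply/eqP => w0; move/eqP: g0; apply; apply: lspaceP.
  apply: aeS2 wc (lrep0 1) => t; rewrite w0 => wt ->.
  by apply/colP => i; rewrite ord1 mxE; apply: cn2_eq0.
have key := lrep_smul g me be.
apply: aeS (aeI (aeI key wc) (lrep0 1)) => t [[h1 h2] h3].
apply/eqP => ft0; move/eqP: rw0; apply; rewrite -h2 /w.
have tE : t \in E by rewrite inE.
have : lrep g t = 0.
  have := h1; rewrite gE h3 /e indicE tE scale1r => <- //.
by move=> ->; rewrite mxE cn2_0.
Qed.

End ZeroSets.

Lemma addB_subB (V : zmodType) (a p q : V) : p + q = a + (q - (a - p)).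
Proof. by rewrite opprB addrCA [a + _]addrC subrK addrC. Qed.

Lemma projection_uniq (R : realType) (H : hilb (R := R)) (S : set H) x p g : subsp S ->
  S p -> S g -> (forall h, S h -> ip (x - p) h = 0) ->
  (forall h, S h -> ip (x - g) h = 0) -> p = g.
Proof.
move=> sS Sp Sg hp hg; apply/subr0_eq/nsq_eq0.
have Spg : S (p - g) by exact: subspB.
have : ip (p - g) (p - g) = ip (x - g) (p - g) - ip (x - p) (p - g).
  have e : p - g = (x - g) - (x - p) by rewrite opprB [RHS]addrC addrA subrK.
  by rewrite -ipBl -e.
by rewrite hp// hg// subrr /nsq => ->.
Qed.

Lemma eq_addl_sub (V : zmodType) (x c d : V) : x = c + d -> x - c = d.
Proof. by move=> ->; rewrite addrC addKr. Qed.

Lemma hlin_comb_sub (R : realType) (H : hilb (R := R)) (f : H -> H) c x y x' y' : hlin f ->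
  f (c *: x + y) - (c *: x' + y') = c *: (f x - x') + (f y - y').
Proof. by move=> lf; rewrite lf scalerBr opprD addrACA. Qed.

(** * Toeplitz operators *)

Section Toeplitz.
Context {R : realType}.
Local Notation C := R[i].
Local Notation mu := (circ R).
Local Notation T := (measurableTypeR R).

Lemma smul_comm n (u v : R -> C) (x : Hil n) : bmx (fun t => (u t)%:M : 'M[C]_n) ->
  bmx (fun t => (v t)%:M : 'M[C]_n) -> smul u (smul v x) = smul v (smul u x).
Proof.
move=> bu bv.
have h1 : smul u (smul v x) = mulop (fun t => (u t)%:M *m (v t)%:M) x.
  exact: (mulop_comp x bu bv).
have h2 : smul v (smul u x) = mulop (fun t => (v t)%:M *m (u t)%:M) x.
  exact: (mulop_comp x bv bu).
rewrite h1 h2; congr (mulop _ x); apply/funext => t.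
by rewrite -!scalar_mxM mulrC.
Qed.

Lemma unimodular_cmeas (u : R -> C) : unimodular u -> cmeas u.
Proof.
move=> [mu' _]; have := mu' 0 0; apply: cmeas_eq => x.
by rewrite mxE.
Qed.

Lemma unimodular_cn2 (u : R -> C) : unimodular u -> {ae mu, forall x, cn2 (u x) = 1}.
Proof. by move=> [_]; apply: aeS => x; exact: cn2_norm1. Qed.

Lemma unimodular_bound (u : R -> C) : unimodular u -> {ae mu, forall x, cn2 (u x) <= 1}.
Proof. by move=> /unimodular_cn2; apply: aeS => x ->. Qed.

Lemma bmx_unimodular n (u : R -> C) : unimodular u -> bmx (fun t => (u t)%:M : 'M[C]_n).
Proof.
by move=> uu; apply: bmx_scalar (unimodular_cmeas uu) (unimodular_bound uu).
Qed.

Lemma ip_smul n (u : R -> C) (x y : Hil n) : unimodular u ->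
  ip (smul u x) (smul u y) = ip x y.
Proof.
move=> uu; have bu := bmx_unimodular n uu.
rewrite /smul mulop_adj// (mulop_comp y (bmx_adj bu) bu).
congr (ip x _); apply: mulop1; first by apply: bmxM => //; exact: bmx_adj.
apply: aeS (unimodular_cn2 uu) => t ut; apply/matrixP => i j.
rewrite mxE (bigD1 i)//= big1 ?addr0 => [|k ki].
  rewrite !mxE !eqxx mulr1n; case: (i == j); last by rewrite !mulr0n mulr0.
  by rewrite !mulr1n mulrC mulcJ ut.
by rewrite !mxE (negPf ki) mulr0n cj0 mul0r.
Qed.

Lemma smul_cls n (u : R -> C) (f : R -> 'cV[C]_n) : unimodular u -> L2 n f ->
  smul u (cls f) = cls (fun t => u t *: f t).
Proof.
move=> uu Lf; rewrite /smul mulop_cls//; last exact: bmx_unimodular.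
by congr cls; apply/funext => t; rewrite mul_scalar_mx.
Qed.

Lemma L2_smul n (u : R -> C) (f : R -> 'cV[C]_n) : unimodular u -> L2 n f ->
  L2 n (fun t => u t *: f t).
Proof.
move=> uu Lf; have := L2_mul (bmx_unimodular n uu) Lf.
by under eq_fun do rewrite mul_scalar_mx.
Qed.

(* All Fourier coefficients of [u f b^*] vanish, so [u f b^* = 0], and [f] vanishes
   only on a null set. *)
Theorem coburn (u : R -> C) (f b : Hil 1) : unimodular u -> hH2 1 f ->
  hHm 1 (smul u f) -> f != 0 -> hH2 1 b ->
  (forall h, hH2 1 h -> ip (smul u h) b = 0) -> b = 0.
Proof.
move=> uu Hf Hu f0 Hb hb.
have bu := bmx_unimodular 1 uu.
pose F : Hil 1 := smul u f.
pose w (t : R) : C := vip (lrep F t) (lrep b t).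
have iw : cintg w by apply: cintg_vip; exact: lrep_L2.
have ipz k (x y : Hil 1) : ip x (zmul k y) =
    cintegral (fun t => vip (lrep x t) (lrep y t) * chi (- k) t).
  rewrite -{1}(lrepK x) /zmul /smul /mulop ip_cls ?inner2E; last first.
  - by apply: L2_mul; [exact: bmx_chi|exact: lrep_L2].
  - exact: lrep_L2.
  congr cintegral; apply/funext => t; rewrite mul_scalar_mx /vip !big_ord1 !mxE.
  by rewrite cjM -chiN; ring.
have w0 : ae_eq_fun w (fun=> 0).
  apply: fourier_unique iw _ => k; rewrite -[k]opprK -ipz.
  have [k0|k0] := leP k 0.
    by apply: Hu; apply: zmul_hH2 => //; lia.
  have -> : ip F (zmul (- k) b) = ip (zmul k F) b by rewrite zmul_adj.
  have -> : zmul k F = smul u (zmul k f).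
    exact: (smul_comm f (bmx_chi 1 k) bu).
  by apply: hb; apply: zmul_hH2 => //; exact: ltW.
apply: lspaceP.
have nz := hH2_nonzero Hf f0.
have key := lrep_smul f (unimodular_cmeas uu) (unimodular_bound uu).
apply: aeS (aeI (aeI w0 nz) (aeI (aeI key (unimodular_cn2 uu)) (lrep0 1))).
move=> t [[wt ft] [[Ft ut] ->]]; apply/colP => i; rewrite ord1 mxE.
move: wt; rewrite /w /vip big_ord1.
have -> : lrep F t 0 0 = u t * lrep f t 0 0.
  by move: Ft => /(congr1 (fun v : 'cV[C]_1 => v 0 0)); rewrite mxE.
move=> /eqP; rewrite !mulf_eq0 (negPf ft) orbF => /orP[/eqP u0|/eqP].
  by move: ut; rewrite u0 cn2_0 => /eqP; rewrite eq_sym oner_eq0.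
by move=> /(congr1 Num.conj); rewrite cjK cj0.
Qed.

Lemma ip_clsl n (f : R -> 'cV[C]_n) (h : Hil n) : L2 n f -> ip (cls f : Hil n) h = inner2 f (lrep h).
Proof. by move=> Lf; rewrite -(ip_cls Lf (lrep_L2 h)) (lrepK h). Qed.

(** The projection theorem in [Hil] provides a witness, so the choice in [proj2] does not fall back
    on its default value. *)
Lemma proj2_spec n (A : set (R -> 'cV[C]_n)) (hA : set (Hil n)) (f : R -> 'cV[C]_n) :
  (forall f, A f -> L2 n f) -> (forall f, L2 n f -> A f <-> hA (cls f)) ->
  subsp hA -> hclosed hA -> L2 n f ->
  A (proj2 A f) /\ forall h, hA h -> ip ((cls f : Hil n) - cls (proj2 A f)) h = 0.
Proof.
move=> AL AhA shA chA Lf.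
have [p hp orth] := projection shA chA (cls f).
have Ap : A (lrep p) by apply/AhA; [exact: lrep_L2|rewrite lrepK].
suff [h1 h2] : [set g | A g /\ forall h, A h -> inner2 (fun x => f x - g x) h = 0]
    (proj2 A f).
  split; [exact: h1|move=> h hh]; have Lp := AL _ h1.
  rewrite -(clsB Lf Lp) (ip_clsl h (L2D Lf (L2N Lp))); apply: h2.
  by apply/AhA; [exact: lrep_L2|rewrite lrepK].
apply: xgetPex; exists (lrep p); split=> // h Ah; have Lh := AL _ Ah.
rewrite -(ip_cls (L2D Lf (L2N (lrep_L2 p))) Lh) (clsB Lf (lrep_L2 p)) (lrepK p).
by apply: orth; apply/AhA.
Qed.

Lemma cls_sum n (I : finType) (c : I -> C) (e : I -> R -> 'cV[C]_n) :
  (forall i, L2 n (e i)) -> L2 n (fun x => \sum_i c i *: e i x) /\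
  cls (fun x => \sum_i c i *: e i x) = \sum_i c i *: (cls (e i) : Hil n).
Proof.
move=> Le; rewrite -[index_enum I]/(index_enum I).
elim: (index_enum I) => [|i r [IH1 IH2]].
  have -> : (fun x : R => \sum_(i <- [::]) c i *: e i x) = fun=> 0.
    by apply/funext => x; rewrite big_nil.
  by rewrite big_nil; split; first exact: L20.
have -> : (fun x : R => \sum_(j <- i :: r) c j *: e j x) =
    fun x => c i *: e i x + \sum_(j <- r) c j *: e j x.
  by apply/funext => x; rewrite big_cons.
by split; [exact: L2_lin|rewrite cls_lin// IH2 big_cons].
Qed.

Lemma ae0_cls n (f : R -> 'cV[C]_n) : L2 n f ->
  ae_eq_fun f (fun=> 0) <-> (cls f : Hil n) = 0.
Proof.
move=> Lf; split=> [h|h]; first exact: (cls_eq Lf (L20 n) h).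
exact: (cls_inj Lf (L20 n) h).
Qed.

Lemma dim_quotient_dimH n (A : set (R -> 'cV[C]_n)) (hA : set (Hil n)) k :
  (forall f, A f -> L2 n f) -> (forall f, L2 n f -> A f <-> hA (cls f)) ->
  dim_quotient A [set f | ae_eq_fun f (fun=> 0)] k -> dimH hA k.
Proof.
move=> AL AhA [e [Ae fre spe]].
have Le i : L2 n (e i) by apply: AL.
exists (fun i => cls (e i)); split.
- by move=> i; apply/AhA.
- move=> c s0; apply: fre; have [L1 E1] := cls_sum c Le.
  by apply/(ae0_cls L1); rewrite E1.
move=> x hx; have Ax : A (lrep x) by apply/AhA; [exact: lrep_L2|rewrite lrepK].
have [c hc] := spe _ Ax; exists c.
have [L1 E1] := cls_sum c Le.
have := hc; rewrite /= => /(ae0_cls (L2D (lrep_L2 x) (L2N L1))).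
by rewrite (clsB (lrep_L2 x) L1) lrepK E1 => /subr0_eq.
Qed.

Lemma norm2_cvg0 n (f : nat -> R -> 'cV[C]_n) g : (forall i, L2 n (f i)) -> L2 n g ->
  (forall i, nsq ((cls g : Hil n) - cls (f i)) <= 4^-1 ^+ i) ->
  norm2 (fun x => f i x - g x) @[i --> \oo] --> 0%E.
Proof.
move=> Lf Lg h.
have e i : norm2 (fun x => f i x - g x) = (Num.sqrt (nsq ((cls g : Hil n) - cls (f i))))%:E.
  rewrite (norm2_nsq (L2D (Lf i) (L2N Lg))).
  have e1 : (cls (fun x => f i x - g x) : Hil n) = (cls (f i) : Hil n) - cls g.
    exact: (clsB (Lf i) Lg).
  have e2 := nsqC (cls (f i) : Hil n) (cls g).
  exact: (congr1 (fun z => (Num.sqrt z)%:E) (etrans (congr1 (fun y : Hil n => nsq y) e1) e2)).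
under eq_fun do rewrite e.
apply: cvg_EFin; first exact: nearW.
have half : (2^-1 : R) ^+ i @[i --> \oo] --> (0 : R).
  by apply: cvg_expr; rewrite ger0_norm ?invr_ge0// invf_lt1// ltr1n.
apply: (squeeze_cvgr _ _ half); last exact: cvg_cst.
apply: nearW => i; rewrite sqrtr_ge0/=.
have -> : (2^-1 : R) ^+ i = Num.sqrt (4^-1 ^+ i).
  rewrite -[LHS]ger0_norm ?exprn_ge0 ?invr_ge0// -sqrtr_sqr -exprM mulnC exprM.
  by congr (Num.sqrt (_ ^+ i)); field.
exact: ler_wsqrtr.
Qed.

Lemma H2_L2 n (f : R -> 'cV[C]_n) : H2 n f -> L2 n f.
Proof. by case. Qed.

Section Index.
Variable u : R -> C.
Hypothesis uu : unimodular u.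

Let toeplitz_spec (f : R -> 'cV[C]_1) : L2 1 f -> H2 1 (toeplitz u f) /\
  forall h, hH2 1 h -> ip (smul u (cls f) - cls (toeplitz u f)) h = 0.
Proof.
move=> Lf; rewrite smul_cls//.
apply: proj2_spec; [exact: H2_L2|exact: H2P|exact: subsp_hH2|exact: hclosed_hH2|].
exact: L2_smul.
Qed.

Definition toeplitz_ker : set (Hil 1) := [set a | hH2 1 a /\ hHm 1 (smul u a)].

Let ker_opP (f : R -> 'cV[C]_1) : L2 1 f ->
  ker_op (H2 1) (toeplitz u) f <-> toeplitz_ker (cls f).
Proof.
move=> Lf; have [Hp hp] := toeplitz_spec Lf; have Lp := H2_L2 Hp.
split=> [[Hf /(ae0_cls Lp) p0]|[Hf Hm]].
  split; first exact/H2P.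
  by move=> h hh; have := hp h hh; rewrite p0 subr0.
split; first exact/H2P.
apply/(ae0_cls Lp); set p : Hil 1 := cls (toeplitz u f).
have Hpp : hH2 1 p by apply/H2P.
have := hp p Hpp; rewrite ipBl Hm// sub0r ipxx -rmorphN => /(congr1 (@complex.Re R)) /=.
by move=> h; apply: (@nsq_eq0 R (Hil 1) p); lra.
Qed.

Lemma toeplitz_index_dim k : toeplitz_index u k -> exists a b : nat,
  dimH toeplitz_ker a /\ k = a%:Z - b%:Z.
Proof.
move=> [_ [a [b [da _ ->]]]]; exists a, b; split=> //.
by apply: dim_quotient_dimH da => [f [/H2_L2]//|]; exact: ker_opP.
Qed.

(** The positive index [k0] yields a nonzero kernel element, so the range of [T_u] is dense in H2 by
    Coburn's lemma, and it is closed by Fredholmness. Thus the cokernel is zero, and any index [k]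
    is the dimension of the kernel. In the form used later, surjectivity says that every element of
    L2 is the sum of an element of [u H2] and one of H2-. *)
Theorem toeplitz_onto k0 k : toeplitz_index u k0 -> 0 < k0 -> toeplitz_index u k ->
  (forall a : Hil 1, exists c d, [/\ hH2 1 c, hHm 1 d & a = smul u c + d]) /\
  exists2 m : nat, k = m%:Z & dimH toeplitz_ker m.
Proof.
move=> hk0 k0gt0 hk.
have [f [Hf Hm] f0] : exists2 f, toeplitz_ker f & f != 0.
  have [a [b [[e [Ke fre _]] kab]]] := toeplitz_index_dim hk0.
  have a0 : (0 < a)%N by lia.
  exists (e (Ordinal a0)); first exact: Ke.
  apply/eqP => e0; have := fre (fun i => (i == Ordinal a0)%:R).
  rewrite (bigD1 (Ordinal a0))//= big1 ?addr0 => [|i /negPf ->]; last by rewrite scale0r.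
  by rewrite e0 scaler0 => /(_ erefl (Ordinal a0))/eqP; rewrite eqxx oner_eq0.
have bu := bmx_unimodular 1 uu.
have lu : hlin (@smul R 1 u) by exact: mulop_lin.
(* The range of [T_u]: that [y] is the projection of [u c] onto H2 is expressed by [u c - y] being
   in [hHm]. *)
pose M : set (Hil 1) := [set y | hH2 1 y /\ exists2 c, hH2 1 c & hHm 1 (smul u c - y)].
have sM : subsp M.
  split; first split; first exact: (subsp0 (@subsp_hH2 R 1)).
    exists 0; first exact: (subsp0 (@subsp_hH2 R 1)).
    by rewrite (hlin0 lu) subr0; exact: (subsp0 (@subsp_hHm R 1)).
  move=> c x y [Hx [cx Hcx hx]] [Hy [cy Hcy hy]]; split.
    exact: ((@subsp_hH2 R 1).2 c _ _ Hx Hy).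
  exists (c *: cx + cy); first exact: ((@subsp_hH2 R 1).2 c _ _ Hcx Hcy).
  have e1 : smul u (c *: cx + cy) - (c *: x + y) = c *: (smul u cx - x) + (smul u cy - y).
    exact: hlin_comb_sub.
  have e2 := (@subsp_hHm R 1).2 c _ _ hx hy.
  exact: (eq_ind_r (hHm 1) e2 e1).
have dense : forall w, hH2 1 w -> hclosure M w.
  apply: (dense_of_orth sM (@subsp_hH2 R 1) (@hclosed_hH2 R 1)); first by move=> x [].
  move=> b Hb hb; apply: (coburn uu Hf Hm f0 Hb) => h Hh.
  have [c [d [Hc Hd e]]] := hH2_hHm_decomp (smul u h).
  have e1 : hHm 1 (smul u h - c) by exact: (eq_ind_r (hHm 1) Hd (eq_addl_sub e)).
  have Mc : M c by split; [exact: Hc|exists h; [exact: Hh|exact: e1]].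
  have e2 := etrans (congr1 (fun y : Hil 1 => ip y b) e) (ipDl c d b).
  by rewrite e2 (Hd b Hb) addr0 ip_conj (hb c Mc) cj0.
have [clR [a [b [da db kab]]]] := hk.
have rangeM g : M g -> range_op (H2 1) (H2 1) (toeplitz u) (lrep g).
  move=> [Hg [c Hc hc]]; split; first exact: H2_lrep.
  exists (lrep c); first exact: H2_lrep.
  have [Hp hp] := toeplitz_spec (lrep_L2 c).
  apply: (cls_inj (H2_L2 Hp) (lrep_L2 g)); apply: etrans (esym (lrepK g)).
  apply: (@projection_uniq R (Hil 1) (hH2 1) (smul u c) _ _ (@subsp_hH2 R 1) _ Hg _ hc).
    exact: ((H2P (H2_L2 Hp)).1 Hp).
  by move=> h Hh; have := hp h Hh; rewrite lrepK.
have onto g : hH2 1 g -> range_op (H2 1) (H2 1) (toeplitz u) (lrep g).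
  move=> Hg; have q0 i : 0 < 4^-1 ^+ i :> R by rewrite exprn_gt0// invr_gt0.
  have /choice[m hm] i : exists m, M m /\ nsq (g - m) < 4^-1 ^+ i.
    by have [m Mm gm] := dense g Hg _ (q0 i); exists m.
  apply: (clR (fun i => lrep (m i))).
  - by move=> i; apply: rangeM; case: (hm i).
  - exact: lrep_L2.
  apply: norm2_cvg0 => [i||i]; [exact: lrep_L2|exact: lrep_L2|].
  by rewrite !lrepK; apply: ltW; case: (hm i).
have b0 : b = 0%N.
  case: b db kab => // b [e [He fre _]] _; exfalso.
  have := fre (fun i => (i == ord0)%:R).
  have -> : (fun x : R => \sum_(i < b.+1) (i == ord0)%:R *: e i x) = e ord0.
    apply/funext => x; rewrite (bigD1 ord0)//= big1 ?addr0 => [|i /negPf ->].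
      by rewrite scale1r.
    by rewrite scale0r.
  have He0 := He ord0; have Le0 := H2_L2 He0.
  have [_ [c Hc hc]] := onto (cls (e ord0)) ((H2P Le0).1 He0).
  have R0 : range_op (H2 1) (H2 1) (toeplitz u) (e ord0).
    split=> //; exists c => //; apply: ae_eq_fun_trans hc _; exact: lrep_cls.
  by move=> /(_ R0 ord0)/eqP; rewrite eqxx oner_eq0.
split; last first.
  exists a; first by rewrite kab b0 subr0.
  by apply: dim_quotient_dimH da => [h [/H2_L2]//|]; exact: ker_opP.
move=> x; have [p [q [Hp Hq ->]]] := hH2_hHm_decomp x.
have [_ [c Hc hc]] := onto p Hp; have Lc := H2_L2 Hc.
have [Ht ht] := toeplitz_spec Lc.
have e : (cls (toeplitz u c) : Hil 1) = p.
  by rewrite (cls_eq (H2_L2 Ht) (lrep_L2 p) hc) lrepK.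
rewrite e in ht.
exists (cls c), (q - (smul u (cls c) - p)); split.
- exact/H2P.
- by apply: (subspB (@subsp_hHm R 1)).
- exact: addB_subB.
Qed.

End Index.
End Toeplitz.

(** * Thematic functions *)

Section Thematic.
Context {R : realType}.
Local Notation C := R[i].
Local Notation mu := (circ R).
Local Notation T := (measurableTypeR R).

Lemma bmx_sub m n m' n' (F : R -> 'M[C]_(m, n)) (F' : R -> 'M[C]_(m', n'))
    (f : 'I_m' -> 'I_m) (g : 'I_n' -> 'I_n) : bmx F ->
  (forall t i j, F' t i j = F t (f i) (g j)) -> bmx F'.
Proof.
move=> [mF [M hM]] e; split; first by move=> i j; apply: cmeas_eq (mF (f i) (g j)) => t.
by exists M; apply: aeS hM => t ht i j; rewrite e.
Qed.

Lemma bmx_tr m n (F : R -> 'M[C]_(m, n)) : bmx F -> bmx (fun t => (F t)^T).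
Proof.
move=> [mF [M hM]]; split; first by move=> i j; apply: cmeas_eq (mF j i) => t; rewrite mxE.
by exists M; apply: aeS hM => t h i j; rewrite mxE.
Qed.

Lemma bmx_conj m n (F : R -> 'M[C]_(m, n)) : bmx F -> bmx (fun t => conj_mx (F t)).
Proof.
move=> bF; have := bmx_tr (bmx_adj bF).
by under eq_fun do rewrite /adjmx /conj_mx -map_trmx trmxK.
Qed.

Lemma lrepD n (x y : Hil n) : ae_eq_fun (lrep (x + y)) (fun t : R => lrep x t + lrep y t).
Proof. exact: lrep_add. Qed.

Lemma flip_mulop m n (F : R -> 'M[C]_(m, n)) (x : Hil n) : bmx F ->
  flip (mulop F x) = mulop (fun t => conj_mx (F t)) (flip x).
Proof.
move=> bF; apply: lspaceP.
apply: aeS (aeI (aeI (lrep_flip (mulop F x)) (lrep_mulop x bF))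
  (aeI (lrep_mulop (flip x) (bmx_conj bF)) (lrep_flip x))).
move=> t [[-> ->] [-> ->]].
by rewrite scalemxAr /conj_mx map_mxM.
Qed.

Definition top n1 n2 : Hil (R := R) (n1 + n2) -> Hil n1 :=
  mulop (fun=> row_mx 1%:M 0).

Definition hX n1 n2 : set (Hil (R := R) (n1 + n2)) := [set x | hH2 n1 (top x)].
Definition hY n1 n2 : set (Hil (R := R) (n1 + n2)) := [set x | hHm n1 (top x)].

Lemma top_lin n1 n2 : hlin (@top n1 n2).
Proof. by apply: mulop_lin; exact: bmx_cst. Qed.

Lemma subsp_hX n1 n2 : subsp (@hX n1 n2).
Proof. by apply: subsp_preim; [exact: top_lin|exact: subsp_hH2]. Qed.

Lemma subsp_hY n1 n2 : subsp (@hY n1 n2).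
Proof. by apply: subsp_preim; [exact: top_lin|exact: subsp_hHm]. Qed.

Lemma hclosed_hX n1 n2 : hclosed (@hX n1 n2).
Proof.
have [M hM] := nsq_mulop (bmx_cst (row_mx 1%:M 0 : 'M[C]_(n1, n1 + n2))).
exact: (hclosed_preim (@top_lin n1 n2) hM (@hclosed_hH2 R n1)).
Qed.

Lemma hclosed_hY n1 n2 : hclosed (@hY n1 n2).
Proof.
have [M hM] := nsq_mulop (bmx_cst (row_mx 1%:M 0 : 'M[C]_(n1, n1 + n2))).
exact: (hclosed_preim (@top_lin n1 n2) hM (@hclosed_hHm R n1)).
Qed.

Lemma hY_flip n1 n2 (x : Hil (n1 + n2)) : hY x <-> hX (flip x).
Proof.
have e : top (flip x) = flip (top x).
  rewrite /top flip_mulop; last exact: bmx_cst.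
  congr (mulop _ (flip x)); apply/funext => t; apply/esym.
  by rewrite /conj_mx map_row_mx map_mx1 map_mx0.
have h := hHm_flip (top x); rewrite -e in h; exact: h.
Qed.

Lemma outer_dense k l (F : R -> 'M[C]_(k, l)) g : outer_fun F -> hH2 k g ->
  hclosure (mulop F @` hH2 l) g.
Proof.
move=> [HF dF] Hg e e0; have bF := Linf_bmx HF.1.
have se : 0 < Num.sqrt e by rewrite sqrtr_gt0.
have [f Hf hf] := dF _ (H2_lrep Hg) _ se; have Lf := H2_L2 Hf.
exists (mulop F (cls f)); first by exists (cls f) => //; exact/H2P.
have LFf := L2_mul bF Lf.
have e1 : (mulop F (cls f) : Hil k) - g = cls (fun x => F x *m f x - lrep g x).
  rewrite (clsB LFf (lrep_L2 g)) (lrepK g).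
  exact: (congr1 (fun y : Hil k => y - g) (mulop_cls bF Lf)).
rewrite nsqC e1.
move: hf; rewrite (norm2_nsq (L2D LFf (L2N (lrep_L2 g)))) lte_fin.
by rewrite ltr_sqrt.
Qed.

Lemma mulop_0 m n (F : R -> 'M[C]_(m, n)) x : bmx F -> {ae mu, forall t, F t = 0} ->
  mulop F x = 0.
Proof.
move=> bF h; apply: cls_repr; first by apply: L2_mul => //; exact: lrep_L2.
by apply: aeS (aeI h (lrep0 m)) => t [-> ->]; rewrite mul0mx.
Qed.

(** * Splitting along the first column of a unitary function *)

Section Split.
Variables (r : nat) (U : R -> 'M[C]_(1 + r)).
Hypotheses (bU : bmx U) (uU : {ae mu, forall t, U t \is unitarymx}).

Let c1 t : 'M[C]_(1 + r, 1) := lsubmx (U t).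
Let c2 t : 'M[C]_(1 + r, r) := rsubmx (U t).

Let bc1 : bmx c1.
Proof.
have e t i j : c1 t i j = U t i (lshift r j) by rewrite mxE.
exact: (bmx_sub bU e).
Qed.

Let bc2 : bmx c2.
Proof.
have e t i j : c2 t i j = U t i (rshift 1 j) by rewrite mxE.
exact: (bmx_sub bU e).
Qed.

Let gram : {ae mu, forall t, [/\ adjmx (c1 t) *m c1 t = 1%:M, adjmx (c1 t) *m c2 t = 0,
  adjmx (c2 t) *m c1 t = 0, adjmx (c2 t) *m c2 t = 1%:M &
  c1 t *m adjmx (c1 t) + c2 t *m adjmx (c2 t) = 1%:M]}.
Proof.
apply: aeS uU => t /unitarymxP h.
have UE : U t = row_mx (c1 t) (c2 t) by rewrite hsubmxK.
have adjE : adjmx (U t) = col_mx (adjmx (c1 t)) (adjmx (c2 t)).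
  by rewrite UE /adjmx tr_row_mx /conj_mx map_col_mx.
have h1 : U t *m adjmx (U t) = 1%:M.
  rewrite -[RHS]h; congr (_ *m _).
have h2 : adjmx (U t) *m U t = 1%:M by exact: mulmx1C.
rewrite adjE {1}UE mul_col_row [1%:M]scalar_mx_block in h2.
have [a1 a2 a3 a4] := eq_block_mx h2.
by split=> //; rewrite -mul_row_col -adjE -UE.
Qed.

Let fst f : Hil 1 := mulop (fun t => adjmx (c1 t)) f.
Let snd f : Hil r := mulop (fun t => adjmx (c2 t)) f.
Let glu (a : Hil 1) (h : Hil r) : Hil (1 + r) := mulop c1 a + mulop c2 h.

Let lfst : hlin fst. Proof. by apply: mulop_lin; exact: bmx_adj. Qed.
Let lsnd : hlin snd. Proof. by apply: mulop_lin; exact: bmx_adj. Qed.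

Let glu_parts x : glu (fst x) (snd x) = x.
Proof.
rewrite /glu /fst /snd (mulop_comp x bc1 (bmx_adj bc1)) (mulop_comp x bc2 (bmx_adj bc2)).
apply: lspaceP.
apply: aeS (aeI (aeI (lrepD (mulop (fun t => c1 t *m adjmx (c1 t)) x)
    (mulop (fun t => c2 t *m adjmx (c2 t)) x)) gram)
  (aeI (lrep_mulop x (bmxM bc1 (bmx_adj bc1))) (lrep_mulop x (bmxM bc2 (bmx_adj bc2))))).
move=> t [[h [_ _ _ _ g]] [h1 h2]].
have e v : c1 t *m adjmx (c1 t) *m v + c2 t *m adjmx (c2 t) *m v = v :> 'cV_(1 + r).
  by rewrite -mulmxDl g mul1mx.
exact: (etrans h (etrans (congr2 +%R h1 h2) (e _))).
Qed.

Let ip_sp x y : ip x y = ip (fst x) (fst y) + ip (snd x) (snd y).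
Proof.
rewrite -{1}(glu_parts x) /glu ipDl.
by rewrite (mulop_adj (fst x) y bc1) (mulop_adj (snd x) y bc2).
Qed.

Let fst_glu a h : fst (glu a h) = a.
Proof.
have e1 : fst (mulop c1 a) = a.
  apply: etrans (mulop_comp a (bmx_adj bc1) bc1) _.
  by apply: mulop1; [exact: bmxM (bmx_adj bc1) bc1|apply: aeS gram => t []].
have e2 : fst (mulop c2 h) = 0.
  apply: etrans (mulop_comp h (bmx_adj bc1) bc2) _.
  by apply: mulop_0; [exact: bmxM (bmx_adj bc1) bc2|apply: aeS gram => t []].
exact: (etrans (hlinD lfst _ _) (etrans (congr2 +%R e1 e2) (addr0 _))).
Qed.

Let snd_glu a h : snd (glu a h) = h.
Proof.
have e1 : snd (mulop c1 a) = 0.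
  apply: etrans (mulop_comp a (bmx_adj bc2) bc1) _.
  by apply: mulop_0; [exact: bmxM (bmx_adj bc2) bc1|apply: aeS gram => t []].
have e2 : snd (mulop c2 h) = h.
  apply: etrans (mulop_comp h (bmx_adj bc2) bc2) _.
  by apply: mulop1; [exact: bmxM (bmx_adj bc2) bc2|apply: aeS gram => t []].
exact: (etrans (hlinD lsnd _ _) (etrans (congr2 +%R e1 e2) (add0r _))).
Qed.

(** In coordinates, [U^* x] is cut after its first entry. *)
Definition unitary_split : hsplit (Hil (1 + r)) (Hil 1) (Hil r) :=
  HSplit lfst lsnd ip_sp fst_glu snd_glu.

Lemma unitary_glue0 a : glue unitary_split a 0 = mulop c1 a.
Proof.
have l2 : hlin (mulop c2) by exact: mulop_lin.
exact: (etrans (congr1 (fun y => mulop c1 a + y) (hlin0 l2)) (addr0 _)).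
Qed.

End Split.
End Thematic.

Lemma subsp_image (R : realType) (H K : hilb (R := R)) (f : H -> K) (A : set H) :
  hlin f -> subsp A -> subsp (f @` A).
Proof.
move=> lf [A0 hA]; split; first by exists 0 => //; exact: hlin0.
by move=> c _ _ [x Ax <-] [y Ay <-]; exists (c *: x + y); [exact: hA|exact: lf].
Qed.

Lemma closure_orth (R : realType) (H : hilb (R := R)) (A : set H) w z : hclosure A w ->
  (forall x, A x -> ip x z = 0) -> ip w z = 0.
Proof.
move=> cw h; apply: (@hclosed_orth R H z w) => e e0.
by have [a Aa wa] := cw e e0; exists a => //; exact: h.
Qed.

Section ThematicBlocks.
Context {R : realType}.
Local Notation C := R[i].
Local Notation mu := (circ R).
Local Notation T := (measurableTypeR R).

Lemma unitary_entry n (A : 'M[C]_n) i j : A \is unitarymx -> cn2 (A i j) <= 1.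
Proof.
move=> /unitarymxP /(congr1 (fun B : 'M[C]_n => complex.Re (B i i))).
rewrite mxE mxE eqxx /= => h.
have -> : 1 = \sum_k cn2 (A i k).
  rewrite -h raddf_sum; apply: eq_bigr => k _.
  by rewrite !mxE mulcJ.
rewrite (bigD1 j)//= lerDl; apply: sumr_ge0 => k _; exact: cn2_ge0.
Qed.

Lemma bmx_unitary n (U : R -> 'M[C]_n) : measurable_mx U ->
  {ae mu, forall t, U t \is unitarymx} -> bmx U.
Proof.
move=> mU hU; split=> //; exists 1; apply: aeS hU => t h i j; exact: unitary_entry.
Qed.

(** The sizes [p.+1 + q] and [1 + (p + q)] are convertible, so one and the same matrix can be read
    with its first column cut off. *)
Lemma block_row_col p q (v1 : 'cV[C]_p.+1) (v2 : 'cV[C]_q) (V : 'M[C]_(p.+1, p))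
    (W : 'M[C]_(q, p)) (S1 : 'M[C]_(p.+1, q)) (S2 : 'M[C]_q) :
  block_mx (row_mx v1 V) S1 (row_mx v2 W) S2 =
  row_mx (col_mx v1 v2) (row_mx (col_mx V W) (col_mx S1 S2)) :> 'M[C]_(p.+1 + q, 1 + (p + q)).
Proof.
rewrite block_mxEh -block_mxEv block_mxEh row_mxA.
have e : (1 + p + q)%N = (1 + (p + q))%N by [].
by rewrite (eq_irrelevance (esym (addnA 1 p q)) (erefl _)) castmx_id.
Qed.

Variables (p q : nat) (U : R -> 'M[C]_(p.+1 + q)).
Hypothesis tU : thematic U.

Lemma thematic_bmx : bmx U. Proof. by case: tU => mU uU _; exact: bmx_unitary. Qed.

Lemma thematic_unitary : {ae mu, forall t, U t \is unitarymx}. Proof. by case: tU. Qed.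

Lemma thematic_blocks : exists (v1 : R -> 'cV[C]_p.+1) (v2 : R -> 'cV[C]_q)
    (Vc : R -> 'M[C]_(p.+1, p)) (S1 : R -> 'M[C]_(p.+1, q)) (S2 : R -> 'M[C]_q),
  [/\ Hinf v1 /\ coouter_fun v1, bmx v2, inner_fun Vc /\ coouter_fun Vc,
    bmx S1 /\ bmx S2 & {ae mu, forall t, U t = row_mx (col_mx (v1 t) (v2 t))
      (row_mx (col_mx (conj_mx (Vc t)) 0) (col_mx (S1 t) (S2 t))) :> 'M[C]_(p.+1 + q, 1 + (p + q))}].
Proof.
have bU := thematic_bmx.
case: tU => _ _ [v1 [v2 [Vc [S1 [S2 [h1 h2 h3 hU]]]]]].
exists v1, v2, Vc, (fun t => ursubmx (U t)), (fun t => drsubmx (U t)); split=> //.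
- exact: Linf_bmx.
- have e1 t i j : ursubmx (U t) i j = U t (lshift q i) (rshift p.+1 j) by rewrite !mxE.
  have e2 t i j : drsubmx (U t) i j = U t (rshift p.+1 i) (rshift p.+1 j) by rewrite !mxE.
  by split; [exact: bmx_sub bU e1|exact: bmx_sub bU e2].
apply: aeS hU => t ->.
by rewrite block_mxKur block_mxKdr -block_row_col.
Qed.

End ThematicBlocks.

Section Blocks.
Context {R : realType}.
Local Notation C := R[i].
Local Notation mu := (circ R).

Lemma vip0 n (v : 'cV[C]_n) : adjmx v *m v = 0 -> v = 0.
Proof.
move=> h; apply: vn2_eq0.
by have := vip_self v; rewrite vipE h mxE => /(congr1 (@complex.Re R)).
Qed.

Lemma adj0_inj m n (A : 'M[C]_(m, n)) : adjmx A = 0 -> A = 0.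
Proof.
by move=> h; rewrite -[A]adjmxK h; apply/matrixP => i j; rewrite !mxE cj0.
Qed.

(** The columns of [V] are orthonormal and orthogonal to [v1 != 0], so with [v1] they form a basis
    of the space of columns of height [p.+1]. If [S2 w = 0], orthogonality to the first columns of
    the unitary matrix makes [S1 w] orthogonal to this basis, so the last columns kill [w] although
    they are isometric. *)
Lemma block_unitary_inj p q (v1 : 'cV[C]_p.+1) (v2 : 'cV[C]_q) (V : 'M[C]_(p.+1, p))
    (S1 : 'M[C]_(p.+1, q)) (S2 : 'M[C]_q) (w : 'cV[C]_q) :
  (row_mx (col_mx v1 v2) (row_mx (col_mx V 0) (col_mx S1 S2)) : 'M[C]_(p.+1 + q)) \is unitarymx ->
  v1 != 0 -> S2 *m w = 0 -> w = 0.
Proof.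
set c1 := col_mx v1 v2; set c2 := col_mx V 0; set c3 := col_mx S1 S2.
set U0 : 'M[C]_(p.+1 + q, 1 + (p + q)) := row_mx c1 (row_mx c2 c3).
move=> /unitarymxP uU v10 S2w.
have h1 : adjmx U0 *m U0 = 1%:M.
  have h0 : (U0 : 'M[C]_(p.+1 + q)) *m adjmx (U0 : 'M[C]_(p.+1 + q)) = 1%:M.
    by apply: etrans uU; congr (_ *m _).
  exact: mulmx1C h0.
have adjE m n1 n2 (A : 'M[C]_(m, n1)) (B : 'M[C]_(m, n2)) :
    adjmx (row_mx A B) = col_mx (adjmx A) (adjmx B).
  by rewrite /adjmx tr_row_mx /conj_mx map_col_mx.
have adjE2 m1 m2 n (A : 'M[C]_(m1, n)) (B : 'M[C]_(m2, n)) :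
    adjmx (col_mx A B) = row_mx (adjmx A) (adjmx B).
  by rewrite /adjmx tr_col_mx /conj_mx map_row_mx.
rewrite /U0 !adjE mul_col_row (mul_mx_row (adjmx c1)) mul_col_row [1%:M]scalar_mx_block in h1.
have [g11 g12 _ g2] := eq_block_mx h1.
rewrite -[0](row_mx0 _ 1 p q) in g12; have [g12a g13] := eq_row_mx g12.
rewrite [1%:M]scalar_mx_block in g2; have [g22 g23 _ g33] := eq_block_mx g2.
have adj0 m n : adjmx (0 : 'M[C]_(m, n)) = 0 by apply/matrixP => i j; rewrite !mxE cj0.
rewrite /c1 /c2 /c3 !adjE2 !mul_row_col ?adj0 ?mul0mx ?mulmx0 ?addr0 in g12a g13 g22 g23.
have g21 : adjmx V *m v1 = 0 by apply: adj0_inj; rewrite adjmxM adjmxK.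
have w1 : adjmx v1 *m (S1 *m w) = 0.
  have := congr1 (mulmx^~ w) g13; rewrite mulmxDl -!mulmxA S2w mulmx0 addr0 => ->.
  by rewrite mul0mx.
have w2 : adjmx V *m (S1 *m w) = 0 by rewrite mulmxA g23 mul0mx.
have d0 : (adjmx v1 *m v1) 0 0 != 0.
  apply/eqP => d0; case/eqP: v10; apply: vip0; apply/matrixP => i j.
  by rewrite !ord1 d0 mxE.
pose d := (adjmx v1 *m v1) 0 0.
(* A left inverse of the square matrix with columns [v1] and [V], hence also a right inverse. *)
pose N : 'M[C]_(1 + p, p.+1) := col_mx (d^-1 *: adjmx v1) (adjmx V).
have NM : N *m (row_mx v1 V : 'M[C]_(p.+1, 1 + p)) = 1%:M.
  rewrite mul_col_row -!scalemxAl g12a g21 g22 scaler0 [RHS]scalar_mx_block; congr block_mx.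
  by apply/matrixP => i j; rewrite !ord1 mxE [RHS]mxE; exact: mulVf.
have MN := mulmx1C (NM : (N : 'M[C]_p.+1) *m (row_mx v1 V : 'M[C]_p.+1) = 1%:M).
have Sw : S1 *m w = 0.
  rewrite -[S1 *m w]mul1mx -MN -mulmxA.
  have -> : N *m (S1 *m w) = 0.
    by rewrite /N mul_col_mx -scalemxAl w1 w2 scaler0 col_mx0.
  by rewrite mulmx0.
by rewrite -[w]mul1mx -g33 -mulmxA /c3 mul_col_mx Sw S2w col_mx0 mulmx0.
Qed.

Definition bot n1 n2 : Hil (R := R) (n1 + n2) -> Hil n2 := mulop (fun=> row_mx 0 1%:M).

Lemma lrep_top n1 n2 (x : Hil (n1 + n2)) : ae_eq_fun (lrep (top x)) (fun t : R => usubmx (lrep x t)).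
Proof.
apply: aeS (lrep_mulop x (bmx_cst (row_mx 1%:M 0 : 'M[C]_(n1, n1 + n2)))) => t h.
by apply: etrans h _; rewrite -[lrep x t]vsubmxK mul_row_col mul1mx mul0mx addr0 col_mxKu.
Qed.

Lemma lrep_bot n1 n2 (x : Hil (n1 + n2)) : ae_eq_fun (lrep (bot x)) (fun t : R => dsubmx (lrep x t)).
Proof.
apply: aeS (lrep_mulop x (bmx_cst (row_mx 0 1%:M : 'M[C]_(n2, n1 + n2)))) => t h.
by apply: etrans h _; rewrite -[lrep x t]vsubmxK mul_row_col mul1mx mul0mx add0r col_mxKd.
Qed.

Lemma top_bot0 n1 n2 (x : Hil (n1 + n2)) : top x = 0 -> bot x = 0 -> x = 0.
Proof.
move=> t0 b0; apply: lspaceP.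
have ht := lrep_top x; have hb := lrep_bot x; rewrite t0 in ht; rewrite b0 in hb.
apply: aeS (aeI (aeI (lrep0 (n1 + n2)) (aeI (lrep0 n1) (lrep0 n2))) (aeI ht hb)).
move=> t [[e0 [e1 e2]] [h1 h2]].
apply: etrans _ (esym e0); rewrite -[lrep x t]vsubmxK.
apply: etrans (congr2 col_mx (etrans (esym h1) e1) (etrans (esym h2) e2)) _.
exact: col_mx0.
Qed.

Lemma orth_hX n1 n2 (z : Hil (n1 + n2)) : (forall f, hX f -> ip z f = 0) ->
  hHm n1 (top z) /\ bot z = 0.
Proof.
move=> h; split.
  move=> F HF; apply: etrans (mulop_adj z F (bmx_cst _)) _; apply: h.
  have e : top (mulop (fun=> adjmx (row_mx 1%:M 0 : 'M[C]_(n1, n1 + n2))) F) = F.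
    apply: etrans (mulop_comp F (bmx_cst _) (bmx_cst _)) _.
    apply: mulop1; first exact: bmxM (bmx_cst _) (bmx_cst _).
    apply: ae_all => t; rewrite /adjmx tr_row_mx /conj_mx map_col_mx mul_row_col.
    by rewrite mul1mx mul0mx addr0 trmx1 map_mx1.
  exact: (eq_ind_r (hH2 n1) HF e).
suff h0 : ip (bot z) (bot z) = 0 by apply: nsq_eq0; rewrite /nsq h0.
apply: etrans (mulop_adj z (bot z) (bmx_cst _)) _; apply: h.
set G := bot z.
have e : top (mulop (fun=> adjmx (row_mx 0 1%:M : 'M[C]_(n2, n1 + n2))) G) = 0.
  apply: etrans (mulop_comp G (bmx_cst _) (bmx_cst _)) _.
  apply: mulop_0; first exact: bmxM (bmx_cst _) (bmx_cst _).
  apply: ae_all => t; rewrite /adjmx tr_row_mx /conj_mx map_col_mx mul_row_col.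
  by rewrite mul1mx mul0mx addr0 trmx0 map_mx0.
exact: (eq_ind_r (hH2 n1) (subsp0 (@subsp_hH2 R n1)) e).
Qed.

(** As [v^T] is outer, some [v^T f] is at distance less than 1 from the constant 1. It is a nonzero
    function in H2 that vanishes wherever [v] does. *)
Lemma coouter_nonzero n (v : R -> 'cV[C]_n) : coouter_fun v -> {ae mu, forall t, v t != 0}.
Proof.
move=> cv; have [Hv _] := cv; have bv := Linf_bmx Hv.1.
have Hek : hH2 1 (ek 0 ord0 : Hil (R := R) 1) by exact: ek_hH2.
have [_ [f Hf <-] hf] := outer_dense cv Hek ltr01.
have nz : mulop (fun t => (v t)^T) f != 0.
  apply/eqP => e0; move: hf; rewrite e0 subr0.
  by rewrite /nsq ip_ek_ek !eqxx /= ltxx.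
have Hg := Hinf_mul Hv Hf.
apply: aeS2 (hH2_nonzero Hg nz) (lrep_mulop f bv) => t h1 h2.
by apply: contraNneq h1 => v0; rewrite h2 v0 trmx0 mul0mx mxE.
Qed.

End Blocks.

(** * Thematic splittings of the domain *)

Section ThematicSplit.
Context {R : realType}.
Local Notation C := R[i].
Local Notation mu := (circ R).
Variables (p q : nat) (U : R -> 'M[C]_(p.+1 + q)).
Hypothesis tU : thematic U.

Definition tsplit : hsplit (Hil (p.+1 + q)) (Hil 1) (Hil (p + q)) :=
  @unitary_split R (p + q) U (thematic_bmx tU) (thematic_unitary tU).

Lemma tsplit_glue0 a : glue tsplit a 0 = mulop (fun t => lsubmx (U t : 'M[C]_(p.+1 + q, 1 + (p + q)))) a.
Proof.
exact: unitary_glue0.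
Qed.

(** By the zero block of a thematic function, the Hardy part of the second component is [Vc^T]
    applied to the Hardy part of [f], and [Vc^T] is analytic. *)
Lemma thematic_snd f : hX f -> hX (snd_part tsplit f).
Proof.
have [v1 [v2 [Vc [S1 [S2 [hv1 bv2 [[HVc iVc] cVc] [bS1 bS2] hU]]]]]] := thematic_blocks tU.
move=> Hf; have bVc := Linf_bmx HVc.1.
have HVt : Hinf (fun t => (Vc t)^T) by case: cVc.
have bVt := Linf_bmx HVt.1.
have h := Hinf_mul HVt Hf.
suff e : top (snd_part tsplit f) = mulop (fun t => (Vc t)^T) (top f).
  exact: (eq_ind_r (hH2 p) h e).
have e2 t i j : rsubmx (U t : 'M[C]_(p.+1 + q, 1 + (p + q))) i j = U t i (rshift 1 j) by rewrite mxE.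
have b2 := bmx_adj (bmx_sub (thematic_bmx tU) e2).
apply: etrans (mulop_comp f (bmx_cst _) b2) _.
apply: etrans _ (esym (mulop_comp f bVt (bmx_cst _))).
apply: mulop_eq; [exact: bmxM (bmx_cst _) b2|exact: bmxM bVt (bmx_cst _)|].
apply: aeS hU => t hUt.
have -> : rsubmx (U t : 'M[C]_(p.+1 + q, 1 + (p + q))) =
  row_mx (col_mx (conj_mx (Vc t)) 0) (col_mx (S1 t) (S2 t)) by rewrite hUt row_mxKr.
rewrite {1}/adjmx tr_row_mx /conj_mx map_col_mx mul_row_col mul1mx mul0mx addr0.
rewrite tr_col_mx map_row_mx trmx0 map_mx0 mul_mx_row mulmx1 mulmx0 map_trmx; congr row_mx.
by apply/matrixP => i j; rewrite !mxE cjK.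
Qed.

Let lsub := fun t => lsubmx (U t : 'M[C]_(p.+1 + q, 1 + (p + q))).
Let rsub := fun t => rsubmx (U t : 'M[C]_(p.+1 + q, 1 + (p + q))).

Let blsub : bmx lsub.
Proof.
have e t i j : lsub t i j = U t i (lshift (p + q) j) by rewrite mxE.
exact: bmx_sub (thematic_bmx tU) e.
Qed.

Let brsub : bmx rsub.
Proof.
have e t i j : rsub t i j = U t i (rshift 1 j) by rewrite mxE.
exact: bmx_sub (thematic_bmx tU) e.
Qed.

(* [v1 a] analytic implies [a] analytic because [v1] is co-outer. *)
Lemma thematic_glue a : hX (glue tsplit a 0) <-> hH2 1 a.
Proof.
have [v1 [v2 [Vc [S1 [S2 [[Hv1 cv1] bv2 _ _ hU]]]]]] := thematic_blocks tU.
have bv1 := Linf_bmx Hv1.1.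
have e : top (glue tsplit a 0) = mulop v1 a.
  apply: etrans (congr1 _ (tsplit_glue0 a)) _.
  apply: etrans (mulop_comp a (bmx_cst _) blsub) _.
  apply: mulop_eq; [exact: bmxM (bmx_cst _) blsub|exact: bv1|].
  apply: aeS hU => t hUt; rewrite /lsub hUt row_mxKl.
  by rewrite mul_row_col mul1mx mul0mx addr0.
suff h : hH2 p.+1 (mulop v1 a) <-> hH2 1 a by rewrite -e in h; exact: h.
split; last exact: Hinf_mul.
move=> H1; apply: hH2_orth => y /hHm_flip Hy.
have [Hvt _] := cv1; have bvt := Linf_bmx Hvt.1.
have cl := outer_dense cv1 Hy.
have e1 x y' : ip x (flip y') = ip y' (flip x) by rewrite -{1}(flipK x) ip_flip.
have -> : ip a y = ip (flip y) (flip a) by rewrite -e1 flipK.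
apply: closure_orth cl _ => _ [f Hf <-].
have e2 : flip (mulop (fun t => (v1 t)^T) f) = mulop (fun t => adjmx (v1 t)) (flip f).
  exact: flip_mulop.
rewrite -e1 e2.
have e3 : ip (mulop v1 a) (flip f) = 0.
  have hm : hHm p.+1 (flip f).
    exact: ((hHm_flip (flip f)).2 (eq_ind_r (hH2 p.+1) Hf (flipK f))).
  by rewrite ip_conj (hm _ H1) cj0.
exact: (etrans (esym (mulop_adj a (flip f) bv1)) e3).
Qed.

(** For [k] orthogonal to the image, [z], the last columns of [U] applied to [k], is orthogonal to
    [hX], hence has Hardy part in H2- and no other part. The lower rows give [S2 (bot k) = 0], so
    [bot k = 0]. Then [conj Vc (top k)] is in H2-, that is, [top k] is orthogonal to [Vc^T H2],
    which is dense because [Vc] is co-outer. *)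
Lemma thematic_dense h : hX h -> hclosure (snd_part tsplit @` @hX R p.+1 q) h.
Proof.
have [v1 [v2 [Vc [S1 [S2 [[Hv1 cv1] bv2 [[HVc iVc] cVc] [bS1 bS2] hU]]]]]] := thematic_blocks tU.
have bv1 := Linf_bmx Hv1.1; have bVc := Linf_bmx HVc.1; have bVb := bmx_conj bVc.
move: h; apply: dense_of_orth; [|exact: subsp_hX|exact: hclosed_hX| |].
- exact: subsp_image (snd_lin tsplit) (@subsp_hX R p.+1 q).
- by move=> _ [f Hf <-]; exact: thematic_snd.
move=> k Hk hk.
pose z : Hil (p.+1 + q) := mulop rsub k.
have zX f : hX f -> ip z f = 0.
  move=> Xf; apply: etrans (mulop_adj k f brsub) _.
  by apply: hk; exists f.
have [tz bz] := orth_hX zX.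
have bot0 : bot k = 0.
  apply: lspaceP.
  apply: aeS (aeI (aeI (lrep0 q) (lrep_bot k)) (aeI (aeI (coouter_nonzero cv1)
    (aeI hU (thematic_unitary tU))) (aeI (lrep_bot z) (lrep_mulop k brsub)))).
  move=> t [[e0 ek] [[v0 [hUt uUt]] [ebz ez]]].
  apply: etrans ek (etrans _ (esym e0)).
  rewrite hUt in uUt; apply: (block_unitary_inj uUt v0).
  have e3 : dsubmx (rsub t *m lrep k t) = 0.
    have e4 := etrans (congr1 (@dsubmx _ p.+1 q 1) (esym ez)) (esym ebz).
    by apply: etrans e4 _; rewrite bz; exact: e0.
  have e5 : rsub t = row_mx (col_mx (conj_mx (Vc t)) 0) (col_mx (S1 t) (S2 t)).
    by rewrite /rsub hUt row_mxKr.
  move: e3; rewrite e5 -[lrep k t]vsubmxK mul_row_col !mul_col_mx add_col_mx col_mxKd.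
  by rewrite mul0mx add0r col_mxKd.
have topz : top z = mulop (fun t => conj_mx (Vc t)) (top k).
  apply: lspaceP.
  apply: aeS (aeI (aeI (lrep0 q) (lrep_bot k)) (aeI (aeI (lrep_top z) hU)
    (aeI (aeI (lrep_mulop (top k) bVb) (lrep_top k)) (lrep_mulop k brsub)))).
  move=> t [[e0 ek] [[ez hUt] [[emk etk] ek2]]].
  apply: etrans ez (etrans _ (esym emk)).
  rewrite etk; apply: etrans (congr1 (@usubmx _ p.+1 q 1) ek2) _.
  have e5 : rsub t = row_mx (col_mx (conj_mx (Vc t)) 0) (col_mx (S1 t) (S2 t)).
    by rewrite /rsub hUt row_mxKr.
  have e6 : dsubmx (lrep k t) = 0.
    by apply: etrans (esym ek) _; rewrite bot0; exact: e0.
  rewrite e5 -[lrep k t]vsubmxK mul_row_col !mul_col_mx add_col_mx col_mxKu col_mxKu.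
  by rewrite e6 mulmx0 addr0.
have top0 : top k = 0.
  have [HVt _] := cVc; have bVt := Linf_bmx HVt.1.
  suff h0 : ip (top k) (top k) = 0 by apply: nsq_eq0; rewrite /nsq h0.
  apply: closure_orth (outer_dense cVc Hk) _ => _ [f Hf <-].
  apply: etrans (mulop_adj f (top k) bVt) _.
  have e7 : mulop (fun t => adjmx (Vc t)^T) (top k) = top z.
    rewrite topz; congr (mulop _ (top k)); apply/funext => t.
    by rewrite /adjmx trmxK.
  by rewrite e7 ip_conj tz// cj0.
exact: top_bot0.
Qed.

End ThematicSplit.

(** * Thematic splittings of the codomain *)

Section Cothematic.
Context {R : realType}.
Local Notation C := R[i].
Local Notation mu := (circ R).
Variables (p q : nat) (U : R -> 'M[C]_(p.+1 + q)).
Hypothesis tU : thematic U.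

(** For [U = W^T] this is [W^*]. The involution [flip] carries multiplication by [Uc] to
    multiplication by [U] and exchanges [hX] and [hY], which reduces every claim to [tsplit]. *)
Let Uc t : 'M[C]_(p.+1 + q) := conj_mx (U t).

Let bUc : bmx Uc. Proof. by apply: bmx_conj; exact: thematic_bmx. Qed.

Let uUc : {ae mu, forall t, Uc t \is unitarymx}.
Proof.
apply: aeS (thematic_unitary tU) => t /unitarymxP h; apply/unitarymxP.
have := congr1 (@conj_mx R _ _) h; rewrite /conj_mx map_mxM map_mx1 => e.
by rewrite -[RHS]e; congr (_ *m _); apply/matrixP => i j; rewrite !mxE.
Qed.

Definition csplit : hsplit (Hil (p.+1 + q)) (Hil 1) (Hil (p + q)) :=
  @unitary_split R (p + q) Uc bUc uUc.

Lemma csplit_snd y : snd_part csplit y = flip (snd_part (tsplit tU) (flip y)).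
Proof.
have e t i j : rsubmx (U t : 'M[C]_(p.+1 + q, 1 + (p + q))) i j = U t i (rshift 1 j) by rewrite mxE.
have b := bmx_adj (bmx_sub (thematic_bmx tU) e).
apply: etrans _ (esym (flip_mulop (flip y) b)); rewrite flipK.
congr (mulop _ y); apply/funext => t; apply/matrixP => i j.
by rewrite !mxE.
Qed.

Lemma csplit_glue0 a : glue csplit a 0 = flip (glue (tsplit tU) (flip a) 0).
Proof.
have e t i j : lsubmx (U t : 'M[C]_(p.+1 + q, 1 + (p + q))) i j = U t i (lshift (p + q) j) by rewrite mxE.
have b := bmx_sub (thematic_bmx tU) e.
rewrite tsplit_glue0; apply: etrans _ (esym (flip_mulop (flip a) b)); rewrite flipK.
apply: etrans (unitary_glue0 bUc uUc a) _.
congr (mulop _ a); apply/funext => t; apply/matrixP => i j.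
by rewrite !mxE.
Qed.

Lemma cothematic_snd y : hY y -> hY (snd_part csplit y).
Proof.
move=> /hY_flip h; rewrite csplit_snd; apply/hY_flip; rewrite flipK.
exact: thematic_snd.
Qed.

Lemma cothematic_glue a : hY (glue csplit a 0) <-> hHm 1 a.
Proof.
split=> [/hY_flip|h].
  by rewrite csplit_glue0 flipK => /thematic_glue h; apply/hHm_flip.
apply/hY_flip; rewrite csplit_glue0 flipK.
by apply/thematic_glue; apply/hHm_flip.
Qed.

Lemma cothematic_dense y : hY y -> hclosure (snd_part csplit @` @hY R p.+1 q) y.
Proof.
move=> /hY_flip h e e0; have [_ [f Hf <-] hf] := thematic_dense tU h e0.
exists (snd_part csplit (flip f)).
  by exists (flip f) => //; apply/hY_flip; rewrite flipK.
by rewrite csplit_snd flipK -{1}(flipK y) -flipB nsq_flip.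
Qed.

End Cothematic.

(** * One step of a thematic factorization *)

Section Step.
Context {R : realType}.
Local Notation C := R[i].
Local Notation mu := (circ R).
Variables (p q p' q' : nat) (V : R -> 'M[C]_(p.+1 + q)) (W : R -> 'M[C]_(p'.+1 + q')).
Hypotheses (tV : thematic V) (tW : thematic (fun x => (W x)^T)).
Variables (Phi : R -> 'M[C]_(p'.+1 + q', p.+1 + q)) (Phi1 : R -> 'M[C]_(p' + q', p + q)).
Variables (t : R) (u : R -> C).
Hypotheses (bPhi : bmx Phi) (bPhi1 : bmx Phi1) (uu : unimodular u).
Hypothesis PhiE : {ae mu, forall x, Phi x = adjmx (W x) *m
  (block_mx (t%:C%C *: (u x)%:M) 0 0 (Phi1 x) : 'M[C]_(1 + (p' + q'), 1 + (p + q))) *m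
  adjmx (V x)}.

Let s := tsplit tV.
Let s' := csplit tW.

Lemma mulopZ m n c (F : R -> 'M[C]_(m, n)) x : bmx F ->
  bmx (fun y => c *: F y) /\ c *: mulop F x = mulop (fun y => c *: F y) x.
Proof.
move=> bF; have bc : bmx (fun y => c *: F y).
  have := bmxM (bmx_cst c%:M) bF.
  by under eq_fun do rewrite mul_scalar_mx.
split=> //; apply: lspaceP.
apply: aeS (aeI (lrep_scale c (mulop F x)) (aeI (lrep_mulop x bF) (lrep_mulop x bc))).
move=> y [h1 [h2 h3]]; apply: etrans h1 (etrans _ (esym h3)).
by rewrite -scalemxAl; congr (c *: _).
Qed.

Let WPhi : {ae mu, forall x, W x *m Phi x =
  (block_mx (t%:C%C *: (u x)%:M) 0 0 (Phi1 x) : 'M[C]_(1 + (p' + q'), 1 + (p + q))) *m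
  adjmx (V x)}.
Proof.
apply: aeS2 PhiE (thematic_unitary tW) => x -> /unitarymxP h.
rewrite -mulmxA [LHS]mulmxA.
suff -> : W x *m adjmx (W x) = 1%:M by rewrite mul1mx.
have h1 := mulmx1C h; have := congr1 trmx h1; rewrite trmx_mul trmxK trmx1 => e.
rewrite -[RHS]e; congr (_ *m _); apply/matrixP => i j; by rewrite !mxE.
Qed.

Let Ffst f : fst_part s' (mulop Phi f) = t%:C%C *: smul u (fst_part s f).
Proof.
have e1 x i j : lsubmx (V x : 'M[C]_(p.+1 + q, 1 + (p + q))) i j = V x i (lshift (p + q) j) by rewrite mxE.
have b1 := bmx_adj (bmx_sub (thematic_bmx tV) e1).
have e2 x i j : lsubmx (conj_mx (W x)^T : 'M[C]_(p'.+1 + q', 1 + (p' + q'))) i j =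
  conj_mx (W x)^T i (lshift (p' + q') j) by rewrite mxE.
have b2 := bmx_adj (bmx_sub (bmx_conj (thematic_bmx tW)) e2).
have bu := bmx_unimodular 1 uu.
have [b3 e3] := mulopZ t%:C%C f (bmxM bu b1).
apply: etrans (mulop_comp f b2 bPhi) _.
apply: etrans _ (esym (congr1 (fun y => t%:C%C *: y) (mulop_comp f bu b1))).
apply: etrans _ (esym e3).
apply: mulop_eq => //; first exact: bmxM b2 bPhi.
apply: aeS WPhi => x hx.
have -> : adjmx (lsubmx (conj_mx (W x)^T : 'M[C]_(p'.+1 + q', 1 + (p' + q')))) =
    usubmx (W x : 'M[C]_(1 + (p' + q'), p'.+1 + q')).
  by apply/matrixP => i j; rewrite !mxE cjK.
have -> : usubmx (W x : 'M[C]_(1 + (p' + q'), p'.+1 + q')) *m Phi x =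
  usubmx (W x *m Phi x : 'M[C]_(1 + (p' + q'), p.+1 + q)) by rewrite mul_usub_mx.
rewrite hx -mul_usub_mx.
rewrite -[adjmx (V x)](@vsubmxK _ 1 (p + q)) /block_mx col_mxKu mul_row_col mul0mx addr0 -scalemxAl.
congr (_ *: (_ *m _)).
by apply/matrixP => i j; rewrite !mxE.
Qed.

Let Fsnd f : snd_part s' (mulop Phi f) = mulop Phi1 (snd_part s f).
Proof.
have e1 x i j : rsubmx (V x : 'M[C]_(p.+1 + q, 1 + (p + q))) i j = V x i (rshift 1 j) by rewrite mxE.
have b1 := bmx_adj (bmx_sub (thematic_bmx tV) e1).
have e2 x i j : rsubmx (conj_mx (W x)^T : 'M[C]_(p'.+1 + q', 1 + (p' + q'))) i j =
  conj_mx (W x)^T i (rshift 1 j) by rewrite mxE.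
have b2 := bmx_adj (bmx_sub (bmx_conj (thematic_bmx tW)) e2).
apply: etrans (mulop_comp f b2 bPhi) _.
apply: etrans _ (esym (mulop_comp f bPhi1 b1)).
apply: mulop_eq; [exact: bmxM b2 bPhi|exact: bmxM bPhi1 b1|].
apply: aeS WPhi => x hx.
have -> : adjmx (rsubmx (conj_mx (W x)^T : 'M[C]_(p'.+1 + q', 1 + (p' + q')))) =
    dsubmx (W x : 'M[C]_(1 + (p' + q'), p'.+1 + q')).
  by apply/matrixP => i j; rewrite !mxE cjK.
have -> : dsubmx (W x : 'M[C]_(1 + (p' + q'), p'.+1 + q')) *m Phi x =
  dsubmx (W x *m Phi x : 'M[C]_(1 + (p' + q'), p.+1 + q)) by rewrite mul_dsub_mx.
rewrite hx -mul_dsub_mx.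
rewrite -[adjmx (V x)](@vsubmxK _ 1 (p + q)) /block_mx col_mxKd mul_row_col mul0mx add0r.
congr (_ *m _).
by apply/matrixP => i j; rewrite !mxE.
Qed.

Hypothesis t0 : 0 < t.
Hypothesis Phi_le : {ae mu, forall x v, vn2 (Phi x *m v) <= t ^+ 2 * vn2 v}.
Hypothesis onto : forall a : Hil 1, exists c d, [/\ hH2 1 c, hHm 1 d & a = smul u c + d].

Let lu : hlin (@smul R 1 u). Proof. by apply: mulop_lin; exact: bmx_unimodular. Qed.

Let iu (a b : Hil 1) : ip (smul u a) (smul u b) = ip a b. Proof. exact: ip_smul. Qed.
Let lPhi : hlin (mulop Phi). Proof. exact: mulop_lin. Qed.
Let lPhi1 : hlin (mulop Phi1). Proof. exact: mulop_lin. Qed.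
Let Fle f : nsq (mulop Phi f) <= t ^+ 2 * nsq f. Proof. exact: nsq_mulop_le. Qed.

Lemma step_few tau2 : 0 <= tau2 < t ^+ 2 -> few_large (mulop Phi) (@hX R p.+1 q) (@hY R p'.+1 q') tau2 ->
  few_large (mulop Phi1) (@hX R p q) (@hY R p' q') tau2.
Proof.
exact: (few_large_reduce (@subsp_hX R p.+1 q) (@hclosed_hX R p.+1 q) (@subsp_hY R p'.+1 q')
  (@hclosed_hY R p'.+1 q') (@subsp_hY R p' q') (@hclosed_hY R p' q') lu iu lPhi1 Ffst Fsnd
  t0 Fle (thematic_glue tV) (@thematic_dense R p q V tV)
  (cothematic_glue tW) (@cothematic_dense R p' q' _ tW) onto).
Qed.

Lemma step_dim tau2 Z k m : 0 <= tau2 < t ^+ 2 ->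
  few_large (mulop Phi) (@hX R p.+1 q) (@hY R p'.+1 q') tau2 -> uniq Z -> t \in Z ->
  dimH (toeplitz_ker u) k ->
  dimH (spectral_part (mulop Phi1) (@hX R p q) (@hY R p' q') Z) m ->
  dimH (spectral_part (mulop Phi) (@hX R p.+1 q) (@hY R p'.+1 q') Z) (k + m).
Proof.
exact: (spectral_part_dim (@subsp_hX R p.+1 q) (@hclosed_hX R p.+1 q) (@subsp_hY R p'.+1 q')
  (@hclosed_hY R p'.+1 q') lu iu lPhi lPhi1 Ffst Fsnd
  t0 Fle (@thematic_snd R p q V tV) (thematic_glue tV) (@thematic_dense R p q V tV)
  (@cothematic_snd R p' q' _ tW) (cothematic_glue tW) (@cothematic_dense R p' q' _ tW) onto).
Qed.

End Step.

(** * Block matrices with cast sizes *)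

Section BlockCast.
Variable A : pzRingType.

Lemma cast_block_shift (j r N r' N' : nat) (j' : nat) (d : 'M[A]_1) (M : 'M[A]_(j, j'))
    (B : 'M[A]_(r, r')) (e : (j.+1 + r = 1 + N)%N) (e' : (j'.+1 + r' = 1 + N')%N)
    (f : (j + r = N)%N) (f' : (j' + r' = N')%N) :
  castmx (e, e') (block_mx (block_mx d 0 0 M : 'M[A]_(j.+1, j'.+1)) 0 0 B) =
  block_mx d 0 0 (castmx (f, f') (block_mx M 0 0 B)).
Proof.
subst N N'; rewrite (eq_irrelevance e (erefl _)) (eq_irrelevance e' (erefl _)) !castmx_id.
have := @block_mxA A 1 j r 1 j' r' d 0 0 0 M 0 0 0 B; cbv zeta.
rewrite !row_mx0 !col_mx0 => h; apply/esym; apply: etrans h _; exact: castmx_id.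
Qed.

Lemma scalar_block_shift j : (1%:M : 'M[A]_(j.+1)) = block_mx (1%:M : 'M[_]_1) 0 0 (1%:M : 'M[_]_j) :> 'M[A]_(1 + j).
Proof. exact: (@scalar_mx_block _ 1 j 1). Qed.

Lemma block0 (r r' : nat) (B : 'M[A]_(r, r')) : block_mx (0 : 'M[A]_(0, 0)) 0 0 B = B.
Proof. by rewrite /block_mx col_flat_mx row_thin_mx. Qed.

Lemma diag_shift d (a : 'I_d.+1 -> A) :
  diag_mx (\row_j a j) = block_mx (a ord0)%:M 0 0 (diag_mx (\row_j a (lift ord0 j))) :> 'M[A]_(1 + d).
Proof.
have neq (i : 'I_1) (j : 'I_d) : (lshift d i == rshift 1 j) = false.
  by apply/eqP => /(congr1 val) /=; have := ltn_ord i; lia.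
apply/matrixP => i j; rewrite [LHS]mxE mxE.
case: (@split_ordP 1 d i) => i' ->; case: (@split_ordP 1 d j) => j' ->.
- by rewrite block_mxEul mxE !ord1 !eqxx; congr (a _ *+ _); apply: val_inj.
- rewrite block_mxEur mxE; exact: (congr1 (GRing.natmul _) (congr1 nat_of_bool (neq i' j'))).
- rewrite block_mxEdl mxE eq_sym; exact: (congr1 (GRing.natmul _) (congr1 nat_of_bool (neq j' i'))).
rewrite block_mxEdr !mxE; by congr (a _ *+ _); exact: val_inj.
Qed.

Lemma prod_block d N (F : 'I_d -> 'M[A]_N) :
  \prod_(j < d) (block_mx (1%:M : 'M[_]_1) 0 0 (F j) : 'M[A]_(1 + N)) =
  block_mx 1%:M 0 0 (\prod_(j < d) F j).
Proof.
elim: d F => [|d IH] F; first by rewrite !big_ord0; exact: scalar_block_shift.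
rewrite !big_ord_recl IH -!mulmxE mulmx_block.
by rewrite !mulmx0 !mul0mx mulmx1 !addr0 !add0r.
Qed.

Lemma block1_mul m n (c : 'M[A]_1) (P : 'M[A]_m) (D : 'M[A]_(m, n)) (Q : 'M[A]_n) :
  block_mx (1%:M : 'M[_]_1) 0 0 P *m block_mx c 0 0 D *m block_mx (1%:M : 'M[_]_1) 0 0 Q =
  block_mx c 0 0 (P *m D *m Q).
Proof.
by rewrite !mulmx_block !(mulmx0, mul0mx, mul1mx, mulmx1, addr0, add0r).
Qed.

End BlockCast.

Section FactorShift.
Context {R : realType}.
Local Notation C := R[i].

Lemma thematic_factor0 n1 n2 (V : R -> 'M[C]_(n1.+1 + n2)) : thematic_factor 0 V ->
  exists2 B : R -> 'M[C]_(n1.+1 + n2), thematic B & ae_eq_fun V B.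
Proof.
move=> [p [e [B [tB VB]]]]; have ep : p = n1 by lia.
subst p; exists B => //; apply: aeS VB => x ->.
by rewrite (eq_irrelevance e (erefl _)) castmx_id (_ : 1%:M = 0 :> 'M[C]_0) ?block0 //; apply/matrixP => -[].
Qed.

Lemma thematic_factorS n1 n2 j (V : R -> 'M[C]_(n1.+1 + n2)) : thematic_factor j.+1 V ->
  exists2 V' : R -> 'M[C]_(n1 + n2), thematic_factor j V' &
    ae_eq_fun V (fun x => block_mx (1%:M : 'M[_]_1) 0 0 (V' x) : 'M[C]_(1 + (n1 + n2))).
Proof.
move=> [p [e [B [tB VB]]]]; have e' : (j + (p.+1 + n2) = n1 + n2)%N by lia.
exists (fun x => castmx (e', e') (block_mx 1%:M 0 0 (B x))).
  by exists p, e', B; split=> //; exact: ae_eq_funP.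
apply: aeS VB => x ->; rewrite scalar_block_shift.
exact: cast_block_shift.
Qed.

End FactorShift.

(** * Thematic factorizations as a recursion *)

Section Factors.
Context {R : realType}.
Local Notation C := R[i].
Local Notation mu := (circ R).
Variables (m2 n2 : nat).

(** The sizes of the successive quotients change, so the factorization is unrolled into a predicate
    that consumes one Hardy component on each side per step. Of the Toeplitz operator it retains
    only surjectivity, as a decomposition of L2, and the kernel dimension. The recursion ends when
    one side has no Hardy component left. *)
Inductive factors : forall m1 n1, (R -> 'M[C]_(m1 + m2, n1 + n2)) -> seq (R * nat) -> Prop :=
| Factors_nil m1 n1 (Phi : R -> 'M[C]_(m1 + m2, n1 + n2)) :
    bmx Phi -> m1 = 0%N \/ n1 = 0%N -> factors Phi [::]
| Factors_cons p' p (Phi : R -> 'M[C]_(p'.+1 + m2, p.+1 + n2)) (Phi1 : R -> 'M[C]_(p' + m2, p + n2))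
    (V : R -> 'M[C]_(p.+1 + n2)) (W : R -> 'M[C]_(p'.+1 + m2)) (t : R) (u : R -> C) k L :
    bmx Phi -> bmx Phi1 -> thematic V -> thematic (fun x => (W x)^T) -> unimodular u ->
    (t != 0 -> (forall a : Hil 1, exists c d, [/\ hH2 1 c, hHm 1 d & a = smul u c + d]) /\
      dimH (toeplitz_ker u) k) ->
    {ae mu, forall x, Phi x = adjmx (W x) *m
      (block_mx (t%:C%C *: (u x)%:M) 0 0 (Phi1 x) : 'M[C]_(1 + (p' + m2), 1 + (p + n2))) *m
      adjmx (V x)} ->
    factors Phi1 L -> factors Phi ((t, k) :: L).

Lemma adj_block1 N (A : 'M[C]_N) : adjmx (block_mx (1%:M : 'M[_]_1) 0 0 A) = block_mx 1%:M 0 0 (adjmx A).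
Proof.
by rewrite /adjmx tr_block_mx /conj_mx map_block_mx !trmx0 trmx1 !map_mx0 map_mx1.
Qed.

Lemma unitary_tr n (A : 'M[C]_n) : A^T \is unitarymx -> A *m adjmx A = 1%:M.
Proof.
move=> /unitarymxP h; have h1 := mulmx1C h.
have := congr1 trmx h1; rewrite trmx_mul trmxK trmx1 => e.
by rewrite -[RHS]e; congr (_ *m _); apply/matrixP => i j; rewrite !mxE.
Qed.

Lemma unitary_adj n (A : 'M[C]_n) : A \is unitarymx -> adjmx A *m A = 1%:M.
Proof.
move=> /unitarymxP h; have h1 := mulmx1C h.
by rewrite -[RHS]h1; congr (_ *m _).
Qed.

(** The factors with positive index are the identity on the first coordinate, so after [W_0] and
    [V_0] are removed the others form a factorization of the same shape, smaller by one. The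
    condition [d = m1] or [d = n1] brings the recursion to its end. *)
Lemma factors_of d : forall m1 n1 (Phi : R -> 'M[C]_(m1 + m2, n1 + n2))
    (t : 'I_d -> R) (u : 'I_d -> R -> C) (k : 'I_d -> nat)
    (W : 'I_d -> R -> 'M[C]_(m1 + m2)) (V : 'I_d -> R -> 'M[C]_(n1 + n2)) r r'
    (em : (d + r = m1 + m2)%N) (en : (d + r' = n1 + n2)%N) (S : R -> 'M[C]_(r, r')),
  bmx Phi -> (d <= m1)%N -> (d <= n1)%N -> d = m1 \/ d = n1 ->
  (forall j, unimodular (u j)) ->
  (forall j, t j != 0 ->
    (forall a : Hil 1, exists c d, [/\ hH2 1 c, hHm 1 d & a = smul (u j) c + d]) /\
    dimH (toeplitz_ker (u j)) (k j)) ->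
  (forall j : 'I_d, thematic_factor j (V j)) ->
  (forall j : 'I_d, thematic_factor j (fun x => (W j x)^T)) ->
  {ae mu, forall x, Phi x = (\prod_(j < d) adjmx (W j x)) *m
    castmx (em, en) (block_mx (diag_mx (\row_j ((t j)%:C%C * u j x))) 0 0 (S x)) *m
    (\prod_(j < d) adjmx (V (rev_ord j) x))} ->
  factors Phi [seq (t j, k j) | j <- enum 'I_d].
Proof.
elim: d => [|d IH] m1 n1 Phi t u k W V r r' em en S bPhi dm dn dmn uu hk hV hW hPhi.
  by rewrite (size0nil (size_enum_ord 0)) /=; apply: Factors_nil => //; case: dmn => <-; [left|right].
case: m1 n1 Phi W V em en bPhi dm dn dmn hV hW hPhi => [|p'] [|p] Phi W V em en bPhi dm dn dmn hV hW hPhi; try by [].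
have [BV tBV VB] := thematic_factor0 (hV ord0).
have [BW tBW WB] := thematic_factor0 (hW ord0).
have /choice[V' hV'] (j : 'I_d) : exists V' : R -> 'M[C]_(p + n2), thematic_factor j V' /\
    ae_eq_fun (V (lift ord0 j)) (fun x => block_mx (1%:M : 'M[_]_1) 0 0 (V' x) : 'M[C]_(1 + (p + n2))).
  have h := hV (lift ord0 j); rewrite lift0 in h; have [X h1 h2] := thematic_factorS h.
  by exists X.
have /choice[W' hW'] (j : 'I_d) : exists W' : R -> 'M[C]_(p' + m2), thematic_factor j W' /\
    ae_eq_fun (fun x => (W (lift ord0 j) x)^T) (fun x => block_mx (1%:M : 'M[_]_1) 0 0 (W' x) : 'M[C]_(1 + (p' + m2))).
  have h := hW (lift ord0 j); rewrite lift0 in h; have [X h1 h2] := thematic_factorS h.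
  by exists X.
have bBV := thematic_bmx tBV; have bBW := bmx_tr (thematic_bmx tBW).
have em' : (d + r = p' + m2)%N by lia.
have en' : (d + r' = p + n2)%N by lia.
pose P x := \prod_(j < d) adjmx (W' j x)^T.
pose Q x := \prod_(j < d) adjmx (V' (rev_ord j) x).
pose D' x : 'M[C]_(p' + m2, p + n2) := castmx (em', en') (block_mx
  (diag_mx (\row_j ((t (lift ord0 j))%:C%C * u (lift ord0 j) x))) 0 0 (S x)).
have key : {ae mu, forall x, Phi x = adjmx (BW x)^T *m
    (block_mx ((t ord0)%:C%C *: (u ord0 x)%:M) 0 0 (P x *m D' x *m Q x) :
      'M[C]_(1 + (p' + m2), 1 + (p + n2))) *m adjmx (BV x)}.
  have hV'' := ae_forall_fin (fun j => (hV' j).2).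
  have hW'' := ae_forall_fin (fun j => (hW' j).2).
  apply: aeS (aeI (aeI hPhi (aeI VB WB)) (aeI hV'' hW'')) => x [[-> [VBx WBx]] [Vx Wx]].
  have -> : \prod_(j < d.+1) adjmx (W j x) = adjmx (BW x)^T *m
      (block_mx (1%:M : 'M[_]_1) 0 0 (P x) : 'M[C]_(1 + (p' + m2))).
    rewrite big_ord_recl -mulmxE -WBx trmxK; congr (_ *m _).
    rewrite -prod_block; apply: eq_bigr => j _.
    rewrite -adj_block1 -[W _ x]trmxK Wx; congr adjmx.
    have e (X : 'M[C]_(p' + m2)) : (block_mx (1%:M : 'M[_]_1) 0 0 X)^T = block_mx 1%:M 0 0 X^T.
      by rewrite tr_block_mx !trmx0 trmx1.
    exact: e.
  have -> : \prod_(j < d.+1) adjmx (V (rev_ord j) x) =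
      (block_mx (1%:M : 'M[_]_1) 0 0 (Q x) : 'M[C]_(1 + (p + n2))) *m adjmx (BV x).
    (* With the index reversed, [V_0^*] is the last factor of the product. *)
    rewrite big_ord_recr /= -mulmxE; congr (_ *m _); last first.
      by rewrite (_ : rev_ord ord_max = ord0) ?VBx//; apply: val_inj; rewrite /= subnn.
    rewrite -prod_block; apply: eq_bigr => j _.
    rewrite -adj_block1 -Vx; congr (adjmx (V _ x)); apply: val_inj => /=.
    by rewrite /fintype.bump leq0n add1n subSS subnSK.
  rewrite diag_shift (cast_block_shift _ _ _ em en em' en') -/(D' x).
  rewrite -!mulmxA; congr (_ *m _); rewrite !mulmxA; congr (_ *m _).
  rewrite scale_scalar_mx; exact: block1_mul.
(* Read off from [W Phi V], the quotient is bounded because [Phi] and the two unitary factors are;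
   almost everywhere it equals the remaining product. *)
pose Phi1 x : 'M[C]_(p' + m2, p + n2) :=
  drsubmx ((BW x)^T *m Phi x *m BV x : 'M[C]_(1 + (p' + m2), 1 + (p + n2))).
have bPhi1 : bmx Phi1.
  have b := bmxM (bmxM bBW bPhi) bBV.
  have e x i j : Phi1 x i j = ((BW x)^T *m Phi x *m BV x) (rshift 1 i) (rshift 1 j).
    by rewrite /Phi1 !mxE.
  exact: bmx_sub b e.
have Phi1E : ae_eq_fun Phi1 (fun x => P x *m D' x *m Q x).
  apply: aeS (aeI key (aeI (thematic_unitary tBV) (thematic_unitary tBW))) => x [Px [uV uW]].
  have hv := unitary_adj uV.
  have hw : (BW x)^T *m adjmx (BW x)^T = 1%:M by apply: unitary_tr; rewrite trmxK.
  rewrite /Phi1 Px -!mulmxA hv mulmx1 mulmxA hw mul1mx.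
  exact: block_mxKdr.
rewrite enum_ordSl /= -map_comp.
apply: (Factors_cons (W := fun x => (BW x)^T) bPhi bPhi1 tBV _ (uu ord0) (hk ord0)).
- by under eq_fun do rewrite trmxK.
- by apply: aeS2 key Phi1E => x -> ->.
apply: (IH _ _ Phi1 (t \o lift ord0) (u \o lift ord0) (k \o lift ord0) (fun j x => (W' j x)^T)
   V' _ _ em' en' S) => //.
- by case: dmn => [[->]|[->]]; [left|right].
- by move=> j; exact: uu.
- by move=> j; exact: hk.
- by move=> j; case: (hV' j).
by move=> j; under eq_fun do rewrite trmxK; case: (hW' j).
Qed.

End Factors.

(** * Superoptimal singular values *)

Section LowerBounds.
Context {R : realType}.
Local Notation C := R[i].
Local Notation mu := (circ R).

(* By the min-max principle this amounts to [sqrt c <= sval_mx j A]. *)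
Definition lowb m n j (A : 'M[C]_(m, n)) (c : R) := exists G : 'M[C]_(n, j.+1),
  (forall w, vn2 (G *m w) = vn2 w) /\ forall w, c * vn2 w <= vn2 (A *m (G *m w)).

Lemma vn2_gt0 n (v : 'cV[C]_n) : v != 0 -> 0 < vn2 v.
Proof.
by move=> v0; rewrite lt_def vn2_ge0 andbT; apply: contraNneq v0 => /vn2_eq0 ->.
Qed.

(** If [B] has rank at most [j], then [B G], which has [j + 1] columns, kills some [w != 0], and at
    [G w] the matrices [A - B] and [A] agree. *)
Lemma lowb_sval m n j (A : 'M[C]_(m, n)) c : 0 <= c -> lowb j A c -> c <= sval_mx j A ^+ 2.
Proof.
move=> c0 [G [iG hG]].
suff h : Num.sqrt c <= sval_mx j A.
  rewrite -[c]sqr_sqrtr//; apply: lerXn2r => //; rewrite nnegrE ?sqrtr_ge0//.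
  exact: le_trans (sqrtr_ge0 c) h.
apply: lb_le_inf; first by exists (opnorm (A - 0)); exists 0; rewrite /= ?mxrank0.
move=> _ [B /= rB <-].
have rj : (\rank B < j.+1)%N by [].
have [x x0 hx] := row_kernel (row_base B *m G)^T rj.
pose w := x^T.
have w0 : w != 0 by apply: contraNneq x0 => /(congr1 trmx); rewrite /w trmxK trmx0 => ->.
have BGw : B *m (G *m w) = 0.
  rewrite -(mulmx_base B) -mulmxA [X in _ *m X]mulmxA.
  by rewrite -[row_base B *m G *m w]trmxK trmx_mul /w trmxK hx trmx0 mulmx0.
have h1 : c * vn2 w <= opnorm (A - B) ^+ 2 * vn2 w.
  apply: le_trans (hG w) _; rewrite -[in leRHS](iG w).
  have -> : A *m (G *m w) = (A - B) *m (G *m w) by rewrite mulmxBl BGw subr0.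
  exact: opnorm_vn2.
rewrite ler_pM2r ?vn2_gt0// in h1.
rewrite -[opnorm _]ger0_norm ?opnorm_ge0// -sqrtr_sqr; exact: ler_wsqrtr.
Qed.

Lemma lowb0 m n (A : 'M[C]_(m, n)) (v : 'cV[C]_n) : v != 0 -> lowb 0 A (vn2 (A *m v) / vn2 v).
Proof.
move=> v0; have p := vn2_gt0 v0; pose a := (Num.sqrt (vn2 v))^-1.
have a2 : cn2 a%:C%C = (vn2 v)^-1.
  by rewrite /cn2 /= expr0n addr0 exprVn sqr_sqrtr ?vn2_ge0.
have e (B : 'cV[C]_n) (w : 'cV[C]_1) : B *m w = w 0 0 *: B.
  by apply/matrixP => i k; rewrite ord1 !mxE big_ord1 mulrC.
have vw (w : 'cV[C]_1) : vn2 w = cn2 (w 0 0) by rewrite /vn2 big_ord1.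
exists (a%:C%C *: v); split=> w; rewrite e.
  by rewrite !vn2Z a2 vw mulVf ?mulr1// gt_eqF.
by rewrite -!scalemxAr !vn2Z a2 vw mulrC [_ / _]mulrC.
Qed.

Lemma lowb_le m n j (A : 'M[C]_(m, n)) c : lowb j A c -> lowb 0 A c.
Proof.
move=> [G [iG hG]]; pose E : 'M[C]_(j.+1, 1) := delta_mx ord0 0.
have iE (w : 'cV[C]_1) : vn2 (E *m w) = vn2 w.
  apply: vn2_unitary; apply/matrixP => i k; rewrite !ord1 !mxE (bigD1 ord0)//= big1.
    by rewrite !mxE /= cj1 mulr1 addr0.
  by move=> l /negPf l0; rewrite !mxE l0 /= cj0 mul0r.
exists (G *m E); split=> w; rewrite -!mulmxA; first by rewrite iG iE.
by rewrite -(iE w).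
Qed.

Section Step.
Variables (m n : nat) (A : 'M[C]_(1 + m, 1 + n)) (A1 : 'M[C]_(m, n)).
Variables (W : 'M[C]_(1 + m)) (V : 'M[C]_(1 + n)) (t : R) (u : C).
Hypotheses (uW : W^T \is unitarymx) (uV : V \is unitarymx) (u1 : cn2 u = 1).
Hypothesis AE : A = adjmx W *m block_mx (t%:C%C *: u%:M) 0 0 A1 *m adjmx V.

Let vW w : vn2 (adjmx W *m w) = vn2 w.
Proof. by apply: vn2_unitary; rewrite adjmxK; exact: unitary_tr. Qed.

Let vV w : vn2 (V *m w) = vn2 w.
Proof. by apply: vn2_unitary; exact: unitary_adj. Qed.

Let AV (a : 'cV[C]_1) (b : 'cV[C]_n) :
  vn2 (A *m (V *m col_mx a b)) = t ^+ 2 * vn2 a + vn2 (A1 *m b).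
Proof.
rewrite AE -!mulmxA [adjmx V *m _]mulmxA (unitary_adj uV) mul1mx vW mul_block_col.
rewrite !mul0mx addr0 add0r vn2_split col_mxKu col_mxKd; congr (_ + _).
rewrite -scalemxAl mul_scalar_mx !vn2Z u1 mul1r; congr (_ * _).
by rewrite /cn2 /= expr0n addr0.
Qed.

Lemma lowb_embed j c : lowb j A1 c -> lowb j A c.
Proof.
move=> [G [iG hG]]; exists (V *m col_mx 0 G); split=> w.
  by rewrite -mulmxA vV mul_col_mx mul0mx vn2_split col_mxKu col_mxKd vn20 add0r.
by rewrite -[V *m _ *m w]mulmxA mul_col_mx AV mul0mx vn20 mulr0 add0r.
Qed.

(** The subspace is enlarged by the first column of [V], which [A] stretches by the modulus of [t],
    and whose image is orthogonal to the images of the other columns. *)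
Lemma lowb_succ j c : c <= t ^+ 2 -> lowb j A1 c -> lowb j.+1 A c.
Proof.
move=> ct [G [iG hG]]; pose G' : 'M[C]_(1 + n, 1 + j.+1) := block_mx 1%:M 0 0 G.
have GE (w : 'cV[C]_(1 + j.+1)) : G' *m w = col_mx (usubmx w) (G *m dsubmx w).
  by rewrite -{1}[w]vsubmxK mul_block_col !mul0mx mul1mx addr0 add0r.
exists (V *m G'); split=> w.
  by rewrite -mulmxA vV GE vn2_split col_mxKu col_mxKd iG -vn2_split.
rewrite -[V *m _ *m w]mulmxA GE AV (@vn2_split _ 1 j.+1 w) mulrDr lerD//.
by rewrite ler_wpM2r// vn2_ge0.
Qed.

End Step.

(** The bound of the [j]-th singular value of [Phi] by the [j]-th entry of [T], in terms of [lowb],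
    for which it passes to the quotients by exhibiting subspaces. *)
Definition good_bounds m n (Phi : R -> 'M[C]_(m, n)) (T : seq R) := forall j, (j < size T)%N ->
  {ae mu, forall x c, 0 <= c -> lowb j (Phi x) c -> c <= T`_j ^+ 2}.

Lemma good_bounds_le m n (Phi : R -> 'M[C]_(m, n)) t T : good_bounds Phi (t :: T) ->
  {ae mu, forall x v, vn2 (Phi x *m v) <= t ^+ 2 * vn2 v}.
Proof.
move=> /(_ 0%N erefl); apply: aeS => x h v.
have [->|v0] := eqVneq v 0; first by rewrite mulmx0 !vn20 mulr0.
have p := vn2_gt0 v0.
rewrite -ler_pdivrMr//; apply: h; last exact: lowb0.
by rewrite divr_ge0 ?vn2_ge0.
Qed.

(** A lower bound [c] for [Phi1] at [j] is one for [Phi] at 0, so [c <= t ^+ 2]. The first column of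
    [V] may therefore be added to the subspace, which makes [c] a lower bound for [Phi] at
    [j.+1]. *)
Lemma good_bounds_step m n (Phi : R -> 'M[C]_(1 + m, 1 + n)) (Phi1 : R -> 'M[C]_(m, n))
    (W : R -> 'M[C]_(1 + m)) (V : R -> 'M[C]_(1 + n)) t u T :
  {ae mu, forall x, (W x)^T \is unitarymx} -> {ae mu, forall x, V x \is unitarymx} ->
  unimodular u ->
  {ae mu, forall x, Phi x = adjmx (W x) *m
    block_mx (t%:C%C *: (u x)%:M) 0 0 (Phi1 x) *m adjmx (V x)} ->
  good_bounds Phi (t :: T) -> good_bounds Phi1 T.
Proof.
move=> uW uV uu PhiE hT j jT.
have h0 := hT 0%N erefl; have h1 := hT j.+1 jT.
apply: aeS (aeI (aeI uW uV) (aeI (aeI (unimodular_cn2 uu) PhiE) (aeI h0 h1))).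
move=> x [[uWx uVx] [[ux PhiEx] [b0 b1]]] c c0 hc.
apply: b1 => //; apply: (lowb_succ uWx uVx ux PhiEx) => //.
by apply: b0 => //; apply: lowb_le; exact: (lowb_embed uWx uVx ux PhiEx hc).
Qed.

End LowerBounds.

(** * The values attained by a superoptimal symbol *)

Section Superoptimal.
Context {R : realType}.
Local Notation C := R[i].
Local Notation mu := (circ R).

Lemma ae_exists (P : R -> Prop) : {ae mu, forall x, P x} -> exists x, P x.
Proof.
move=> h; apply: contrapT => np.
have h0 : mu.-negligible (setT : set (measurableTypeR R)).
  by apply: negligibleS h => x _ Px; apply: np; exists x.
have h1 := measure_negligible (measurableT : measurable (setT : set (measurableTypeR R))) h0.
have := etrans (esym (@circ_setT R)) h1.
by move=> /eqP; rewrite onee_eq0.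
Qed.

Lemma sval_mx_ge0 m n j (A : 'M[C]_(m, n)) : 0 <= sval_mx j A.
Proof.
apply: lb_le_inf; first by exists (opnorm (A - 0)); exists 0; rewrite /= ?mxrank0.
by move=> _ [B _ <-]; exact: opnorm_ge0.
Qed.

Lemma sval_mx_le m n j (A : 'M[C]_(m, n)) : sval_mx j.+1 A <= sval_mx j A.
Proof.
apply: lb_le_inf; first by exists (opnorm (A - 0)); exists 0; rewrite /= ?mxrank0.
move=> _ [B rB <-]; apply: ge_inf.
  by exists 0 => _ [D _ <-]; exact: opnorm_ge0.
by exists B => //=; exact: leqW.
Qed.

Lemma sval_mx0 m n (A : 'M[C]_(m, n)) : sval_mx 0 A = opnorm A.
Proof.
rewrite /sval_mx (_ : [set _ | _ in _] = [set opnorm A]) ?inf1//.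
apply/seteqP; split=> [_ [B /= rB <-]|_ ->]; last first.
  by exists 0 => /=; [rewrite mxrank0|rewrite subr0].
by move: rB; rewrite leqn0 mxrank_eq0 => /eqP ->; rewrite subr0.
Qed.

Lemma sub_block0 m1 m2 n1 n2 (Phi : R -> 'M[C]_(m1 + m2, n1 + n2)) :
  sub_block Phi (fun=> 0) = Phi.
Proof. by apply/funext => x; rewrite /sub_block subr0 submxK. Qed.

Section Values.
Variables (m1 m2 n1 n2 : nat) (Phi : R -> 'M[C]_(m1 + m2, n1 + n2)).

Lemma Omega_le i j : (i <= j)%N -> Omega Phi j `<=` Omega Phi i.
Proof.
by elim: j => [|j IH]; [rewrite leqn0 => /eqP ->|rewrite leq_eqVlt => /orP[/eqP ->//|/IH h Q [/h]]].
Qed.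

(** All minimizers in [Omega_j] give the same value, and the zero function is one of them. The case
    [j = 0] also identifies the operator norm with the singular value of index 0. *)
Lemma superopt_sval_symbol j t : Omega Phi j (fun=> 0) -> superopt_sval Phi j t ->
  ess_sval j Phi = t%:E.
Proof.
move=> O0 [Q OQ <-]; rewrite -[in LHS](sub_block0 Phi); apply/eqP; rewrite eq_le.
have e (Q' : R -> 'M[C]_(m1, n1)) : ess_norm_mx (sub_block Phi Q') = ess_sval 0 (sub_block Phi Q').
  by rewrite /ess_norm_mx /ess_sval; congr ess_sup; apply/funext => x; rewrite sval_mx0.
case: j O0 OQ => [|j] [S0 h0] [SQ hQ].
  by rewrite -(e (fun=> 0)) -(e Q); apply/andP; split; [exact: h0 _ SQ|exact: hQ _ S0].
by apply/andP; split; [exact: h0 _ SQ|exact: hQ _ S0].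
Qed.

Lemma ess_sval_ae j t : ess_sval j Phi = t%:E -> {ae mu, forall x, sval_mx j (Phi x) <= t}.
Proof.
move=> e; have := ess_sup_ge mu (fun x => (sval_mx j (Phi x))%:E).
by rewrite -/(ess_sval j Phi) e; apply: aeS => x; rewrite lee_fin.
Qed.

Lemma ess_sval_ge0 j t : ess_sval j Phi = t%:E -> 0 <= t.
Proof.
move=> /ess_sval_ae /ae_exists[x]; exact: le_trans (sval_mx_ge0 _ _).
Qed.

Lemma ess_sval_le i j s t : (i <= j)%N -> ess_sval i Phi = s%:E -> ess_sval j Phi = t%:E -> t <= s.
Proof.
move=> ij es et; rewrite -lee_fin -es -et; apply: le_ess_sup; apply: ae_all => x.
rewrite lee_fin; elim: j ij {et} => [|j IH]; first by rewrite leqn0 => /eqP ->.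
rewrite leq_eqVlt => /orP[/eqP ->//|/IH]; exact: le_trans (sval_mx_le _ _).
Qed.

Lemma good_bounds_superopt (T : seq R) :
  (forall j, (j < size T)%N -> ess_sval j Phi = (T`_j)%:E) -> good_bounds Phi T.
Proof.
move=> h j jT; apply: aeS (ess_sval_ae (h j jT)) => x hx c c0 /(lowb_sval c0) hc.
apply: le_trans hc _; apply: lerXn2r => //; rewrite nnegrE ?sval_mx_ge0//.
exact: ess_sval_ge0 (h j jT).
Qed.

Lemma top_cls n n' (f : R -> 'cV[C]_(n + n')) : L2 (n + n') f ->
  L2 n (fun x => usubmx (f x)) /\ top (cls f) = cls (fun x => usubmx (f x)).
Proof.
move=> Lf; have b := bmx_cst (row_mx 1%:M 0 : 'M[C]_(n, n + n')).
have e : (fun x => row_mx 1%:M 0 *m f x) = (fun x => usubmx (f x)).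
  by apply/funext => x; rewrite -[f x]vsubmxK mul_row_col mul1mx mul0mx addr0 col_mxKu.
by split; [have := L2_mul b Lf; rewrite e|rewrite -e; exact: mulop_cls].
Qed.

Lemma L2_parts n n' (f : R -> 'cV[C]_(n + n')) : L2 n (fun x => usubmx (f x)) ->
  L2 n' (fun x => dsubmx (f x)) -> L2 (n + n') f.
Proof.
move=> /L2P[mu1 hu] /L2P[md hd]; apply/L2P; split.
  move=> i j; rewrite ord1; case: (split_ordP i) => k ->.
    by apply: cmeas_eq (mu1 k 0) => x; rewrite mxE.
  by apply: cmeas_eq (md k 0) => x; rewrite mxE.
by under eq_fun do rewrite vn2_split; exact: rintgD.
Qed.

Lemma bot_L2 n n' (f : R -> 'cV[C]_(n + n')) : L2 (n + n') f -> L2 n' (fun x => dsubmx (f x)).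
Proof.
move=> Lf; have b := bmx_cst (row_mx 0 1%:M : 'M[C]_(n', n + n')).
have e : (fun x => row_mx 0 1%:M *m f x) = (fun x => dsubmx (f x)).
  by apply/funext => x; rewrite -[f x]vsubmxK mul_row_col mul1mx mul0mx add0r col_mxKd.
by have := L2_mul b Lf; rewrite e.
Qed.

Lemma fb_cod_L2 (f : R -> 'cV[C]_(m1 + m2)) : fb_cod f -> L2 (m1 + m2) f.
Proof. by move=> [[Lu _] Ld]; exact: L2_parts. Qed.

Lemma fb_domP (f : R -> 'cV[C]_(n1 + n2)) : L2 (n1 + n2) f -> fb_dom f <-> hX (cls f).
Proof.
move=> Lf; have [Lu e] := top_cls Lf; rewrite /hX /mkset e.
split=> [[h _]|h]; first exact/H2P.
by split; [exact/H2P|exact: bot_L2].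
Qed.

Lemma fb_codP (f : R -> 'cV[C]_(m1 + m2)) : L2 (m1 + m2) f -> fb_cod f <-> hY (cls f).
Proof.
move=> Lf; have [Lu e] := top_cls Lf; rewrite /hY /mkset e.
split=> [[h _]|h]; first exact/HmP.
by split; [exact/HmP|exact: bot_L2].
Qed.

End Values.
End Superoptimal.

(** * The essential norm *)

Section Compact.
Context {R : realType}.
Local Notation C := R[i].

Lemma nsq_young (H : hilb (R := R)) (x y : H) (e : R) : 0 < e ->
  nsq (x + y) <= (1 + e) * nsq x + (1 + e^-1) * nsq y.
Proof.
move=> e0; have := nsq_ge0 (e%:C%C *: x - y).
rewrite (nsqB (e%:C%C *: x) y) (nsqD x y) nsqZ ipZl ReM /cn2 /= mul0r subr0 expr0n addr0 => h.
have : e * (2 * complex.Re (ip x y)) <= e * (e * nsq x + e^-1 * nsq y).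
  by rewrite [e * (_ + _)]mulrDr [e * (e^-1 * _)]mulrA mulfV ?gt_eqF// mul1r; lra.
by rewrite ler_pM2l//; lra.
Qed.

Lemma ReZ (a : R) (z : C) : complex.Re (a%:C%C * z) = a * complex.Re z.
Proof. by rewrite ReM /= mul0r subr0. Qed.

Lemma incr_ge (s : nat -> nat) : {homo s : i j / (i < j)%N} -> forall i, (i <= s i)%N.
Proof. by move=> hs; elim=> // i IH; apply: leq_ltn_trans IH _; exact: hs. Qed.

Lemma nsq_sum_orthonormal (H : hilb (R := R)) (x : nat -> H) n :
  (forall i, nsq (x i) = 1) -> (forall i j, (j < i)%N -> ip (x i) (x j) = 0) ->
  nsq (\sum_(i < n) x i) = n%:R.
Proof.
move=> x1 xo; elim: n => [|n IH]; first by rewrite big_ord0 nsq0.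
rewrite big_ord_recr /= nsq_orth ?IH ?x1 -?natr1// ip_suml big1// => i _.
by rewrite ip_conj xo ?cj0.
Qed.

Variables (H H' : hilb (R := R)) (F K : H -> H') (X : set H) (Y : set H').
Variables (rho2 tau2 : R).
Hypotheses (lF : hlin F) (sX : subsp X) (sY : subsp Y) (cY : hclosed Y).
Hypothesis lK : forall c x y, X x -> X y -> K (c *: x + y) = c *: K x + K y.
Hypothesis cK : forall x : nat -> H, (forall i, X (x i)) -> (forall i, nsq (x i) <= 1) ->
  exists s : nat -> nat, {homo s : i j / (i < j)%N} /\ exists g, forall e : R, 0 < e ->
    exists N, forall i, (N <= i)%N -> nsq (K (x (s i)) - g) < e.
Hypothesis FK : forall x p, X x -> nsq x <= 1 -> Y p ->
  (forall y, Y y -> ip (F x - p) y = 0) -> nsq (p - K x) <= rho2.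
Hypotheses (rho0 : 0 <= rho2) (rt : rho2 < tau2).

(** This says that the projection of [F x] onto [Y] has square norm above [tau2 * nsq x]. If
    [few_large] fails, there are families of every size all of whose nontrivial combinations are
    [big]. *)
Let big x := exists2 z, Y z & tau2 * nsq x < nsq (F x) - nsq (F x - z).

Let big_nz x : big x -> 0 < nsq x.
Proof.
move=> [z _ h]; apply: nsq_gt0; apply/eqP => x0.
move: h; rewrite x0 (hlin0 lF) !nsq0 !sub0r nsqN mulr0.
by have := nsq_ge0 z; lra.
Qed.

Let big_scale c x : 0 < cn2 c -> big x -> big (c *: x).
Proof.
move=> c0 [z Yz h]; exists (c *: z); first exact: subspZ.
rewrite (hlinZ lF) -scalerBr !nsqZ -mulrBr mulrCA.
by rewrite ltr_pM2l.
Qed.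

Let KX0 : K 0 = 0.
Proof.
have := lK 1 (subsp0 sX) (subsp0 sX).
rewrite !scale1r addr0 => h; apply: (addIr (K 0)); by rewrite -h add0r.
Qed.

Let KZ c x : X x -> K (c *: x) = c *: K x.
Proof. by move=> Xx; have := lK c Xx (subsp0 sX); rewrite addr0 KX0 addr0. Qed.

Let K_sum n (x : nat -> H) : (forall i, X (x i)) ->
  K (\sum_(i < n) x i) = \sum_(i < n) K (x i).
Proof.
move=> Xx; elim: n => [|n IH]; first by rewrite !big_ord0 KX0.
rewrite !big_ord_recr /= -IH -[X in K (X + _)]scale1r lK ?scale1r//.
exact: subsp_sum.
Qed.

(** One more vector than the length of [es] suffices for a nontrivial combination orthogonal to
    [es]; it is [big], hence nonzero, and can be normalized. *)
Let pick_orth : (forall N, exists f : 'I_N -> H, (forall i, X (f i)) /\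
    forall c : 'I_N -> C, (exists i, c i != 0) -> big (\sum_i c i *: f i)) ->
  forall es : seq H, exists x, [/\ X x, nsq x = 1, big x & forall e, e \in es -> ip x e = 0].
Proof.
move=> bad es; have [f [Xf bf]] := bad (size es).+1.
have [c c0 hc] := row_kernel (\matrix_(i < (size es).+1, j < size es) ip (f i) es`_j) (ltnSn _).
pose y := \sum_i c 0 i *: f i.
have by_ : big y.
  apply: bf; apply/existsP; apply: contraNT c0 => /existsPn h.
  by apply/eqP/rowP => i; rewrite mxE; apply/eqP; have := h i; rewrite negbK.
have y0 := big_nz by_; pose a := (Num.sqrt (nsq y))^-1.
have a2 : cn2 a%:C%C = (nsq y)^-1.
  by rewrite /cn2 /= expr0n addr0 exprVn sqr_sqrtr// ltW.
have Xy : X y by apply: subsp_sum => // i _; exact: subspZ.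
exists (a%:C%C *: y); split; first exact: subspZ.
- by rewrite nsqZ a2 mulVf// gt_eqF.
- by apply: big_scale => //; rewrite a2 invr_gt0.
move=> e ees; rewrite ipZl; suff -> : ip y e = 0 by rewrite mulr0.
move: ees; rewrite -index_mem => jlt.
move/matrixP: hc => /(_ 0 (Ordinal jlt)); rewrite !mxE => <-.
rewrite /y ip_suml; apply: eq_bigr => i _; rewrite ipZl mxE /= nth_index//.
by rewrite -index_mem.
Qed.

(* Otherwise there are orthonormal [e i] in [X] with [K (e i)] bounded away from 0;
   a subsequence of [K (e i)] converges, so [K] is unbounded on the unit vectors
   [n ^ (-1/2) * (e 0 + ... + e (n - 1))], against its compactness. *)
Theorem few_large_compact : few_large F X Y tau2.
Proof.
apply: contrapT => nfl; have r0 := rho0; have r1 := rt.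
have bad N : exists f : 'I_N -> H, (forall i, X (f i)) /\
    forall c : 'I_N -> C, (exists i, c i != 0) -> big (\sum_i c i *: f i).
  apply: contrapT => nb; apply: nfl; exists N => f Xf.
  apply: contrapT => nc; apply: nb; exists f; split=> // c c0.
  apply: contrapT => nbig; apply: nc; exists c; split=> // z Yz.
  by rewrite leNgt; apply/negP => h; apply: nbig; exists z.
have /choice[next hnext] := pick_orth bad.
pose es := fix es n := if n is n'.+1 then next (es n') :: es n' else [::].
pose e n := next (es n).
have Xe n : X (e n) by case: (hnext (es n)).
have e1 n : nsq (e n) = 1 by case: (hnext (es n)).
have be n : big (e n) by case: (hnext (es n)).
have mem_es m n : (m < n)%N -> e m \in es n.
  elim: n => // n IH; rewrite ltnS leq_eqVlt => /orP[/eqP ->|/IH h]; rewrite /= inE ?eqxx//.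
  by rewrite h orbT.
have eo n m : (m < n)%N -> ip (e n) (e m) = 0.
  by move=> mn; case: (hnext (es n)) => _ _ _; apply; exact: mem_es.
(* [ep] is small enough for [(1 + ep) * rho2] to leave half of the gap [tau2 - rho2]. The projection
   of [F (e n)] has square norm above [tau2] and square distance at most [rho2] from [K (e n)], so
   [nsq_young] leaves at least [de] for [K (e n)]. *)
pose ep := (tau2 - rho2) / (2 * (rho2 + 1)).
have d2 : 0 < 2 * (rho2 + 1) by rewrite mulr_gt0// ltr_wpDl.
have ep0 : 0 < ep by rewrite divr_gt0// subr_gt0.
pose de := (tau2 - rho2) / 2 / (1 + ep^-1).
have iep : 0 < ep^-1 by rewrite invr_gt0.
have de0 : 0 < de by rewrite !divr_gt0 ?subr_gt0//; lra.
have Kbig n : de <= nsq (K (e n)).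
  have [p Yp hp] := projection sY cY (F (e n)).
  have p1 : tau2 < nsq p.
    have [z Yz] := be n; rewrite e1 mulr1.
    have := projection_best sY Yp hp Yz.
    have : nsq (F (e n)) = nsq (F (e n) - p) + nsq p.
      by rewrite -[in LHS](subrK p (F (e n))) (nsq_orth (hp p Yp)).
    lra.
  have p2 : nsq (p - K (e n)) <= rho2 by apply: FK => //; rewrite e1.
  have := nsq_young (p - K (e n)) (K (e n)) ep0; rewrite subrK => h.
  have h1 : ep * rho2 <= (tau2 - rho2) / 2.
    rewrite /ep mulrAC ler_pdivrMr//.
    have -> : (tau2 - rho2) / 2 * (2 * (rho2 + 1)) = (tau2 - rho2) * rho2 + (tau2 - rho2) by field.
    lra.
  rewrite /de ler_pdivrMr; last lra.
  have h2 : (1 + ep) * nsq (p - K (e n)) <= (1 + ep) * rho2 by rewrite ler_wpM2l//; lra.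
  lra.
have e1' n : nsq (e n) <= 1 by rewrite e1.
have [s [hs [g hg]]] := cK Xe e1'.
have de2 : 0 < de / 2 by rewrite divr_gt0.
have [N0 hN0] := hg (de / 2) de2.
pose x i := e (s (N0 + i)%N).
have Xx i : X (x i) by exact: Xe.
have x1 i : nsq (x i) = 1 by exact: e1.
have xo i j : (j < i)%N -> ip (x i) (x j) = 0.
  by move=> ji; apply: eo; apply: hs; rewrite ltn_add2l.
(* From [nsq (K (x i)) >= de] and [nsq (K (x i) - g) < de / 2], expanding the square. *)
have Kx i : de / 4 <= complex.Re (ip (K (x i)) g).
  have := hN0 (N0 + i)%N (leq_addr _ _); rewrite -/(x i) nsqB.
  by have := Kbig (s (N0 + i)%N); rewrite -/(x i); have := nsq_ge0 g; lra.
(* A sum of [4^m] orthonormal vectors has norm [2^m], so these are unit vectors, while the inner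
   products of their images with [g] grow like [2^m]. *)
pose h m := ((2^-1) ^+ m)%:C%C *: \sum_(i < 4 ^ m) x i.
have Xh m : X (h m) by apply: subspZ => //; apply: subsp_sum.
have h1 m : nsq (h m) <= 1.
  rewrite nsqZ (nsq_sum_orthonormal _ x1 xo) /cn2 /= expr0n addr0.
  rewrite -exprM mulnC exprM natrX -exprMn.
  by rewrite (_ : 2^-1 ^+ 2 * 4%:R = 1 :> R) ?expr1n//; field.
have Kh m : 2 ^+ m * (de / 4) <= complex.Re (ip (K (h m)) g).
  rewrite /h KZ; last by apply: subsp_sum.
  rewrite K_sum// ipZl ReZ ip_suml raddf_sum.
  apply: (@le_trans _ _ (2^-1 ^+ m * \sum_(i < 4 ^ m) (de / 4))).
    rewrite sumr_const card_ord -[_ *+ (4 ^ m)]mulr_natl [leRHS]mulrA natrX -exprMn.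
    by rewrite (_ : 2^-1 * 4%:R = 2 :> R)//; field.
  by rewrite ler_wpM2l ?exprn_ge0 ?invr_ge0//; apply: ler_sum => i _; exact: Kx.
have [r [hr [g' hg']]] := cK Xh h1.
have [N1 hN1] := hg' 1 ltr01.
(* Upper bound for the same inner products once [K (h (r i))] is within 1 of [g']: half of
   [nsq (K (h (r i))) + nsq g]. *)
pose M := 1 + nsq g' + nsq g / 2.
pose q := Num.truncn (M / (de / 4)).
have de4 : 0 < de / 4 by rewrite divr_gt0.
have M0 : 0 <= M by rewrite /M; have := nsq_ge0 g'; have := nsq_ge0 g; lra.
have qM : M / (de / 4) < q.+1%:R.
  by rewrite truncnS_gt.
pose i := maxn N1 q.+1.
have iN1 : (N1 <= i)%N by exact: leq_maxl.
have ub : complex.Re (ip (K (h (r i))) g) <= M.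
  have := hN1 i iN1.
  have := nsqD_le (K (h (r i)) - g') g'; rewrite subrK.
  have := nsq_ge0 (K (h (r i)) - g); rewrite nsqB /M; lra.
have lb := Kh (r i).
have : q.+1%:R <= 2 ^+ r i :> R.
  rewrite -natrX ler_nat; apply: leq_trans (leq_maxr N1 q.+1) _; rewrite -/i.
  by apply: leq_trans (incr_ge hr i) _; apply: ltnW; exact: ltn_expl.
rewrite ltr_pdivrMr// in qM => le2.
have : q.+1%:R * (de / 4) <= 2 ^+ r i * (de / 4) by rewrite ler_wpM2r// ltW.
lra.
Qed.

End Compact.

(** * The essential norm of a four block operator *)

Section EssentialNorm.
Context {R : realType}.
Local Notation C := R[i].
Variables (m1 m2 n1 n2 : nat).
Variables (Phi : R -> 'M[C]_(m1 + m2, n1 + n2)) (G : (R -> 'cV[C]_(n1 + n2)) -> R -> 'cV[C]_(m1 + m2)).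
Hypothesis symG : is_symbol Phi G.

Let LPhi : Linf Phi. Proof. by case: symG. Qed.
Let bPhi : bmx Phi. Proof. exact: Linf_bmx. Qed.

Lemma fb_dom_lrep (x : Hil (n1 + n2)) : hX x -> fb_dom (lrep x : R -> 'cV[C]_(n1 + n2)).
Proof.
move=> Xx; apply/(fb_domP (lrep_L2 x)).
exact: (eq_ind_r (@hX R n1 n2) Xx (lrepK x)).
Qed.

Lemma norm2_lrep n (x : Hil (R := R) n) : norm2 (lrep x : R -> 'cV[C]_n) = (Num.sqrt (nsq x))%:E.
Proof.
have := norm2_nsq (lrep_L2 x) => e.
by apply: etrans e _; congr (Num.sqrt _)%:E; exact: congr1 (lrepK x).
Qed.

(** [four_block] is defined by the same orthogonality relation, and projections are unique. *)
Let symbol_proj x p : hX x -> hY p -> (forall y, hY y -> ip (mulop Phi x - p) y = 0) ->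
  p = cls (G (lrep x)).
Proof.
move=> Xx Yp hp; have Ax := fb_dom_lrep Xx.
have [BG eG] := symG.2 _ Ax; have LG := fb_cod_L2 BG.
have Lf := L2_mul bPhi (lrep_L2 x).
have [Bq hq] := proj2_spec (@fb_cod_L2 R m1 m2) (@fb_codP R m1 m2)
  (@subsp_hY R m1 m2) (@hclosed_hY R m1 m2) Lf.
have Lq := fb_cod_L2 Bq.
have -> : cls (G (lrep x)) = cls (proj2 fb_cod (fun t => Phi t *m lrep x t)).
  exact: cls_eq LG Lq eG.
apply: (projection_uniq (@subsp_hY R m1 m2) Yp _ hp hq).
exact: (fb_codP Lq).1 Bq.
Qed.

(** Take a compact [K] for which the norm [r] of [Gamma - K] is below [t]. Any [tau2] strictly
    between [r ^+ 2] and [t ^+ 2] will do; the midpoint is taken. *)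
Lemma symbol_few_large t : 0 < t -> (essential_norm fb_dom fb_cod G < t%:E)%E ->
  exists2 tau2, 0 <= tau2 < t ^+ 2 &
    few_large (mulop Phi) (@hX R n1 n2) (@hY R m1 m2) tau2.
Proof.
move=> t0 /ereal_inf_lt[_ [K [[KB Kae Klin] Kcpt] <-]].
set v := opnorm2 _ _ => vt.
have vge f : fb_dom f -> (norm2 f <= 1)%E -> (norm2 (fun x => (G f x - K f x)%R) <= v)%E.
  by move=> Af f1; apply: ereal_sup_ubound; exists f.
have dom0 : fb_dom (lrep (0 : Hil (R := R) (n1 + n2))).
  by apply: fb_dom_lrep; exact: subsp0 (@subsp_hX R n1 n2).
have v0 : (0 <= v)%E.
  apply: le_trans (vge _ dom0 _); first exact: Lnorm_ge0.
  by rewrite norm2_lrep nsq0 sqrtr0 lee_fin.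
(* Lying between 0 and [t], the norm is a real number. *)
case: v v0 vt vge => [r||] // r0 rt vge; rewrite lee_fin in r0; rewrite lte_fin in rt.
have rt2 : r ^+ 2 < t ^+ 2 by rewrite ltrXn2r// nnegrE// ltW.
exists ((r ^+ 2 + t ^+ 2) / 2).
  by have r2 := sqr_ge0 r; apply/andP; split; lra.
pose Kh (x : Hil (n1 + n2)) : Hil (m1 + m2) := cls (K (lrep x)).
have LK x : hX x -> L2 (m1 + m2) (K (lrep x)).
  by move=> Xx; apply: fb_cod_L2; apply: KB; exact: fb_dom_lrep.
apply: (@few_large_compact R _ _ (mulop Phi) Kh (@hX R n1 n2) (@hY R m1 m2) (r ^+ 2)).
- exact: mulop_lin.
- exact: subsp_hX.
- exact: subsp_hY.
- exact: hclosed_hY.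
- move=> c x y Xx Xy.
  have Xz := (@subsp_hX R n1 n2).2 c x y Xx Xy.
  have Lz := L2_lin c (lrep_L2 x) (lrep_L2 y).
  have Az : fb_dom (fun t => c *: lrep x t + lrep y t).
    apply/(fb_domP Lz); apply: (eq_ind_r (@hX R n1 n2) Xz).
    have e := cls_lin c (lrep_L2 x) (lrep_L2 y).
    by rewrite !lrepK in e; exact: e.
  apply: etrans _ (cls_lin c (LK x Xx) (LK y Xy)).
  apply: cls_eq; [exact: LK|exact: L2_lin (LK x Xx) (LK y Xy)|].
  apply: ae_eq_fun_trans (Klin c _ _ (fb_dom_lrep Xx) (fb_dom_lrep Xy)).
  apply: Kae; [exact: fb_dom_lrep|exact: Az|exact: lrep_lin].
- move=> x Xx x1.
  have [i||s [hs [g Bg hg]]] := Kcpt (fun i => lrep (x i)).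
  + exact: fb_dom_lrep.
  + exists 1 => i; rewrite norm2_lrep lee_fin -[leRHS]sqrtr1; exact: ler_wsqrtr.
  have Lg := fb_cod_L2 Bg.
  exists s; split=> //; exists (cls g) => e e0.
  pose d i := Kh (x (s i)) - cls g.
  have nE i : norm2 (fun y => K (lrep (x (s i))) y - g y) = (Num.sqrt (nsq (d i)))%:E.
    have L1 := LK _ (Xx (s i)).
    apply: etrans (norm2_nsq (L2D L1 (L2N Lg))) _.
    have e1 : (cls (fun y => K (lrep (x (s i))) y - g y) : Hil (m1 + m2)) = d i.
      exact: clsB L1 Lg.
    exact: (congr1 (fun y : Hil (m1 + m2) => (Num.sqrt (nsq y))%:E) e1).
  have hd : Num.sqrt (nsq (d i)) @[i --> \oo] --> (0 : R).
    have h : (fun i => norm2 (fun y => K (lrep (x (s i))) y - g y)) =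
        EFin \o (fun i => Num.sqrt (nsq (d i))) by apply/funext => i; exact: nE.
    have := hg; rewrite h => /fine_cvg; exact.
  have se : 0 < Num.sqrt e by rewrite sqrtr_gt0.
  have /cvgrPdist_lt/(_ _ se) [N _ hN] := hd.
  exists N => i Ni; have := hN i Ni.
  by rewrite /= sub0r normrN ger0_norm ?sqrtr_ge0// ltr_sqrt.
- move=> x p Xx x1 Yp hp; rewrite (symbol_proj Xx Yp hp).
  have Ax := fb_dom_lrep Xx; have LG := fb_cod_L2 (symG.2 _ Ax).1.
  have n1' : (norm2 (lrep x) <= 1)%E.
    by rewrite norm2_lrep lee_fin -[leRHS]sqrtr1; exact: ler_wsqrtr.
  have := vge _ Ax n1'; rewrite (norm2_nsq (L2D LG (L2N (LK x Xx)))) lee_fin.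
  have e : (cls (fun y => G (lrep x) y - K (lrep x) y) : Hil (m1 + m2)) = (cls (G (lrep x)) : Hil (m1 + m2)) - Kh x.
    exact: clsB LG (LK x Xx).
  move=> h; rewrite -e -[nsq _]sqr_sqrtr ?nsq_ge0//.
  by apply: lerXn2r => //; rewrite nnegrE ?sqrtr_ge0.
- exact: sqr_ge0.
- by lra.
Qed.

End EssentialNorm.

(** * Invariance of the indices *)

Section SpectralLower.
Context {R : realType}.
Local Notation C := R[i].

(** Eigencomponents for distinct positive [s] are orthogonal, and so are their images. Hence
    [nsq (F f)] is the sum of the [s ^+ 2 * nsq (g s)], which exceeds [t2 * nsq f] unless all [g s]
    vanish. *)
Lemma spectral_part_lower (H H' : hilb (R := R)) (F : H -> H') X Y Z (t2 : R) f : hlin F ->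
  uniq Z -> (forall s, s \in Z -> 0 < s /\ t2 < s ^+ 2) -> spectral_part F X Y Z f ->
  nsq (F f) <= t2 * nsq f -> f = 0.
Proof.
move=> lF uZ hZ [_ _ [g fE hg]] hf.
have orth s s' : s \in Z -> s' \in Z -> s' != s -> ip (g s) (g s') = 0.
  move=> sZ s'Z ss'; have e := hg _ sZ (g s').
  have : (s ^+ 2)%:C%C * ip (g s) (g s') = (s' ^+ 2)%:C%C * ip (g s) (g s').
    rewrite -e ip_conj (hg _ s'Z) cjM -ip_conj; congr (_ * _).
    by apply: complex_eq; rewrite !cE//= oppr0.
  move=> /eqP; rewrite -subr_eq0 -mulrBl mulf_eq0 => /orP[|/eqP//].
  rewrite -rmorphB /= => /eqP /(congr1 (@complex.Re R)) /= h; case/eqP: ss'.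
  have := (hZ _ sZ).1; have := (hZ _ s'Z).1 => p p'.
  by have /eqP : s ^+ 2 = s' ^+ 2 by [apply: subr0_eq]; rewrite eqrXn2 ?ltW// => /eqP.
have gf s : s \in Z -> ip (g s) f = (nsq (g s))%:C%C.
  move=> sZ; rewrite fE ip_sumr (bigD1_seq s)//= ipxx big_seq_cond big1 ?addr0// => s' /andP[s'Z].
  exact: orth.
have nf : nsq f = \sum_(s <- Z) nsq (g s).
  rewrite {1}/nsq {1}fE ip_suml raddf_sum big_seq [RHS]big_seq.
  by apply: eq_bigr => s sZ; rewrite gf.
have nFf : nsq (F f) = \sum_(s <- Z) s ^+ 2 * nsq (g s).
  rewrite {1}/nsq {1}fE (hlin_sum lF) ip_suml raddf_sum big_seq [RHS]big_seq.
  by apply: eq_bigr => s sZ; rewrite hg// gf//= mul0r subr0.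
move: hf; rewrite nFf nf mulr_sumr -subr_le0 -sumrB => hs.
have pos s : s \in Z -> 0 <= s ^+ 2 * nsq (g s) - t2 * nsq (g s).
  by move=> sZ; rewrite -mulrBl mulr_ge0 ?nsq_ge0// subr_ge0 ltW//; case: (hZ _ sZ).
have h0 : \sum_(s <- Z | s \in Z) (s ^+ 2 * nsq (g s) - t2 * nsq (g s)) == 0.
  by rewrite eq_le sumr_ge0// andbT -big_seq.
rewrite psumr_eq0// in h0.
rewrite fE big_seq; apply: big1 => s sZ; apply: nsq_eq0.
have := allP h0 _ sZ; rewrite sZ /= -mulrBl mulf_eq0 => /orP[|/eqP//].
by rewrite subr_eq0 gt_eqF//; case: (hZ _ sZ).
Qed.

End SpectralLower.

(** * The stage at which one side has no Hardy component *)

Section EndStage.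
Context {R : realType}.
Local Notation C := R[i].
Local Notation mu := (circ R).

Lemma mulop_zmul m n (F : R -> 'M[C]_(m, n)) k x : bmx F ->
  mulop F (zmul k x) = zmul k (mulop F x).
Proof.
move=> bF.
apply: etrans (mulop_comp x bF (bmx_chi n k)) _.
apply: etrans _ (esym (mulop_comp x (bmx_chi m k) bF)).
by congr (mulop _ x); apply/funext => t; rewrite scalar_mxC.
Qed.

Lemma zmul_hHm n k (x : Hil (R := R) n) : k <= 0 -> hHm n x -> hHm n (zmul k x).
Proof.
move=> k0 hx g Hg; rewrite zmul_adj; apply: hx.
by apply: zmul_hH2 => //; rewrite oppr_ge0.
Qed.

Lemma zmul_hX n1 n2 k (x : Hil (R := R) (n1 + n2)) : 0 <= k -> hX x -> hX (zmul k x).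
Proof.
move=> k0 hx; have e := mulop_zmul k x (bmx_cst (row_mx 1%:M 0 : 'M[C]_(n1, n1 + n2))).
exact: (eq_ind_r (hH2 n1) (zmul_hH2 k0 hx) e).
Qed.

Lemma zmul_hY n1 n2 k (x : Hil (R := R) (n1 + n2)) : k <= 0 -> hY x -> hY (zmul k x).
Proof.
move=> k0 hx; have e := mulop_zmul k x (bmx_cst (row_mx 1%:M 0 : 'M[C]_(n1, n1 + n2))).
exact: (eq_ind_r (hHm n1) (zmul_hHm k0 hx) e).
Qed.

(** Having nonnegative distinct frequencies, the polynomial is a nonzero element of H2. *)
Lemma trig_nonzero N (c : 'I_N -> C) (k : 'I_N -> int) : (forall i, 0 <= k i) -> injective k ->
  (exists i, c i != 0) -> {ae mu, forall t, \sum_i c i * chi (k i) t != 0}.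
Proof.
move=> k0 kinj [j cj].
have [L1 E1] := cls_sum c (fun i => @ekf_L2 R 1 (k i) ord0).
pose p : Hil (R := R) 1 := \sum_i c i *: ek (k i) ord0.
have Hp : hH2 1 p.
  apply: (subsp_sum (@subsp_hH2 R 1)) => i _.
  by apply: (subspZ (@subsp_hH2 R 1)); exact: ek_hH2.
have p0 : p != 0.
  apply/eqP => p0; case/eqP: cj; have := congr1 (fun x : Hil 1 => ip x (ek (k j) ord0)) p0.
  rewrite ip0l /p ip_suml; under eq_bigr do rewrite ipZl ip_ek_ek (inj_eq kinj) andbT.
  rewrite (bigD1 j)//= eqxx mulr1 big1 ?addr0// => i /negPf ->; exact: mulr0.
apply: aeS2 (hH2_nonzero Hp p0) (lrep_cls L1) => t h1 h2.
have e : lrep p t = \sum_i c i *: ekf (k i) ord0 t.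
  by apply: etrans h2; congr (lrep _ t); exact: esym E1.
move: h1; rewrite e summxE; congr (_ != 0); apply: eq_bigr => i _.
by rewrite !mxE !eqxx /= mulr1.
Qed.

Let smul_sum0 n N (c : 'I_N -> C) (k : 'I_N -> int) (f : Hil n) :
  {ae mu, forall t, \sum_i c i * chi (k i) t != 0} ->
  \sum_i c i *: zmul (k i) f = 0 -> f = 0.
Proof.
move=> nz h.
have [L1 E1] := cls_sum c (fun i => L2_mul (bmx_chi n (k i)) (lrep_L2 f)).
have := (ae0_cls L1).2 (etrans E1 h) => h0.
apply: lspaceP; apply: aeS (aeI (aeI h0 nz) (lrep0 n)) => t [[e p] e0].
apply: etrans _ (esym e0).
have : (\sum_i c i * chi (k i) t) *: lrep f t = 0.
  rewrite scaler_suml -[RHS]e; apply: eq_bigr => i _.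
  by rewrite mul_scalar_mx scalerA.
by move=> /eqP; rewrite scaler_eq0 (negPf p) => /eqP.
Qed.

Lemma spectral_part_zmul m n (F : R -> 'M[C]_(m, n)) X Y Z k f : bmx F ->
  (forall x, X x -> X (zmul k x)) -> (forall y, Y y -> Y (zmul k y)) ->
  spectral_part (mulop F) X Y Z f -> spectral_part (mulop F) X Y Z (zmul k f).
Proof.
move=> bF hX' hY' [Xf Yf [g fE hg]]; split; first exact: hX'.
  by rewrite mulop_zmul//; exact: hY'.
exists (fun s => zmul k (g s)).
  by rewrite fE (hlin_sum (@zmul_lin R n k)).
move=> s sZ x.
by rewrite mulop_zmul// !zmul_adj -mulop_zmul// hg.
Qed.

Lemma Hil0 (x : Hil (R := R) 0) : x = 0.
Proof. by apply: lspaceP; apply: ae_all => t; apply/matrixP => -[]. Qed.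

(* Here [hX] or [hY] is the whole space, so the spectral part is invariant under the
   shift or its inverse. If [f != 0], the translates of [f] are independent, and
   [Phi] has on their span norms too large for [few_large]. *)
Theorem end_trivial m1 m2 n1 n2 (Phi : R -> 'M[C]_(m1 + m2, n1 + n2)) Z tau2 f :
  bmx Phi -> m1 = 0%N \/ n1 = 0%N -> few_large (mulop Phi) (@hX R n1 n2) (@hY R m1 m2) tau2 ->
  uniq Z -> (forall s, s \in Z -> 0 < s /\ tau2 < s ^+ 2) ->
  spectral_part (mulop Phi) (@hX R n1 n2) (@hY R m1 m2) Z f -> f = 0.
Proof.
move=> bPhi mn [N hN] uZ hZ Sf.
have lF : hlin (mulop Phi) by exact: mulop_lin.
have sS := @subsp_spectral_part R _ _ (mulop Phi) (@hX R n1 n2) (@hY R m1 m2) Z lF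
  (@subsp_hX R n1 n2) (@subsp_hY R m1 m2).
(* The direction of translation: forward if [hY] is the whole space, as [hX] is invariant under the
   shift, and backward if [hX] is the whole space. *)
have [sg [sg1 hk]] : exists sg : int, (sg = 1 \/ sg = -1) /\ forall k : nat,
    (forall x, @hX R n1 n2 x -> hX (zmul (sg * k%:Z) x)) /\
    (forall y, @hY R m1 m2 y -> hY (zmul (sg * k%:Z) y)).
  case: mn => mn; [exists 1|exists (-1)].
    split; first by left.
    move=> k; split=> x hx; first by apply: zmul_hX => //; rewrite mul1r.
    by move=> g _; move: g (top _); rewrite mn => g y; rewrite (Hil0 y) ip0l.
  split; first by right.
  move=> k; split=> x hx; last by apply: zmul_hY => //; rewrite mulN1r oppr_le0.
  by move=> i; exfalso; have := ltn_ord i; lia.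
have [c [c0 hc]] := hN (fun i => zmul (sg * (nat_of_ord i)%:Z) f) (fun i => (hk i).1 f (let: And3 h _ _ := Sf in h)).
have Sh : spectral_part (mulop Phi) (@hX R n1 n2) (@hY R m1 m2) Z
    (\sum_i c i *: zmul (sg * (nat_of_ord i)%:Z) f).
  apply: (subsp_sum sS) => i _; apply: (subspZ sS).
  exact: (spectral_part_zmul bPhi (hk i).1 (hk i).2 Sf).
have h0 : \sum_i c i *: zmul (sg * (nat_of_ord i)%:Z) f = 0.
  apply: (spectral_part_lower lF uZ hZ Sh).
  (* The inequality of [few_large] is used at [z = F h], which is in [Y] since [h] is in the
     spectral part; it then bounds [nsq (F h)] itself. *)
  have aux (w : Hil (m1 + m2)) b : nsq w - nsq (w - w) <= b -> nsq w <= b.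
    by rewrite subrr nsq0 subr0.
  have [_ Yh _] := Sh; exact: aux (hc _ Yh).
apply: smul_sum0 h0.
case: sg1 => ->.
  apply: (@trig_nonzero N c (fun i => 1 * (nat_of_ord i)%:Z)) => // i j.
  by rewrite !mul1r => -[] /val_inj.
(* For negative frequencies the polynomial is conjugated. *)
have c0' : exists i, (c i)^* != 0.
  have [i ci] := c0; exists i; apply: contraNneq ci => /(congr1 Num.conj).
  by rewrite cjK cj0 => ->.
have inj : injective (fun i : 'I_N => (nat_of_ord i)%:Z) by move=> i j [] /val_inj.
apply: aeS (trig_nonzero (fun i => isT : 0 <= (nat_of_ord i)%:Z) inj c0') => t.
apply: contraNneq => /(congr1 Num.conj); rewrite cj0 cj_sum => h.
by apply/eqP; apply: etrans h; apply: eq_bigr => i _; rewrite cjM -chiN mulN1r opprK.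
Qed.

End EndStage.

Section Dimension.
Context {R : realType}.
Local Notation C := R[i].

(** Induction along the factorization: a step with [t] in [Z] contributes its [k]. As soon as some
    [t] lies below all of [Z], the bound [|Phi| <= t] makes the spectral part trivial, and the sum
    is empty because later values are no larger. *)
Theorem factors_dim m1 m2 n1 n2 (Phi : R -> 'M[C]_(m1 + m2, n1 + n2)) (L : seq (R * nat)) :
  factors Phi L -> forall tau2 (Z : seq R), 0 <= tau2 -> good_bounds Phi (unzip1 L) ->
  pairwise (fun x y => y <= x) (unzip1 L) ->
  few_large (mulop Phi) (@hX R n1 n2) (@hY R m1 m2) tau2 -> uniq Z ->
  (forall s, s \in Z -> 0 < s /\ tau2 < s ^+ 2) ->
  (forall t, t \in unzip1 L -> t \in Z \/ forall s, s \in Z -> 0 <= t < s) ->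
  dimH (spectral_part (mulop Phi) (@hX R n1 n2) (@hY R m1 m2) Z)
    (\sum_(tk <- L | tk.1 \in Z) tk.2)%N.
Proof.
elim=> {m1 n1 Phi L} [m1 n1 Phi bPhi mn|p' p Phi Phi1 V W t u k L bPhi bPhi1 tV tW uu hk PhiE _ IH]
  tau2 Z tau0 gb pw few uZ hZ hL.
  rewrite big_nil; apply: dimH0; last by move=> x; exact: end_trivial few uZ hZ.
  exact: (subsp0 (subsp_spectral_part Z (mulop_lin bPhi) (@subsp_hX R n1 n2) (@subsp_hY R m1 m2))).
have Phi_le := good_bounds_le gb.
have gb1 := good_bounds_step (thematic_unitary tW) (thematic_unitary tV) uu PhiE gb.
move: pw => /= /andP[tall pw].
have [tZ|tZ] := hL t (mem_head _ _).
  have [t0 taut] := hZ t tZ.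
  have [onto dimk] := hk (lt0r_neq0 t0).
  have tau : 0 <= tau2 < t ^+ 2 by rewrite tau0.
  rewrite big_cons /= tZ.
  apply: (step_dim tV tW bPhi bPhi1 uu PhiE t0 Phi_le onto tau few uZ tZ dimk).
  apply: (IH tau2) => //.
    exact: (step_few tV tW bPhi bPhi1 uu PhiE t0 Phi_le onto tau few).
  by move=> s sL; apply: hL; rewrite /= inE sL orbT.
rewrite big_seq_cond big1 => [|tk /andP[tkL tkZ]]; last first.
  exfalso; have /andP[_ h] := tZ _ tkZ; move: tkL; rewrite inE => /orP[/eqP e|tkL].
    by move: h; rewrite e ltxx.
  by have := allP tall _ (map_f fst tkL); rewrite leNgt h.
apply: dimH0.
  exact: (subsp0 (subsp_spectral_part Z (mulop_lin bPhi) (@subsp_hX R p.+1 n2) (@subsp_hY R p'.+1 m2))).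
apply: (spectral_part_trivial (t2 := t ^+ 2)); first exact: nsq_mulop_le.
by move=> s /tZ/andP[t0 ts]; rewrite ltrXn2r// nnegrE// (le_trans t0)// ltW.
Qed.

End Dimension.

Section Invariance.
Context {R : realType}.
Local Notation C := R[i].
Variables (m1 m2 n1 n2 : nat).
Variables (Gamma : (R -> 'cV[C]_(n1 + n2)) -> R -> 'cV[C]_(m1 + m2)).
Variables (Phi : R -> 'M[C]_(m1 + m2, n1 + n2)) (t : 'I_(minn m1 n1) -> R).
Hypothesis hPhi : superopt_symbol Phi Gamma.
Hypothesis ht : forall j : 'I_(minn m1 n1), superopt_sval Phi j (t j).

Let hsval (j : 'I_(minn m1 n1)) : ess_sval j Phi = (t j)%:E.
Proof.
apply: superopt_sval_symbol (ht j).
by apply: Omega_le hPhi.2; have := ltn_ord j; lia.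
Qed.

Lemma superopt_ge0 j : 0 <= t j.
Proof. exact: ess_sval_ge0 (hsval j). Qed.

Lemma thematic_dim (u : 'I_(minn m1 n1) -> R -> C)
    (W : 'I_(minn m1 n1) -> R -> 'M[C]_(m1 + m2))
    (V : 'I_(minn m1 n1) -> R -> 'M[C]_(n1 + n2))
    (D : R -> 'M[C]_(m1 + m2, n1 + n2)) (k : 'I_(minn m1 n1) -> int) tau2 (Z : seq R) :
  thematic_factorization Phi t u W V D ->
  (forall j, t j != 0 -> toeplitz_index (u j) (k j)) ->
  0 <= tau2 -> few_large (mulop Phi) (@hX R n1 n2) (@hY R m1 m2) tau2 -> uniq Z ->
  (forall s, s \in Z -> 0 < s /\ tau2 < s ^+ 2) ->
  (forall j, t j \in Z \/ forall s, s \in Z -> t j < s) ->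
  exists2 N, dimH (spectral_part (mulop Phi) (@hX R n1 n2) (@hY R m1 m2) Z) N &
    \sum_(j | t j \in Z) k j = N%:Z.
Proof.
move=> [hu hV hW [em [en [S [_ hD]]]] hPE] hk tau0 few uZ hZ hL.
(* Where [t j = 0] the value 0 is a mere default; elements of [Z] are positive, so the sums over [Z]
   do not meet it. *)
have hkn0 j : exists m : nat, t j != 0 ->
    ((forall a : Hil 1, exists c d, [/\ hH2 1 c, hHm 1 d & a = smul (u j) c + d]) /\
      dimH (toeplitz_ker (u j)) m) /\ k j = m%:Z.
  have [_|tj] := eqVneq (t j) 0; first by exists 0%N.
  have [uj [k0 hk0 k0gt]] := hu j.
  have [onto [m km dm]] := toeplitz_onto uj hk0 k0gt (hk j tj).
  by exists m.
have [kn hkn] := choice hkn0.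
have bPhi : bmx Phi by apply: Linf_bmx; case: hPhi => -[].
have fac : factors Phi [seq (t j, kn j) | j <- enum 'I_(minn m1 n1)].
  apply: (factors_of (W := W) (V := V) (u := u) (em := em) (en := en) (S := S) bPhi).
  - exact: geq_minl.
  - exact: geq_minr.
  - by rewrite /minn; case: ifP => _; [left|right].
  - by move=> j; case: (hu j).
  - by move=> j /hkn[].
  - exact: hV.
  - exact: hW.
  by apply: aeS2 hPE hD => x -> ->.
have uz : unzip1 [seq (t j, kn j) | j <- enum 'I_(minn m1 n1)] = [seq t j | j <- enum 'I_(minn m1 n1)].
  by rewrite /unzip1 -map_comp.
have tnth i (id : (i < minn m1 n1)%N) :
    [seq t j | j <- enum 'I_(minn m1 n1)]`_i = t (Ordinal id).
  rewrite (nth_map (Ordinal id)) ?size_enum_ord//; congr t; apply: val_inj.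
  by rewrite /= nth_enum_ord.
exists (\sum_(tk <- [seq (t j, kn j) | j <- enum 'I_(minn m1 n1)] | tk.1 \in Z) tk.2)%N.
  apply: (factors_dim fac tau0 _ _ few uZ hZ); rewrite uz.
  - apply: good_bounds_superopt => i; rewrite size_map size_enum_ord => id.
    by rewrite tnth; exact: (hsval (Ordinal id)).
  - apply/(pairwiseP 0) => i j; rewrite !inE size_map size_enum_ord => id jd ij.
    rewrite !tnth; exact: (ess_sval_le (ltnW ij) (hsval (Ordinal id)) (hsval (Ordinal jd))).
  move=> _ /mapP[j _ ->]; have [h|h] := hL j; [by left|right=> s sZ].
  by rewrite superopt_ge0 h.
rewrite big_map big_enum_cond /= -natz natr_sum.
apply: eq_bigr => j tZ; have [|_ ->] := hkn j; last by rewrite natz.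
by rewrite gt_eqF//; case: (hZ _ tZ).
Qed.

End Invariance.

Section Decreasing.
Variables (R : realDomainType) (l : nat) (a : 'I_l.+1 -> R).

Lemma decr_le : (forall r s : 'I_l.+1, (r < s)%N -> a s < a r) ->
  forall i i' : 'I_l.+1, (i <= i')%N -> a i' <= a i.
Proof.
move=> ad i i'; rewrite leq_eqVlt => /orP[/eqP/val_inj ->//|h]; exact: ltW (ad _ _ h).
Qed.

Lemma decr_inj : (forall r s : 'I_l.+1, (r < s)%N -> a s < a r) -> injective a.
Proof.
move=> ad i i' e; case: (ltngtP i i') => [h|h|/val_inj //].
  by have := ad _ _ h; rewrite e ltxx.
by have := ad _ _ h; rewrite e ltxx.
Qed.

Lemma sum_le_lt d (f : 'I_d -> int) (t : 'I_d -> R) (r : 'I_l.+1) : injective a ->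
  \sum_(j | [exists i : 'I_l.+1, (i <= r)%N && (t j == a i)]) f j =
  \sum_(j | t j == a r) f j + \sum_(j | [exists i : 'I_l.+1, (i < r)%N && (t j == a i)]) f j.
Proof.
move=> a_inj; rewrite (bigID (fun j => t j == a r)) /=; congr (_ + _); apply: eq_bigl => j.
  apply: andb_idl => e; apply/existsP; exists r; by rewrite leqnn.
apply/andP/existsP => [[/existsP[i /andP[ir /eqP e]] nr]|[i /andP[ir /eqP e]]].
  exists i; rewrite e eqxx andbT ltn_neqAle ir andbT.
  by apply: contraNneq nr => /val_inj <-; rewrite e.
split; first by apply/existsP; exists i; rewrite ltnW//= e.
by rewrite e; apply: contraTneq ir => /a_inj ->; rewrite ltnn.
Qed.

End Decreasing.

Theorem theorem9p1 (R : realType) (m1 m2 n1 n2 : nat)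
  (Gamma : (R -> 'cV[R[i]]_(n1 + n2)) -> R -> 'cV[R[i]]_(m1 + m2))
  (Phi : R -> 'M[R[i]]_(m1 + m2, n1 + n2))
  (t : 'I_(minn m1 n1) -> R)
  (hPhi : superopt_symbol Phi Gamma)
  (ht : forall j : 'I_(minn m1 n1), superopt_sval Phi j (t j))
  (hess : forall j : 'I_(minn m1 n1), t j != 0 ->
     (essential_norm fb_dom fb_cod Gamma < (t j)%:E)%E)
  (l : nat) (a : 'I_l.+1 -> R)
  (a_decr : forall r s : 'I_l.+1, (r < s)%N -> a s < a r)
  (a_values : forall x : R,
     (exists r, x = a r) <-> (x != 0 /\ exists j, x = t j))
  (u : 'I_(minn m1 n1) -> R -> R[i])
  (W : 'I_(minn m1 n1) -> R -> 'M[R[i]]_(m1 + m2))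
  (V : 'I_(minn m1 n1) -> R -> 'M[R[i]]_(n1 + n2))
  (D : R -> 'M[R[i]]_(m1 + m2, n1 + n2))
  (k : 'I_(minn m1 n1) -> int)
  (hfact : thematic_factorization Phi t u W V D)
  (hk : forall j, t j != 0 -> toeplitz_index (u j) (k j))
  (u' : 'I_(minn m1 n1) -> R -> R[i])
  (W' : 'I_(minn m1 n1) -> R -> 'M[R[i]]_(m1 + m2))
  (V' : 'I_(minn m1 n1) -> R -> 'M[R[i]]_(n1 + n2))
  (D' : R -> 'M[R[i]]_(m1 + m2, n1 + n2))
  (k' : 'I_(minn m1 n1) -> int)
  (hfact' : thematic_factorization Phi t u' W' V' D')
  (hk' : forall j, t j != 0 -> toeplitz_index (u' j) (k' j)) :
  forall r : 'I_l.+1,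
    \sum_(j | t j == a r) k j = \sum_(j | t j == a r) k' j.
Proof.
have tge0 := superopt_ge0 hPhi ht.
have at_ i : exists j, a i = t j.
  by have [_ [j ->]] := (a_values (a i)).1 (ex_intro _ i erefl); exists j.
have a0 i : 0 < a i.
  have [n0 [j e]] := (a_values (a i)).1 (ex_intro _ i erefl).
  by rewrite lt_def n0 e tge0.
(* The least nonzero value provides one [tau2] that lies below [s ^+ 2] for every [s] in any of the
   sets [Z] used. *)
have [jl ejl] := at_ ord_max.
have [tau2 /andP[tau0 taul] few] : exists2 tau2, 0 <= tau2 < a ord_max ^+ 2 &
    few_large (mulop Phi) (@hX R n1 n2) (@hY R m1 m2) tau2.
  apply: (symbol_few_large hPhi.1 (a0 ord_max)); rewrite ejl; apply: hess.
  by rewrite -ejl gt_eqF.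
have a_le := decr_le a_decr; have a_inj := decr_inj a_decr.
(* Downward closure of [P] makes [Z] an initial segment: a nonzero [t j] outside [Z] lies below all
   of [Z]. The dimension on the common side does not involve the factorization, so both sums are
   equal to it. *)
have key (P : pred 'I_l.+1) : (forall i i' : 'I_l.+1, (i <= i')%N -> P i' -> P i) ->
    \sum_(j | [exists i, P i && (t j == a i)]) k j =
    \sum_(j | [exists i, P i && (t j == a i)]) k' j.
  move=> hP; pose Z := [seq a i | i <- enum 'I_l.+1 & P i].
  have memZ x : x \in Z = [exists i, P i && (x == a i)].
    apply/mapP/existsP => [[i0 ]|[i /andP[Pi /eqP xi]]].
      by rewrite mem_filter => /andP[Pi _] ->; exists i0; rewrite Pi eqxx.
    by exists i; rewrite // mem_filter Pi mem_enum.
  have uZ : uniq Z by rewrite map_inj_uniq// filter_uniq// enum_uniq.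
  have hZ s : s \in Z -> 0 < s /\ tau2 < s ^+ 2.
    move=> /mapP[i _ ->]; split=> //; apply: lt_le_trans taul _.
    apply: lerXn2r; [by rewrite nnegrE ltW|by rewrite nnegrE ltW|].
    by apply: a_le; rewrite -ltnS.
  have hL j : t j \in Z \/ forall s, s \in Z -> t j < s.
    have [tj0|tj0] := eqVneq (t j) 0.
      by right=> s /hZ[s0 _]; rewrite tj0.
    have [i ei] := (a_values (t j)).2 (conj tj0 (ex_intro _ j erefl)).
    have [Pi|nPi] := boolP (P i).
      by left; rewrite memZ; apply/existsP; exists i; rewrite Pi ei eqxx.
    right=> s /mapP[i']; rewrite mem_filter => /andP[Pi' _] ->.
    rewrite ei; apply: a_decr; rewrite ltnNge; apply: contra nPi => h; exact: hP h Pi'.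
  have [N dN eN] := thematic_dim hPhi ht hfact hk tau0 few uZ hZ hL.
  have [N' dN' eN'] := thematic_dim hPhi ht hfact' hk' tau0 few uZ hZ hL.
  under eq_bigl do rewrite -memZ; under [RHS]eq_bigl do rewrite -memZ.
  by rewrite eN eN' (dimH_uniq dN dN').
move=> r.
(* For [r = 0] the second instance has empty [Z]. *)
have e1 := key (fun i => (i <= r)%N) (fun i i' ii' h => leq_trans ii' h).
have e2 := key (fun i => (i < r)%N) (fun i i' ii' h => leq_ltn_trans ii' h).
move: e1; rewrite /= (sum_le_lt _ _ _ a_inj) (sum_le_lt k' _ _ a_inj) e2; exact: addIr.
Qed.
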